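(* The local normal zeta function of $F_{2,4}$ satisfies, for almost all primes $p$ (all but finitely many), the functional equation $$\zeta^{\triangleleft}_{F_{2,4},p}(s)\big|_{p\mapsto p^{-1}}=p^{45-14s}\cdot\zeta^{\triangleleft}_{F_{2,4},p}(s).$$ That is, there is a rational function $W(X,Y)\in\mathbb{Q}(X,Y)$ with $\zeta^{\triangleleft}_{F_{2,4},p}(s)=W(p,p^{-s})$ for almost all primes $p$, and $W(X^{-1},Y^{-1})=X^{45}Y^{14}\,W(X,Y)$.
   Context: $F_{2,4}=F_4/\gamma_3(F_4)$ is the free nilpotent group of class two on four generators ($F_4$ the free group on four generators, $\gamma_3$ the third term of the lower central series). For a finitely generated group $G$ and a prime $p$, $\zeta^{\triangleleft}_{G,p}(s)=\sum_{n\ge0}a^{\triangleleft}_{p^n}(G)p^{-ns}$, where $a^{\triangleleft}_{m}(G)$ is the number of normal subgroups of index $m$ in $G$. The notation $|_{p\mapsto p^{-1}}$ means that, when the function is written as a single rational function $W(p,p^{-s})$ valid for almost all $p$, one substitutes $p^{-1}$ for $p$ and $p^{s}$ for $p^{-s}$. *)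

(* Defs.v *)
From HB Require Import structures.
From mathcomp Require Import all_boot all_order all_algebra.
From mathcomp Require Import fraction polyXY.
From mathcomp Require Import finmap generic_quotient.
From mathcomp Require Import all_classical all_reals all_analysis.
From mathcomp Require Import complex.
Import numFieldNormedType.Exports.
Import Order.TTheory GRing.Theory Num.Theory.

Set Implicit Arguments.
Unset Strict Implicit.
Unset Printing Implicit Defensive.

Local Open Scope classical_set_scope.
Local Open Scope ring_scope.

Section FreeGroup.
Variable I : choiceType.

(* [(i, false)] is the generator [i] and [(i, true)] its inverse. *)
Definition letter : Type := (I * bool)%type.
HB.instance Definition _ := Choice.on letter.

Definition letter_inv (a : letter) : letter := (a.1, ~~ a.2).

Definition reduced (w : seq letter) : bool :=
  sorted (fun a b : letter => b != letter_inv a) w.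

Record free_group : Type := FreeGroup {
  free_word :> seq letter;
  free_wordP : reduced free_word }.

HB.instance Definition _ := [isSub for free_word].
HB.instance Definition _ := [Choice of free_group by <:].

(* The reduced form of [a :: w], for [w] reduced. *)
Definition push (a : letter) (w : seq letter) : seq letter :=
  if w is b :: w' then if b == letter_inv a then w' else a :: w else [:: a].

Definition rmul (u w : seq letter) : seq letter := foldr push w u.
Definition rinv (u : seq letter) : seq letter := rev (map letter_inv u).

Lemma letter_invK : involutive letter_inv.
Proof. by case=> i b; rewrite /letter_inv negbK. Qed.

Lemma push_reduced a w : reduced w -> reduced (push a w).
Proof.
case: w => [|b w] //=; case: ifPn => [_ /path_sorted //|ba bw].
by rewrite /reduced /= ba.
Qed.

Lemma rmul_reduced u w : reduced w -> reduced (rmul u w).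
Proof. by move=> rw; elim: u => //= a u; apply: push_reduced. Qed.

Lemma pushK a w : reduced w -> push (letter_inv a) (push a w) = w.
Proof.
case: w => [|b w] /=; first by rewrite letter_invK eqxx.
case: ifPn => [/eqP -> |ba] /=; last by rewrite letter_invK eqxx.
by case: w => [|c w] //= /andP[/negPf ->].
Qed.

Lemma rmul_push a u w : reduced w -> rmul (push a u) w = push a (rmul u w).
Proof.
move=> rw; case: u => [|b u] //=; case: ifPn => // /eqP -> /=.
by rewrite -{1}[a]letter_invK pushK // rmul_reduced.
Qed.

Lemma rmulA u v w : reduced w -> rmul u (rmul v w) = rmul (rmul u v) w.
Proof. by move=> rw; elim: u => //= a u ->; rewrite rmul_push. Qed.

Lemma rmul1 u : reduced u -> rmul u [::] = u.
Proof.
elim: u => //= a u IH rau; rewrite IH; last exact: path_sorted rau.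
by case: u rau {IH} => [|b u] //= /andP[/negPf ->].
Qed.

Lemma rmul_rcons u a w : rmul (rcons u a) w = rmul u (push a w).
Proof. by rewrite /rmul foldr_rcons. Qed.

Lemma rmulV u : reduced u -> rmul (rinv u) u = [::].
Proof.
elim: u => //= a u IH rau; rewrite /rinv /= rev_cons rmul_rcons /=.
by rewrite letter_invK eqxx; apply/IH/(path_sorted rau).
Qed.

Lemma rinv_reduced u : reduced u -> reduced (rinv u).
Proof.
rewrite /reduced /rinv rev_sorted sorted_map; apply: sub_sorted => a b /=.
by apply: contra => /eqP ->; rewrite letter_invK.
Qed.

Lemma rinvK u : rinv (rinv u) = u.
Proof. by rewrite /rinv map_rev revK mapK //; apply: letter_invK. Qed.

Definition free_one : free_group := @FreeGroup [::] isT.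
Definition free_mul (x y : free_group) : free_group :=
  FreeGroup (rmul_reduced x (free_wordP y)).
Definition free_inv (x : free_group) : free_group :=
  FreeGroup (rinv_reduced (free_wordP x)).

Lemma free_mulA : associative free_mul.
Proof. by move=> x y z; apply/val_inj/rmulA/free_wordP. Qed.
Lemma free_mul1 : left_id free_one free_mul.
Proof. by move=> x; apply/val_inj. Qed.
Lemma free_mul1r : right_id free_one free_mul.
Proof. by move=> x; apply/val_inj/rmul1/free_wordP. Qed.
Lemma free_mulV : left_inverse free_one free_inv free_mul.
Proof. by move=> x; apply/val_inj/rmulV/free_wordP. Qed.
Lemma free_mulrV : right_inverse free_one free_inv free_mul.
Proof.
move=> x; apply/val_inj; rewrite /= -{1}[free_word x]rinvK.
exact/rmulV/rinv_reduced/free_wordP.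
Qed.

HB.instance Definition _ := isGroup.Build free_group
  free_mulA free_mul1 free_mul1r free_mulV free_mulrV.

End FreeGroup.

Section Subgroups.
Variable G : groupType.
Implicit Types (A H : set G).

Definition is_subgroup H : Prop :=
  [/\ H 1%g, forall x y, H x -> H y -> H (x * y)%g & forall x, H x -> H x^-1%g].

Definition is_normal H : Prop :=
  is_subgroup H /\ forall x y, H x -> H (x ^ y)%g.

Definition generated A : set G := smallest is_subgroup A.

Definition commutator_subgroup A H : set G :=
  generated [set [~ x, y]%g | x in A & y in H].

(* Indexed so that [lower_central 1] is [G]; the value at [0] is irrelevant. *)
Definition lower_central (i : nat) : set G :=
  iter i.-1 (fun H => commutator_subgroup H setT) setT.

Definition left_coset H (x : G) : set G := [set (x * h)%g | h in H].

Definition has_index H (m : nat) : Prop := (range (left_coset H) #= `I_m)%card.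

Definition normal_subgroups_of_index (m : nat) : set (set G) :=
  [set H | is_normal H /\ has_index H m].

(* [fset_set] is only meaningful on finite sets; a finitely generated group
   has finitely many normal subgroups of each finite index. *)
Definition num_normal_subgroups (m : nat) : nat :=
  #|` fset_set (normal_subgroups_of_index m)|%fset.

End Subgroups.

Section Quotient.
Variables (G : groupType) (N : set G) (nN : is_normal N).

Definition coset_rel (x y : G) : bool := `[< N (x^-1 * y)%g >].

Lemma coset_rel_refl : reflexive coset_rel.
Proof. by move=> x; apply/asboolP; rewrite mulVg; case: nN => -[]. Qed.

Lemma coset_rel_sym : symmetric coset_rel.
Proof.
have [[_ _ NV] _] := nN.
by move=> x y; apply/asboolP/asboolP => /NV; rewrite invgM invgK.
Qed.

Lemma coset_rel_trans : transitive coset_rel.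
Proof.
have [[_ NM _] _] := nN.
move=> y x z /asboolP xy /asboolP yz; apply/asboolP.
have := NM _ _ xy yz; rewrite -mulgA mulVKg; apply.
Qed.

Canonical coset_equiv :=
  EquivRel coset_rel coset_rel_refl coset_rel_sym coset_rel_trans.

Definition quotient_group : Type := {eq_quot coset_equiv}%qT.
HB.instance Definition _ := Choice.on quotient_group.
HB.instance Definition _ := EqQuotient.on quotient_group.

Definition quo (x : G) : quotient_group := \pi_(quotient_group)%qT x.

Definition quo_one : quotient_group := quo 1%g.
Definition quo_mul (a b : quotient_group) : quotient_group :=
  quo (repr a * repr b)%g.
Definition quo_inv (a : quotient_group) : quotient_group := quo (repr a)^-1%g.

Lemma quo_eqP (x y : G) : quo x = quo y <-> N (x^-1 * y)%g.
Proof.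
split=> [/eqmodP/asboolP //|Nxy].
by apply/eqmodP/asboolP.
Qed.

Lemma quo_repr (x : G) : N ((repr (quo x))^-1 * x)%g.
Proof. by apply/quo_eqP; rewrite /quo reprK. Qed.

Lemma quo_mulE (x y : G) : quo_mul (quo x) (quo y) = quo (x * y)%g.
Proof.
have [[_ NM _] NJ] := nN; apply/quo_eqP.
set x' := repr _; set y' := repr _.
have Nx : N (x'^-1 * x)%g := quo_repr x.
have Ny : N (y'^-1 * y)%g := quo_repr y.
have := NM _ _ (NJ _ y' Nx) Ny.
by rewrite /conjg invgM !mulgA mulgK.
Qed.

Lemma quo_invE (x : G) : quo_inv (quo x) = quo x^-1%g.
Proof.
have [[_ _ NV] NJ] := nN; apply/quo_eqP; rewrite invgK.
have := NV _ (NJ _ (repr (quo x))^-1%g (quo_repr x)).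
by rewrite /conjg !invgM !invgK !mulgA mulgK.
Qed.

Lemma quo_mulA : associative quo_mul.
Proof.
elim/quotW=> x; elim/quotW=> y; elim/quotW=> z.
rewrite (quo_mulE y z) (quo_mulE x y) (quo_mulE x).
by rewrite (quo_mulE (x * y)%g) mulgA.
Qed.
Lemma quo_mul1 : left_id quo_one quo_mul.
Proof. by move=> a; elim/quotW: a => x; rewrite quo_mulE mul1g. Qed.
Lemma quo_mul1r : right_id quo_one quo_mul.
Proof. by move=> a; elim/quotW: a => x; rewrite quo_mulE mulg1. Qed.
Lemma quo_mulV : left_inverse quo_one quo_inv quo_mul.
Proof. by move=> a; elim/quotW: a => x; rewrite quo_invE quo_mulE mulVg. Qed.
Lemma quo_mulrV : right_inverse quo_one quo_inv quo_mul.
Proof. by move=> a; elim/quotW: a => x; rewrite quo_invE quo_mulE mulgV. Qed.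

HB.instance Definition _ := isGroup.Build quotient_group
  quo_mulA quo_mul1 quo_mul1r quo_mulV quo_mulrV.

End Quotient.

Section LowerCentralNormal.
Variable G : groupType.
Implicit Types (A H : set G).

Lemma generated_subgroup A : is_subgroup (generated A).
Proof.
split; first by move=> M [[]].
- move=> x y Ax Ay M MA; have [[_ MM _] _] := MA.
  exact: MM (Ax M MA) (Ay M MA).
- move=> x Ax M MA; have [[_ _ MV] _] := MA.
  exact: MV (Ax M MA).
Qed.

Lemma lower_central_normal (i : nat) : is_normal (@lower_central G i).
Proof.
rewrite /lower_central; elim: i.-1 => [|n [[H1 HM HV] HJ]] //=.
split; first exact: generated_subgroup.
move=> x y Kx; set K := commutator_subgroup _ _ in Kx *.
have [_ KM KV] : is_subgroup K := @generated_subgroup _.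
have KH : K `<=` iter n (fun H => commutator_subgroup H setT) setT.
  apply: smallest_sub => // _ [a Ha] [b _] <-.
  by apply: HM; [exact: HV | exact: HJ].
rewrite -[(x ^ y)%g](mulVKg x); apply: (KM _ _ Kx).
by apply: sub_gen_smallest; exists x; [exact: KH | exists y].
Qed.

End LowerCentralNormal.

(* [F_{c,d} = F_d / gamma_(c+1)(F_d)]. *)
Definition free_nilpotent (c d : nat) : groupType :=
  quotient_group (@lower_central_normal (free_group 'I_d) c.+1).

Section Zeta.
Variable R : realType.

(* [x ^ s = exp (s log x)], for [x > 0]. *)
Definition complex_pow (x : R) (s : R[i]) : R[i] :=
  (x `^ complex.Re s)%:C%C *
  (cos (complex.Im s * ln x) +i* sin (complex.Im s * ln x))%C.

Variable G : groupType.

Definition normal_zeta_term (p : nat) (s : R[i]) (n : nat) : R[i]^o :=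
  (num_normal_subgroups G (p ^ n))%:R * complex_pow p%:R (- (n%:R * s)).

Definition normal_zeta (p : nat) (s : R[i]) : R[i]^o :=
  limn (series (normal_zeta_term p s)).

End Zeta.

Local Notation "x %:F" := (@FracField.tofrac _ x).

(* [Q(X,Y)], with [X] the outer and [Y] the inner polynomial variable. *)
Definition ratfun2 : fieldType := {fraction {poly {poly rat}}}.
Definition rX : ratfun2 := ('X : {poly {poly rat}})%:F.
Definition rY : ratfun2 := ('Y : {poly {poly rat}})%:F.

Definition eval2 (K : fieldType) (N : {poly {poly rat}}) (x y : K) : K :=
  (map_poly (map_poly ratr) N).[x, y].

(* [W] is defined at [(x, y)] and [W(x, y) = w].  The point may have
   coordinates in any field of characteristic zero: a field of numbers, or
   [Q(X,Y)] itself, in which case this is substitution into [W]. *)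
Definition ratfun_value (K : fieldType) (W : ratfun2) (x y w : K) : Prop :=
  exists N D : {poly {poly rat}},
    [/\ W = N%:F / D%:F, eval2 D x y != 0 & w = eval2 N x y / eval2 D x y].

Definition almost_all_primes (P : nat -> Prop) : Prop :=
  finite_set [set p | prime p /\ ~ P p].

(* Main.v *)
(** A normal subgroup [N] of the class-two group on [Z^4 x Z^6] determines the
lattices [L] (its image in [Z^4]) and [M] (its intersection with the center
[Z^6]), where [M] contains the wedge products [x ^ y] of [x] in [L] with [y] in
[Z^4]; for odd index each such pair comes from [|Z^6 / M| ^ 4] normal subgroups.
The map [L |-> L' = {x | p x \in L}] sends pairs to pairs, and its fibers are
counted by subspaces over [F_p].  They depend only on the states of the two
pairs, the state [(nu, m)] being formed by the ranks of [Z^4 / L] and [Z^6 / M].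
The quotient of [Z^6] by the wedge products of [L] has rank ['C(nu, 2)], hence
[m <= 'C(nu, 2)], which leaves 15 states.  So the generating functions of the
states solve a triangular linear system, and the zeta function is an explicit
fraction whose denominator is a product of 14 factors [1 - X^a Y^b]; the
functional equation amounts to the numerator being palindromic, which is checked
by computation. *)

From Stdlib Require Import ZArith.
Require Import Defs.
From HB Require Import structures.
From mathcomp Require Import all_boot all_order all_algebra.
From mathcomp Require Import fraction polyXY finmap.
From mathcomp Require mxabelem.
From mathcomp Require Import all_classical all_reals all_analysis.
From mathcomp Require Import complex.
From mathcomp Require Import ring lra zify ssrZ.
Import numFieldNormedType.Exports.
Import Order.TTheory GRing.Theory Num.Theory.

Set Implicit Arguments.
Unset Strict Implicit.
Unset Printing Implicit Defensive.

Local Open Scope classical_set_scope.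
Local Open Scope ring_scope.

(** * Cardinalities of classical sets *)

(** Since [p x] lies in [L] exactly for [x] in [L'], one has [p L' <= L <= L'], and [L] is a
    subspace of [L' / p L'] that meets the kernel of [L' / p L' -> Z^n / p Z^n] trivially; the
    dimension of this kernel is the corank of [L']. The choices of [L] and [M] are tied together by
    the wedge products of [L] with [Z^4]. In a basis adapted to [L] these form a lattice in Smith
    form, whose own division by [p] is the wedge lattice of [L'] and thus lies in [M']. So they give
    a subspace of known dimension that avoids the kernel as well, and only ranks enter the count.
    The prime 2 is excluded because the normal subgroups over a pair are counted as homomorphisms
    from [L] to [Z^6 / M], after a change of coordinates that halves a cocycle modulo the index. The
    denominator has exponents [(174, 73)] and the numerator is palindromic for [(129, 59)]; the
    differences are [(45, 14)], and the 14 factors leave no sign. *)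

Definition ncard (T : eqType) (A : set T) (k : nat) : Prop :=
  exists s : seq T, [/\ uniq s, size s = k & forall x, A x <-> x \in s].

Lemma ncard_image (T U : eqType) (A : set T) (B : set U) (f : T -> U) k :
  (forall x, A x -> B (f x)) ->
  (forall x y, A x -> A y -> f x = f y -> x = y) ->
  (forall y, B y -> exists2 x, A x & f x = y) ->
  ncard A k -> ncard B k.
Proof.
move=> fAB finj fsurj [s [us <- As]]; exists (map f s); split.
- by rewrite map_inj_in_uniq // => x y /As Ax /As Ay; apply: finj.
- by rewrite size_map.
- move=> y; split=> [/fsurj[x /As xs <-]|/mapP[x /As Ax ->]]; last exact: fAB.
  exact: map_f.
Qed.

Lemma ncard_preimage (T U : eqType) (A : set T) (B : set U) (f : T -> U) k :
  (forall x, A x -> B (f x)) ->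
  (forall x y, A x -> A y -> f x = f y -> x = y) ->
  (forall y, B y -> exists2 x, A x & f x = y) ->
  ncard B k -> ncard A k.
Proof.
move=> fAB finj fsurj.
(* The values are optional because [T] may be empty while [U] is not. *)
have g_ex (y : U) : exists x : option T,
    B y -> exists x', [/\ x = Some x', A x' & f x' = y].
  have [By|nBy] := pselect (B y); last by exists None.
  by have [x Ax fx] := fsurj y By; exists (Some x) => _; exists x.
have [g gP] := choice g_ex.
move=> [s [us <- Bs]]; exists (pmap g s).
have gE y : y \in s -> exists x', [/\ g y = Some x', A x' & f x' = y].
  by move=> /Bs; apply: gP.
split.
- have gK : {in s, pcancel g (fun o => obind (fun x => Some (f x)) o)}.
    by move=> y /gE[x [-> _ /= ->]].
  elim: s us gE {Bs gK} => //= y s IH /andP[ys us] gE.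
  have [x [gy Ax fx]] := gE y (mem_head _ _).
  have gE' z : z \in s -> exists x', [/\ g z = Some x', A x' & f x' = z].
    by move=> zs; apply: gE; rewrite inE zs orbT.
  rewrite gy /= IH // andbT; apply: contra ys.
  rewrite mem_pmap => /mapP[z zs gz]; have [x' [gz' Ax' fx']] := gE' z zs.
  have [xx] : Some x = Some x' by rewrite gz gz'.
  by rewrite -fx xx fx'.
- rewrite size_pmap; apply/eqP; rewrite -all_count; apply/allP => y /gE.
  by move=> [x [-> _ _]].
- move=> x; rewrite mem_pmap; split=> [Ax|/mapP[y ys gy]].
    have /gP[x' [gx' Ax' fx']] := fAB _ Ax.
    apply/mapP; exists (f x); first exact/Bs/fAB.
    by rewrite gx'; congr Some; apply: finj.
  by have [x' [gx' Ax' _]] := gE y ys; move: gy; rewrite gx' => -[->].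
Qed.

Lemma ncard_unique (T : eqType) (A : set T) k l :
  ncard A k -> ncard A l -> k = l.
Proof.
move=> [s [us <- As]] [t [ut <- At]]; apply/eqP; rewrite eqn_leq.
by rewrite !uniq_leq_size // => x; [move=> /At/As|move=> /As/At].
Qed.

Lemma ncard_fibers (T U : eqType) (A : set T) (f : T -> U) (s : seq U)
    (c : U -> nat) :
  uniq s -> (forall x, A x -> f x \in s) ->
  (forall y, y \in s -> ncard [set x | A x /\ f x = y] (c y)) ->
  ncard A (\sum_(y <- s) c y).
Proof.
elim: s A => [|y s IH] A.
  move=> _ As _; rewrite big_nil; exists [::]; split=> // x.
  by split=> // /As; rewrite in_nil.
move=> /= /andP[ys us] As Ac; rewrite big_cons.
have [t1 [ut1 st1 t1P]] := Ac y (mem_head _ _).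
have [|z zs|t2 [ut2 st2 t2P]] := IH [set x | A x /\ f x \in s] us.
- by move=> x [].
- have zys : z \in y :: s by rewrite inE zs orbT.
  have [t [ut st tP]] := Ac z zys; exists t; split=> // x; split.
    by move=> [[Ax _] fx]; apply/tP.
  by move=> /tP[Ax fx]; split=> //; split=> //=; rewrite fx.
exists (t1 ++ t2); split.
- rewrite cat_uniq ut1 ut2 andbT /=; apply/hasPn => x /t2P[Ax fxs].
  by apply: contra ys => /t1P[_ <-].
- by rewrite size_cat st1 st2.
- move=> x; rewrite mem_cat; split.
    move=> Ax; have := As x Ax; rewrite inE => /predU1P[fx|fx].
      by apply/orP; left; apply/t1P.
    by apply/orP; right; apply/t2P.
  by move=> /orP[/t1P[]|/t2P[]].
Qed.

Lemma ncard_fibers_const (T U : eqType) (A : set T) (B : set U) (f : T -> U)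
    k c :
  ncard B k -> (forall x, A x -> B (f x)) ->
  (forall y, B y -> ncard [set x | A x /\ f x = y] c) ->
  ncard A (k * c)%N.
Proof.
move=> [s [us <- Bs]] AB Ac.
have := @ncard_fibers _ _ A f s (fun=> c) us.
rewrite big_const_seq count_predT iter_addn addn0 mulnC; apply.
  by move=> x /AB/Bs.
by move=> y /Bs; apply: Ac.
Qed.

Lemma ncard_finType (T : finType) (P : pred T) :
  ncard [set x | P x] #|[pred x | P x]|.
Proof.
exists (enum P); split; first exact: enum_uniq.
  by rewrite -cardE; apply: eq_card.
by move=> x; rewrite mem_enum.
Qed.

Lemma ncard_fset_set (T : choiceType) (A : set T) k :
  ncard A k -> #|` fset_set A|%fset = k.
Proof.
move=> [s [us <- As]].
suff -> : A = [set` [fset x in s]%fset].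
  by rewrite set_fsetK card_fseq undup_id.
by apply/seteqP; split=> x /=; rewrite inE => /As.
Qed.

Lemma ncard0 (T : eqType) (A : set T) : (forall x, ~ A x) -> ncard A 0.
Proof. by move=> A0; exists [::]; split=> // x; split=> // /A0. Qed.

(** With [ncard_fset_set], this passes from explicit lists, on which bijections and fibers are
    easily counted, to the cardinalities behind [has_index] and [num_normal_subgroups]. *)
Lemma card_eq_IIP (T : choiceType) (A : set T) k :
  ncard A k <-> (A #= `I_k)%card.
Proof.
split=> [[s [us <- As]]|Ak].
  suff -> : A = [set` [fset x in s]%fset].
    by apply/card_eq_fsetP; rewrite card_fseq undup_id.
  by apply/seteqP; split=> x /=; rewrite inE => /As.
have Afin : finite_set A by apply/finite_setP; exists k.
exists (enum_fset (fset_set A)); split; first exact: fset_uniq.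
  exact: card_fset_set.
by move=> x; split; rewrite (in_fset_set Afin) inE.
Qed.

(** * Subspaces of a finite vector space avoiding a given subspace *)

Section SubspaceCount.
Variable F : finFieldType.
Local Notation q := #|F|.

Lemma card_submx m n (A : 'M[F]_(m, n)) :
  #|[pred v : 'rV[F]_n | (v <= A)%MS]| = (q ^ \rank A)%N.
Proof. by rewrite -mxabelem.card_rowg; apply: eq_card =>
  v; rewrite mxabelem.mem_rowg. Qed.

Lemma mxrank_adds_row m n (v : 'rV[F]_n) (M : 'M[F]_(m, n)) :
  \rank (v + M)%MS = (~~ (v <= M)%MS + \rank M)%N.
Proof.
have [vM|nvM] /= := boolP (v <= M)%MS; first by rewrite (addsmx_idPr vM).
apply/eqP; rewrite eqn_leq; apply/andP; split.
  apply: leq_trans (leq_of_leqif (mxrank_adds_leqif v M)) _.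
  by rewrite leq_add2r rank_leq_row.
rewrite add1n ltn_neqAle mxrankS ?addsmxSr // andbT.
rewrite (mxrank_leqif_sup (addsmxSr v M)); apply: contra nvM.
exact/submx_trans/addsmxSl.
Qed.

(** The rows are chosen one at a time: after [i] rows independent modulo [S], the next one must
    avoid a space with [q ^ (\rank S + i)] elements. *)
Lemma card_independent n (S U : 'M[F]_n) j :
  (S <= U)%MS ->
  #|[pred V : 'M[F]_(j, n) | (V <= U)%MS
      & \rank (V + S)%MS == (j + \rank S)%N]|
  = (\prod_(i < j) (q ^ \rank U - q ^ (\rank S + i)))%N.
Proof.
move=> SU; elim: j => [|j IH].
  rewrite big_ord0 -sum1_card (eq_bigl (pred1 0)) ?big_pred1_eq // => V.
  by rewrite [V]flatmx0 !inE sub0mx adds0mx !eqxx.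
rewrite big_ord_recr /= -IH -sum1_card.
rewrite (reindex (fun Wv : 'M[F]_(j, n) * 'rV[F]_n =>
   col_mx Wv.2 Wv.1 : 'M[F]_(j.+1, n))) /=; last first.
  exists (fun V : 'M[F]_(1 + j, n) => (dsubmx V, usubmx V)) => V _ /=.
    by case: V => W v; rewrite col_mxKu col_mxKd.
  by rewrite vsubmxK.
rewrite (eq_bigl (fun Wv : 'M[F]_(j, n) * 'rV[F]_n =>
    [&& (Wv.1 <= U)%MS & \rank (Wv.1 + S)%MS == (j + \rank S)%N] &&
    ((Wv.2 <= U)%MS && ~~ (Wv.2 <= Wv.1 + S)%MS))); last first.
  move=> [W v] /=; rewrite !inE [(col_mx v W <= U)%MS]col_mx_sub.
  have -> : \rank (col_mx v W + S)%MS = \rank (v + (W + S))%MS.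
    by rewrite addsmxA -(adds_eqmx (addsmxE v W) (eqmx_refl S)).
  rewrite mxrank_adds_row; case: (v <= U)%MS; rewrite ?andbF //=.
  case: (W <= U)%MS; rewrite ?andbF //=.
  have : (\rank (W + S)%MS <= j + \rank S)%N.
    apply: leq_trans (leq_of_leqif (mxrank_adds_leqif W S)) _.
    by rewrite leq_add2r rank_leq_row.
  case: (v <= W + S)%MS => /=; last by rewrite andbT => _; apply/eqP/eqP; lia.
  rewrite andbF add0n => le; apply/negbTE/eqP => e.
  by rewrite e addSn ltnn in le.
rewrite -(pair_big_dep (fun W : 'M[F]_(j, n) => (W <= U)%MS &&
  (\rank (W + S)%MS == (j + \rank S)%N)) (fun W (v : 'rV[F]_n) =>
  (v <= U)%MS && ~~ (v <= W + S)%MS) (fun _ _ => 1%N)) /=.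
rewrite -sum_nat_const; apply: eq_big => [W|W /andP[WU /eqP rW]].
  by rewrite !inE.
rewrite sum1dep_card addnC -rW -!card_submx.
have <- := cardID [pred v : 'rV[F]_n | (v <= W + S)%MS] [pred v | (v <= U)%MS].
have -> : #|[predI [pred v : 'rV[F]_n | (v <= U)%MS]
               & [pred v | (v <= W + S)%MS]]|
          = #|[pred v : 'rV[F]_n | (v <= W + S)%MS]|.
  apply: eq_card => v; rewrite !inE andbC.
  case: (boolP (v <= W + S)%MS) => //= vWS.
  by rewrite (submx_trans vWS) // addsmx_sub WU.
by rewrite addKn; apply: eq_card => v; rewrite !inE andbC.
Qed.

(** Double counting of the [j]-tuples [V] independent modulo [S + T], sorted by the space
    [U = V + S]; the tuples over a given [U] are those in [U] independent modulo [S]. The condition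
    [<<U>> == U] picks one matrix for each subspace. *)
Lemma card_subspaces n (S T : 'M[F]_n) j :
  \rank (S :&: T)%MS = 0 ->
  (#|[pred U : 'M[F]_n | [&& <<U>>%MS == U, (S <= U)%MS,
        \rank (U :&: T)%MS == 0 & \rank U == j + \rank S]]|
    * \prod_(i < j) (q ^ (\rank S + j) - q ^ (\rank S + i))
  = \prod_(i < j) (q ^ n - q ^ (\rank S + \rank T + i)))%N.
Proof.
move=> ST0; set X := [pred U | _].
have rST : \rank (S + T)%MS = (\rank S + \rank T)%N.
  by have := mxrank_sum_cap S T; rewrite ST0 addn0.
have := @card_independent n (S + T)%MS 1%:M j (submx1 _).
rewrite mxrank1 rST => <-; rewrite -[RHS]sum1_card.
have rVS (V : 'M[F]_(j, n)) :
    (\rank (V + (S + T))%MS == j + (\rank S + \rank T))%N ->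
    (\rank (V + S)%MS = j + \rank S)%N /\ \rank ((V + S) :&: T)%MS = 0%N.
  move=> /eqP rVST.
  have le : (\rank (V + S)%MS <= j + \rank S)%N.
    apply: leq_trans (leq_of_leqif (mxrank_adds_leqif V S)) _.
    by rewrite leq_add2r rank_leq_row.
  have := mxrank_sum_cap (V + S)%MS T.
  have -> : \rank (V + S + T)%MS = \rank (V + (S + T))%MS.
    by rewrite addsmxA.
  by rewrite rVST; lia.
rewrite (partition_big (fun V : 'M[F]_(j, n) => <<(V + S)%MS>>%MS) X) /=;
  last first.
  move=> V; rewrite !inE submx1 /= => /rVS[rS rT].
  rewrite genmx_id eqxx !genmxE addsmxSr /= rS eqxx andbT.
  by rewrite (cap_eqmx (genmxE _) (eqmx_refl T)) rT.
rewrite -sum_nat_const; apply: eq_bigr => U; rewrite !inE.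
move=> /and4P[/eqP gU SU /eqP UT0 /eqP rU].
rewrite -(_ : \rank U = (\rank S + j)%N); last by rewrite rU addnC.
rewrite -(card_independent j SU) -[LHS]sum1_card; symmetry.
apply: eq_bigl => V; rewrite !inE.
rewrite submx1 /=; apply/andP/andP => [[VST /eqP VSU]|[VU rVS']].
  have [-> _] := rVS _ VST; split=> //.
  by rewrite -VSU genmxE addsmxSl.
have VSU : (V + S :=: U)%MS.
  apply/eqmxP; rewrite -(mxrank_leqif_eq (_ : (V + S <= U)%MS)) ?addsmx_sub ?VU //.
  by rewrite (eqP rVS') rU.
split; last by rewrite (eq_genmx VSU) gU.
rewrite addsmxA (adds_eqmx VSU (eqmx_refl T)).
by have := mxrank_sum_cap U T; rewrite UT0 rU; lia.
Qed.
End SubspaceCount.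

(** The Gaussian binomial coefficient, by the [q]-Pascal rule: without division, it can be repeated
    on polynomials in [zgauss]. *)
Fixpoint gauss (q n k : nat) : nat :=
  match k, n with
  | 0, _ => 1
  | _.+1, 0 => 0
  | k'.+1, n'.+1 => gauss q n' k' + q ^ k * gauss q n' k
  end.

Lemma prod_expn_sub_shift q n j r :
  (\prod_(i < j) (q ^ (r + n) - q ^ (r + i))
   = q ^ (r * j) * \prod_(i < j) (q ^ n - q ^ i))%N.
Proof.
under eq_bigr => i _ do rewrite !expnD -mulnBr.
by rewrite big_split /= prod_nat_const card_ord -expnM.
Qed.

Lemma prod_expn_subSS q n j :
  (\prod_(i < j.+1) (q ^ n.+1 - q ^ i)
   = (q ^ n.+1 - 1) * (q ^ j * \prod_(i < j) (q ^ n - q ^ i)))%N.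
Proof.
have := prod_expn_sub_shift q n j 1; rewrite mul1n => <-.
by rewrite big_ord_recl expn0.
Qed.

(** Both sides are the number of independent [j]-tuples in dimension [n], on the left sorted by
    their span. For [j > n] both vanish. *)
Lemma gaussE q n j : (0 < q)%N ->
  (gauss q n j * \prod_(i < j) (q ^ j - q ^ i) = \prod_(i < j) (q ^ n - q ^ i))%N.
Proof.
move=> q0; have prod0 m k : (m < k)%N -> (\prod_(i < k) (q ^ m - q ^ i) = 0)%N.
  by move=> mk; rewrite (bigD1 (Ordinal mk)) //= subnn.
elim: n j => [|n IH] [|j]; rewrite ?big_ord0 ?muln1 //.
  by rewrite mul0n prod0.
rewrite [gauss _ _ _]/= mulnDl -mulnA IH !prod_expn_subSS big_ord_recr /=.
have -> : (gauss q n j * ((q ^ j.+1 - 1) * (q ^ j * \prod_(i < j) (q ^ j - q ^ i)))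
    = (q ^ j.+1 - 1) * (q ^ j * (gauss q n j * \prod_(i < j) (q ^ j - q ^ i))))%N.
  by lia.
rewrite IH; have [jn|nj] := leqP j n; last by rewrite prod0 ?muln0.
have ab : (q ^ j <= q ^ n)%N by rewrite leq_pexp2l.
have a0 : (0 < q ^ j)%N by rewrite expn_gt0 q0.
have [d qn] : exists d, (q ^ n = q ^ j + d)%N.
  by exists (q ^ n - q ^ j)%N; rewrite subnKC.
rewrite !expnS qn addKn.
move: (q ^ j)%N a0 (\prod_(i < j) _)%N => a a0 P.
have c1 : (0 < q * a)%N by rewrite muln_gt0 q0.
by rewrite mulnDr -addnBAC // mulnDl; congr addn; ring.
Qed.

Lemma prod_expn_sub_gt0 q n : (1 < q)%N ->
  (0 < \prod_(i < n) (q ^ n - q ^ i))%N.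
Proof.
by move=> q1; rewrite prodn_gt0 // => i; rewrite subn_gt0 ltn_exp2l.
Qed.

(** The exponents in the products of [card_subspaces] are shifted by [\rank S] on one side and by
    [\rank S + \rank T] on the other; the quotient of the shifts is [q ^ (\rank T * j)]. *)
Lemma card_subspacesE (F : finFieldType) n (S T : 'M[F]_n) j :
  \rank (S :&: T)%MS = 0 ->
  (#|[pred U : 'M[F]_n | [&& <<U>>%MS == U, (S <= U)%MS,
        \rank (U :&: T)%MS == 0 & \rank U == j + \rank S]]|
   = #|F| ^ (\rank T * j) * gauss #|F| (n - \rank S - \rank T) j)%N.
Proof.
move=> ST0; have := card_subspaces j ST0; set X := #|_|.
have q1 : (1 < #|F|)%N by exact: card_finNzRing_gt1.
have rn : (\rank S + \rank T <= n)%N.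
  have := mxrank_sum_cap S T; rewrite ST0 addn0 => <-; exact: rank_leq_row.
under [RHS]eq_bigr => i _ do rewrite -{1}(subnKC rn) subnDA.
rewrite !prod_expn_sub_shift mulnCA.
rewrite mulnDl expnD -mulnA => /eqP.
rewrite eqn_pmul2l ?expn_gt0 ?(ltnW q1) // -(gaussE (n - \rank S - \rank T) j (ltnW q1)) mulnA.
by rewrite eqn_pmul2r ?prod_expn_sub_gt0 // => /eqP.
Qed.

(** * Subgroups of free abelian groups and Smith normal form *)

Lemma ncard_range (T : Type) (U W : eqType) (f : T -> U) (g : T -> W) k :
  (forall x y, f x = f y <-> g x = g y) ->
  ncard (range f) k -> ncard (range g) k.
Proof.
move=> fg; have h_ex (u : U) : exists w : option W,
    forall x, f x = u -> w = Some (g x).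
  have [[x fx]|nx] := pselect (exists x, f x = u).
    by exists (Some (g x)) => y fy; congr Some; apply/fg; rewrite fx fy.
  by exists None => y fy; case: nx; exists y.
have [h hP] := choice h_ex.
move=> cf; have : ncard [set w | exists x, w = Some (g x)] k.
  apply: (ncard_image (f := h)) cf => [u [x _ fx]|u v [x _ fx] [y _ fy]|w [x ->]].
  - by exists x; apply: hP.
  - by rewrite (hP _ x fx) (hP _ y fy) => -[/fg]; rewrite fx fy.
  - by exists (f x); [exists x|apply: hP].
apply: (ncard_preimage (f := Some)) => [w [x _ gx]|v w _ _ [->]|w [x ->]] //.
  by exists x; rewrite gx.
by exists (g x); first by exists x.
Qed.

Section Subgroup.
Variable V : zmodType.

Definition zsub (L : set V) : Prop :=
  L 0 /\ forall x y, L x -> L y -> L (x - y).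

Definition zcoset (L : set V) (x : V) : set V := [set y | L (x - y)].

Definition zindex (L : set V) (m : nat) : Prop := ncard (range (zcoset L)) m.

Variables (L : set V) (sL : zsub L).

Lemma zsubN x : L x -> L (- x).
Proof. by case: sL => L0 LB /(LB _ _ L0); rewrite sub0r. Qed.

Lemma zsubD x y : L x -> L y -> L (x + y).
Proof. by case: sL => _ LB Lx /zsubN /(LB _ _ Lx); rewrite opprK. Qed.

Lemma zsubMn x k : L x -> L (x *+ k).
Proof.
move=> Lx; elim: k => [|k IH]; first by case: sL.
by rewrite mulrS; apply: zsubD.
Qed.

Lemma zsubMz x k : L x -> L (x *~ k).
Proof. by case: k => k Lx; [|apply: zsubN]; apply: zsubMn. Qed.

Lemma zsub_sum I (r : seq I) (F : I -> V) :
  (forall i, L (F i)) -> L (\sum_(i <- r) F i).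
Proof.
move=> LF; elim: r => [|i r IH]; first by rewrite big_nil; case: sL.
by rewrite big_cons; apply: zsubD.
Qed.

Lemma zcosetP x y : zcoset L x = zcoset L y <-> L (x - y).
Proof.
split=> [e|Lxy].
  have : zcoset L y y by rewrite /zcoset /= subrr; case: sL.
  by rewrite -e.
apply/seteqP; split=> z; rewrite /zcoset /= => Lz.
  by have := zsubD (zsubN Lxy) Lz; rewrite opprB addrA subrK.
by have := zsubD Lxy Lz; rewrite addrA subrK.
Qed.

Lemma zindexP (U : eqType) (f : V -> U) m :
  (forall x y, f x = f y <-> L (x - y)) ->
  ncard (range f) m <-> zindex L m.
Proof.
move=> fL; split; apply: ncard_range => x y; by rewrite fL zcosetP.
Qed.

End Subgroup.

Lemma zsubZ n (L : set 'rV[int]_n) x (k : int) : zsub L -> L x -> L (k *: x).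
Proof. by move=> sL Lx; rewrite -[k]intz scaler_int; apply: zsubMz. Qed.

Lemma zsub_mulmx n m (L : set 'rV[int]_n) (M : 'M[int]_(m, n)) u :
  zsub L -> (forall i, L (row i M)) -> L (u *m M).
Proof.
move=> sL LM; rewrite mulmx_sum_row; apply: zsub_sum => // i.
exact: zsubZ.
Qed.

Lemma mxBE (V : zmodType) m n (A B : 'M[V]_(m, n)) i j :
  (A - B) i j = A i j - B i j.
Proof. by rewrite !mxE. Qed.

(** * Lattices in Smith form *)

Section Smith.
Variables (p n : nat).
Hypothesis p_pr : prime p.
Implicit Types (R : 'M[int]_n) (a : 'I_n -> nat) (L : set 'rV[int]_n).

(** For invertible [R], the lattice spanned by the rows of [R] multiplied by [p ^ a i]. Stated
    through divisibility of coordinates, it makes division by [p] a mere lowering of exponents. *)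
Definition smith R a : set 'rV[int]_n :=
  [set x : 'rV[int]_n | forall i, ((p ^ a i)%N %| (x *m invmx R) 0%R i)%Z].

Definition smith_basis R a : 'M[int]_n :=
  (diag_mx (\row_i (p ^ a i)%N%:Z)) *m R.

Lemma smith_sub R a : zsub (smith R a).
Proof.
split=> [i|x y Lx Ly i]; first by rewrite mul0mx mxE dvdz0.
by rewrite mulmxBl mxBE rpredB ?Lx ?Ly.
Qed.

Let p0 : p != 0%N. Proof. by rewrite -lt0n prime_gt0. Qed.

Lemma smithP R a x : R \in unitmx ->
  smith R a x <-> exists k, x = k *m smith_basis R a.
Proof.
move=> uR; split=> [Lx|[k ->] i]; last first.
  by rewrite mulmxA mulmxK // mul_mx_diag mxE [X in _ * X]mxE dvdz_mull.
exists (\row_i (((x *m invmx R) 0%R i) %/ (p ^ a i)%N)%Z).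
rewrite mulmxA -[LHS](mulmxKV uR); congr (_ *m _); apply/rowP => i.
by rewrite mul_mx_diag [RHS]mxE [X in _ = X * _]mxE [X in _ = _ * X]mxE divzK.
Qed.

Lemma smith_basis_inj R a (k : 'rV[int]_n) : R \in unitmx ->
  k *m smith_basis R a = 0 -> k = 0.
Proof.
move=> uR; rewrite mulmxA => /(congr1 (mulmx^~ (invmx R))).
rewrite mulmxK // mul0mx mul_mx_diag => /rowP k0; apply/rowP => i.
move: (k0 i); rewrite !mxE => /eqP; rewrite mulf_eq0 => /orP[/eqP //|].
by rewrite eqz_nat expn_eq0 (negbTE p0).
Qed.

Lemma smith_div R a x :
  smith R a (p%:Z *: x) <-> smith R (fun i => (a i).-1) x.
Proof.
have pxE i : ((p%:Z *: x) *m invmx R) 0%R i = p%:Z * (x *m invmx R) 0%R i.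
  by rewrite -scalemxAl mxE.
split=> Lx i; have := Lx i; rewrite pxE; case: (a i) => [|b] /=.
- by rewrite !dvd1z.
- by rewrite expnS PoszM dvdz_mul2l ?eqz_nat.
- by rewrite !dvd1z.
- by rewrite expnS PoszM dvdz_mul2l ?eqz_nat.
Qed.

Lemma smith_index R a : R \in unitmx -> zindex (smith R a) (p ^ \sum_i a i)%N.
Proof.
move=> uR.
pose N := (p ^ \sum_i a i)%N.
have aN i : (p ^ a i <= N)%N.
  by rewrite leq_pexp2l ?prime_gt0 // (bigD1 i) //= leq_addr.
have pa0 i : (p ^ a i)%N%:Z != 0 by rewrite eqz_nat expn_eq0 (negbTE p0).
(* The residues modulo the various [p ^ a i] share one ordinal type, since each [p ^ a i] is at most
   [N]. *)
pose f (x : 'rV[int]_n) : {ffun 'I_n -> 'I_N.+1} :=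
  [ffun i => inord `|(((x *m invmx R) 0%R i) %% (p ^ a i)%N)%Z|%N].
have fE x i : (f x i)%:Z = ((((x *m invmx R) 0%R i) %% (p ^ a i)%N)%Z).
  rewrite ffunE inordK ?gez0_abs ?modz_ge0 //.
  rewrite ltnS; apply: leq_trans (aN i); apply: ltnW.
  by rewrite -ltz_nat gez0_abs ?modz_ge0 // ltz_pmod // ltz_nat expn_gt0 prime_gt0.
have -> : (p ^ \sum_i a i)%N =
    #|family (fun i : 'I_n => [pred t : 'I_N.+1 | (t < p ^ a i)%N])|.
  rewrite card_family foldrE big_map big_enum /= expn_sum; apply: eq_bigr => i _.
  rewrite -[LHS]card_ord.
  pose w (t : 'I_(p ^ a i)) : 'I_N.+1 := widen_ord (leqW (aN i)) t.
  have winj : injective w by move=> s t /(congr1 val) /= /val_inj.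
  rewrite -(card_imset _ winj); apply: eq_card => t.
  apply/imsetP/idP => [[s _ ->]|ts]; first exact: (ltn_ord s).
  by exists (Ordinal (ts : (t < p ^ a i)%N)) => //; apply/val_inj.
apply/(@zindexP _ _ (smith_sub R a) _ f) => [x y|].
  split=> [fxy i|Lxy].
    rewrite mulmxBl mxBE -eqz_mod_dvd.
    by rewrite -!fE fxy.
  apply/ffunP => i; apply/val_inj/eqP; rewrite -eqz_nat !fE eqz_mod_dvd.
  by have := Lxy i; rewrite mulmxBl mxBE.
have := ncard_finType (family (fun i : 'I_n =>
  [pred t : 'I_N.+1 | (t < p ^ a i)%N])).
apply: (ncard_image (f := id)) => [g gF|//|g [x _ <-]].
  exists ((\row_i (g i : nat)%:Z) *m R) => //; apply/ffunP => i.
  apply/val_inj/eqP; rewrite -eqz_nat fE mulmxK // mxE modz_small //.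
  by rewrite /= ltz_nat; have /familyP/(_ i) := gF; rewrite inE.
exists (f x) => //; apply/familyP => i; rewrite inE -ltz_nat fE.
by rewrite ltz_pmod // ltz_nat expn_gt0 prime_gt0.
Qed.

End Smith.

(** As [L] contains [q Z^n], it is generated by the [q e_i] together with those of its elements
    whose entries lie in [[0, q)]. This provides the matrix to which the Smith normal form
    applies. *)
Lemma zsub_generators n q (L : set 'rV[int]_n) :
  (0 < q)%N -> zsub L -> (forall x, L (q%:Z *: x)) ->
  exists m (M : 'M[int]_(n + m, n)), forall x, L x <-> exists u, x = u *m M.
Proof.
move=> q0 sL Lq; pose T := {ffun 'I_n -> 'I_q}.
pose rep (g : T) : 'rV[int]_n := \row_i (g i : nat)%:Z.
pose G := \matrix_(i < #|T|)
  (if `[< L (rep (enum_val i)) >] then rep (enum_val i) else 0).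
have LG i : L (row i G).
  by rewrite rowK; case: asboolP => // _; case: sL.
exists #|T|, (col_mx q%:Z%:M G) => x; split=> [Lx|[u ->]]; last first.
  rewrite -[u]hsubmxK mul_row_col mul_mx_scalar.
  by apply: zsubD => //; apply: zsub_mulmx.
have qn0 : q%:Z != 0 by rewrite eqz_nat -lt0n.
have rq i : (`|x 0%R i %% q|%Z < q)%N.
  by rewrite -ltz_nat gez0_abs ?modz_ge0 ?ltz_pmod.
pose g : T := [ffun i => Ordinal (rq i)].
have xg : x = rep g + q%:Z *: \row_i (x 0%R i %/ q)%Z.
  apply/rowP => i; rewrite !mxE ffunE /= gez0_abs ?modz_ge0 //.
  by rewrite addrC mulrC -divz_eq.
have Lg : L (rep g).
  have -> : rep g = x - q%:Z *: \row_i (x 0%R i %/ q)%Z by rewrite {1}xg addrK.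
  by case: sL => _; apply.
exists (row_mx (\row_i (x 0%R i %/ q)%Z) (delta_mx 0 (enum_rank g))).
rewrite mul_row_col mul_mx_scalar -rowE rowK enum_rankK.
by case: asboolP => // _; rewrite {1}xg addrC.
Qed.

Lemma smith_exists n p k (L : set 'rV[int]_n) :
  prime p -> zsub L -> (forall x, L ((p ^ k)%N%:Z *: x)) ->
  exists R a, [/\ R \in unitmx, (forall i j : 'I_n, (i <= j)%N -> (a i <= a j)%N)
    & L = smith p R a].
Proof.
move=> p_pr sL Lq.
have q0 : (0 < p ^ k)%N by rewrite expn_gt0 prime_gt0.
have [m [M LM]] := zsub_generators q0 sL Lq.
have [P uP [R uR [d d_sorted MD]]] := int_Smith_normal_form M.
have LR x : L x <-> forall i : 'I_n, (d`_i %| (x *m invmx R) 0%R i)%Z.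
  split=> [/LM[u ->] i|Lx].
    rewrite MD !mulmxA mulmxK // mxE rpred_sum // => j _; rewrite [X in _ * X]mxE.
    by case: eqP => [->|_]; rewrite ?mulr1n ?mulr0n ?mulr0 ?dvdz0 // dvdz_mull.
  pose v := \row_i ((x *m invmx R) 0%R i %/ d`_i)%Z.
  apply/LM; exists (row_mx v 0 *m invmx P).
  rewrite MD -mulmxA !mulmxA mulmxKV // -[LHS](mulmxKV uR); congr (_ *m _).
  apply/rowP => j; rewrite [RHS]mxE big_split_ord /= [X in _ + X]big1 ?addr0.
    rewrite (bigD1 j) //= big1 ?addr0 => [|i ij].
      by rewrite row_mxEl [v _ _]mxE [X in _ * X]mxE /= eqxx mulr1n divzK.
    rewrite row_mxEl [X in _ * X]mxE /=.
    by rewrite -(inj_eq val_inj) in ij; rewrite (negPf ij) mulr0n mulr0.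
  by move=> i _; rewrite row_mxEr [X in X * _]mxE mul0r.
(* The multiple by [p ^ k] of the [i]-th row of [R] lies in [L], so every invariant factor is a
   power of [p] up to sign. *)
have dq (i : 'I_n) : (d`_i %| (p ^ k)%N%:Z)%Z.
  have /LR/(_ i) := Lq (delta_mx 0 i *m R).
  by rewrite scalemxAl mulmxK // !mxE !eqxx mulr1.
pose a (i : 'I_n) := logn p (absz (d`_i)%R).
have da (i : 'I_n) : (absz (d`_i)%R) = (p ^ a i)%N.
  have := dq i; rewrite dvdzE /= => /(dvdn_pfactor _ _ p_pr)[l _ dl].
  by rewrite /a dl pfactorK.
exists R, a; split=> // [i j ij|].
  (* Beyond the end of [d] one would read the default [0], which does not divide [p ^ k]. *)
  have ltd (l : 'I_n) : (l < size d)%N.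
    rewrite ltnNge; apply/negP => sd; have := dq l.
    by rewrite nth_default // dvd0z eqz_nat expn_eq0 -leqn0 leqNgt prime_gt0.
  have := sorted_leq_nth dvdz_trans dvdzz 0 d_sorted i j (ltd i) (ltd j) ij.
  by rewrite dvdzE !da dvdn_Pexp2l // prime_gt1.
apply/seteqP; split=> x; rewrite /smith /=; first move/LR => Lx i.
  by have := Lx i; rewrite !dvdzE da.
by move=> Lx; apply/LR => i; have := Lx i; rewrite !dvdzE da.
Qed.

(** * Lattices with a given quotient by [p] *)

Lemma scalez_inj m n (q : int) :
  q != 0 -> injective (fun x : 'M[int]_(m, n) => q *: x).
Proof.
move=> q0 x y /matrixP xy; apply/matrixP => i j.
by have := xy i j; rewrite !mxE => /(mulfI q0).
Qed.

Section Reduction.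
Variables (p n : nat).
Hypothesis p_pr : prime p.
Implicit Types (x k : 'rV[int]_n) (v : 'rV['F_p]_n) (L : set 'rV[int]_n).

Definition redp m (x : 'M[int]_(m, n)) : 'M['F_p]_(m, n) := map_mx intr x.

Definition zred L (M : 'M['F_p]_n) : Prop :=
  forall v, (v <= M)%MS <-> exists2 x, L x & redp x = v.

(** This is the dimension of [Z^n / (L + p Z^n)], hence the rank of the finite group [Z^n / L] when
    [L] has [p]-power index. *)
Definition zcorank L (nu : nat) : Prop :=
  exists2 M, zred L M & (\rank M + nu)%N = n.

Lemma redp_surj v : exists x, redp x = v.
Proof.
exists (\row_i (v 0 i : nat)%:Z); apply/rowP => i; rewrite !mxE.
exact: natr_Zp.
Qed.

Lemma redp_eq0 x : redp x = 0 <-> exists y, x = p%:Z *: y.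
Proof.
split=> [/rowP x0|[y ->]]; last first.
  apply/rowP => i; rewrite !mxE intrM.
  by rewrite (pchar_Fp_0 p_pr : (p%:Z)%:~R = 0 :> 'F_p) mul0r.
exists (\row_i (x 0%R i %/ p)%Z); apply/rowP => i; rewrite !mxE mulrC divzK //.
by rewrite (dvdz_pcharf (pchar_Fp p_pr)); move: (x0 i); rewrite !mxE => ->.
Qed.

Lemma redpD m (x y : 'M[int]_(m, n)) : redp (x + y) = redp x + redp y.
Proof. exact: map_mxD. Qed.

Lemma redpB m (x y : 'M[int]_(m, n)) : redp (x - y) = redp x - redp y.
Proof. exact: map_mxB. Qed.

Lemma redp_eq x y : redp x = redp y <-> exists z, x = y + p%:Z *: z.
Proof.
split=> [xy|[z ->]].
  have /redp_eq0[z xyz] : redp (x - y) = 0 by rewrite redpB xy subrr.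
  by exists z; rewrite -xyz addrC subrK.
by rewrite redpD (_ : redp (_ *: _) = 0) ?addr0 //; apply/redp_eq0; exists z.
Qed.

(** Over the prime field every scalar is a multiple of [1], so closure under addition already gives
    a subspace. *)
Lemma additive_rowspace (P : 'rV['F_p]_n -> Prop) :
  P 0 -> (forall u v, P u -> P v -> P (u + v)) ->
  exists M : 'M['F_p]_n, forall v, (v <= M)%MS <-> P v.
Proof.
move=> P0 PD.
have PZ (c : 'F_p) v : P v -> P (c *: v).
  rewrite -[c]natr_Zp scaler_nat => Pv; elim: (nat_of_ord c) => // m IH.
  by rewrite mulrS; apply: PD.
exists (\sum_(v : 'rV['F_p]_n | `[< P v >]) <<v>>)%MS => v; split; last first.
  move=> Pv; rewrite -(genmxE v); apply: (sumsmx_sup v) => //; exact/asboolP.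
move=> /sub_sumsmxP[u ->]; elim/big_ind: _ => // w /asboolP Pw.
have /sub_rVP[c ->] : (u w *m <<w>>%MS <= w)%MS.
  by rewrite (submx_trans (submxMl _ _)) // genmxE.
exact: PZ.
Qed.

Lemma zred_exists L : zsub L -> exists M, zred L M.
Proof.
move=> sL; apply: (@additive_rowspace (fun v => exists2 x, L x & redp x = v)).
  by exists 0; [case: sL|apply/redp_eq0; exists 0; rewrite scaler0].
move=> u v [x Lx <-] [y Ly <-]; exists (x + y); first exact: zsubD.
exact: redpD.
Qed.

Lemma zred_eqmx L M N : zred L M -> zred L N -> (M :=: N)%MS.
Proof.
move=> LM LN; apply/eqmxP/andP; split; apply/rV_subP => v.
  by move/LM/LN.
by move/LN/LM.
Qed.

Lemma zcorank_unique L nu mu : zcorank L nu -> zcorank L mu -> nu = mu.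
Proof.
move=> [M LM rM] [N LN rN];
  have e : \rank M = \rank N by rewrite (zred_eqmx LM LN).
by apply/eqP; rewrite -(eqn_add2l (\rank M)) rM e rN.
Qed.

End Reduction.

Section LatticeStep.
Variables (p n : nat) (R : 'M[int]_n) (a : 'I_n -> nat).
Hypotheses (p_pr : prime p) (uR : R \in unitmx).
Local Notation L' := (smith p R a).
Local Notation B := (smith_basis p R a).
Local Notation Bp := (redp p B).

Let pull (J : set 'rV[int]_n) : set 'rV[int]_n := [set k | J (k *m B)].

Let pull_sub J : zsub J -> zsub (pull J).
Proof.
move=> [J0 JB]; split=> [|x y Jx Jy]; rewrite /pull /= ?mul0mx //.
by rewrite mulmxBl; apply: JB.
Qed.

Let redpM (k : 'rV[int]_n) : redp p (k *m B) = redp p k *m Bp.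
Proof. exact: map_mxM. Qed.

Lemma smith_zred : zred L' Bp.
Proof.
move=> v; split=> [/submxP[u ->]|[x /(smithP _ _ _ uR)[k ->] <-]].
  have [k ku] := redp_surj u; exists (k *m B); last by rewrite redpM ku.
  by apply/smithP => //; exists k.
by rewrite redpM submxMl.
Qed.

(** If [k *m B] lies in [J] and vanishes modulo [p], it is [p y] with [y] in [L'], say [y = l *m B];
    then [k = p l], so [k] itself vanishes modulo [p]. Hence passing to coordinates preserves the
    rank of the reduction. *)
Lemma pull_zred J U :
  zsub J -> (forall x, J (p%:Z *: x) -> L' x) -> zred (pull J) U ->
  \rank (U :&: kermx Bp)%MS = 0%N /\ zred J (U *m Bp).
Proof.
move=> sJ JL UJ; split.
  apply/eqP; rewrite mxrank_eq0 -submx0; apply/rV_subP => v.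
  rewrite sub_capmx => /andP[/UJ[k Jk <-]].
  rewrite sub_kermx -redpM => /eqP/(redp_eq0 p_pr)[y ky].
  have /JL/(smithP _ _ _ uR)[l yl] : J (p%:Z *: y) by rewrite -ky.
  rewrite (_ : redp p k = 0) ?sub0mx //; apply/(redp_eq0 p_pr); exists l.
  apply/eqP; rewrite -subr_eq0; apply/eqP/(smith_basis_inj p_pr uR (a := a)).
  by rewrite mulmxBl ky yl -scalemxAl subrr.
move=> v; split=> [/submxP[u ->]|[x Jx <-]].
  have /UJ[k Jk ku] : (u *m U <= U)%MS by exact: submxMl.
  by exists (k *m B); rewrite // redpM ku mulmxA.
have /(smithP _ _ _ uR)[k xk] : L' x.
  by apply: JL; apply: zsubZ.
rewrite xk redpM submxMr //; apply/UJ; exists k => //.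
by rewrite /pull /= -xk.
Qed.

(* In the coordinates given by a basis of [L'], the lattices [L] correspond to the
   subspaces of [F_p^n] that meet the kernel of the reduced basis trivially. *)
Lemma card_lattice_step (K : set 'rV[int]_n) (M : 'M['F_p]_n) t nu j :
  zcorank p L' t -> zsub K -> (forall x, K (p%:Z *: x) -> L' x) ->
  zred K M -> (j + \rank M + nu)%N = n ->
  ncard [set L | [/\ zsub L, K `<=` L, (forall x, L (p%:Z *: x) <-> L' x)
    & zcorank p L nu]]
  (p ^ (t * j) * gauss p (n - \rank M - t) j)%N.
Proof.
move=> [N LN rN] sK KL KM jr.
have rB : \rank Bp = \rank N by rewrite (zred_eqmx smith_zred LN).
have rT : \rank (kermx Bp) = t by rewrite mxrank_ker rB; lia.
have [S KS] := zred_exists p_pr (pull_sub sK).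
have [ST0 KSB] := pull_zred sK KL KS.
have rankB (U : 'M['F_p]_n) : \rank (U :&: kermx Bp)%MS = 0%N ->
    \rank (U *m Bp) = \rank U.
  by move=> UT0; have := mxrank_mul_ker U Bp; rewrite UT0 addn0.
have rS : \rank S = \rank M by rewrite -rankB // (zred_eqmx KSB KM).
have JL (J : set 'rV[int]_n) : zsub J -> (forall x, J (p%:Z *: x) -> L' x) ->
    forall x, J x -> exists2 k, x = k *m B & pull J k.
  move=> sJ JL x Jx; have /(smithP _ _ _ uR)[k xk] : L' x.
    by apply: JL; apply: zsubZ.
  by exists k; rewrite /pull /= -?xk.
have := card_subspacesE j ST0; rewrite card_Fp // rS rT => <-.
pose f (U : 'M['F_p]_n) : set 'rV[int]_n :=
  [set x | exists2 k, x = k *m B & (redp p k <= U)%MS].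
have fE U k : f U (k *m B) <-> (redp p k <= U)%MS.
  split=> [[l kl]|]; last by exists k.
  rewrite (_ : k = l) //; apply/eqP; rewrite -subr_eq0; apply/eqP.
  by apply: (smith_basis_inj p_pr uR (a := a)); rewrite mulmxBl kl subrr.
have redp0 : redp p (0 : 'rV[int]_n) = 0.
  by apply/(redp_eq0 p_pr); exists 0; rewrite scaler0.
have redpp (k : 'rV[int]_n) : redp p (p%:Z *: k) = 0.
  by apply/(redp_eq0 p_pr); exists k.
have f_sub U : zsub (f U).
  split=> [|_ _ [k -> kU] [l -> lU]].
    by exists 0; rewrite ?mul0mx // redp0 sub0mx.
  by exists (k - l); rewrite ?mulmxBl // redpB addmx_sub // eqmx_opp.
have f_div U x : \rank (U :&: kermx Bp)%MS = 0%N ->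
    f U (p%:Z *: x) <-> L' x.
  move=> UT0; split=> [[k xk kU]|/(smithP _ _ _ uR)[k ->]]; last first.
    by rewrite scalemxAl; apply/fE; rewrite redpp sub0mx.
  have : (redp p k <= U :&: kermx Bp)%MS.
    by rewrite sub_capmx kU sub_kermx -redpM -xk redpp eqxx.
  move/eqP: UT0; rewrite mxrank_eq0 => /eqP ->; rewrite submx0 => /eqP.
  move=> /(redp_eq0 p_pr)[l kl]; apply/(smithP _ _ _ uR); exists l.
  apply: (@scalez_inj _ _ p%:Z); first by rewrite eqz_nat -lt0n prime_gt0.
  by rewrite /= xk kl scalemxAl.
have f_zred U : zred (pull (f U)) U.
  move=> v; split=> [vU|[k /fE kU <-]] //.
  by have [k kv] := redp_surj v; exists k => //; apply/fE; rewrite kv.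
apply: ncard_image (ncard_finType _) => [U|U1 U2|L].
- move=> /= /and4P[_ SU /eqP UT0 /eqP rU].
  have fUL x : f U (p%:Z *: x) <-> L' x := f_div U x UT0.
  split=> //.
    move=> x /(JL K sK KL)[k -> Kk]; apply/fE.
    by apply: submx_trans SU; apply/KS; exists k.
  have [_ fUB] := pull_zred (f_sub U) (fun x => (fUL x).1) (f_zred U).
  by exists (U *m Bp) => //; rewrite rankB // rU.
- move=> /= /and4P[/eqP gU1 _ _ _] /and4P[/eqP gU2 _ _ _] e.
  rewrite -gU1 -gU2; apply/genmxP/andP.
  have sub V W : f V = f W -> (V <= W)%MS.
    move=> VW; apply/rV_subP => v; have [k <-] := redp_surj v.
    by move=> kV; apply/fE; rewrite -VW; apply/fE.
  by split; apply: sub.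
- move=> [sL KLs Ldiv [Q LQ rQ]].
  have Ldiv1 x : L (p%:Z *: x) -> L' x by move/Ldiv.
  have [U0 LU0] := zred_exists p_pr (pull_sub sL).
  pose U := <<U0>>%MS.
  have LU : zred (pull L) U by move=> v; rewrite genmxE; apply: LU0.
  have [UT0 LUB] := pull_zred sL Ldiv1 LU.
  have rU : \rank U = \rank Q by rewrite -rankB // (zred_eqmx LUB LQ).
  exists U.
    rewrite /= genmx_id eqxx UT0 eqxx rU /=; apply/andP; split.
      apply/rV_subP => v /KS[k Kk kv]; apply/LU; exists k => //.
      exact: KLs.
    by apply/eqP; lia.
  apply/seteqP; split=> x.
    move=> [k -> /LU[l Ll /(redp_eq p_pr)[z lk]]].
    have -> : k *m B = l *m B - p%:Z *: (z *m B).
      by rewrite scalemxAl -mulmxBl lk addrK.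
    have /Ldiv Lz : L' (z *m B) by apply/(smithP _ _ _ uR); exists z.
    by case: sL => _; apply.
  by move=> /(JL L sL Ldiv1)[k -> Lk]; apply/fE/LU; exists k.
Qed.

End LatticeStep.

(** * Exterior squares of lattices *)

Lemma ord_down_closed n (P : pred 'I_n) (i : 'I_n) :
  (forall j k : 'I_n, (j <= k)%N -> P k -> P j) ->
  P i = (i < #|[pred j | P j]|)%N.
Proof.
move=> Pdown; have card_lt m : (m <= n)%N -> #|[pred j : 'I_n | (j < m)%N]| = m.
  move=> mn; have winj : injective (widen_ord mn).
    by move=> s t /(congr1 val) /= /val_inj.
  rewrite -[RHS]card_ord -(card_imset _ winj).
  apply: eq_card => j; rewrite !inE; apply/idP/imsetP => [jm|[k _ ->]] //=.
  by exists (Ordinal jm) => //; apply/val_inj.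
apply/idP/idP => [Pi|]; last apply: contraLR => nPi; rewrite -?leqNgt.
  rewrite -[X in (X <= _)%N](card_lt i.+1) //;
    apply/subset_leq_card/fintype.subsetP => j.
  by rewrite !inE ltnS => ji; apply: Pdown ji Pi.
rewrite -[X in (_ <= X)%N](card_lt i (ltnW (ltn_ord i))).
apply/subset_leq_card/fintype.subsetP => j; rewrite !inE => Pj; rewrite ltnNge.
by apply: contra nPi => ij; apply: Pdown ij Pj.
Qed.

Section SmithRank.
Variables (p n : nat) (R : 'M[int]_n) (a : 'I_n -> nat).
Hypotheses (p_pr : prime p) (uR : R \in unitmx).
Hypothesis a_mono : forall i j : 'I_n, (i <= j)%N -> (a i <= a j)%N.

(** The exponents increase, so the zero exponents come first and the diagonal matrix reduces to
    [pid_mx]. *)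
Lemma smith_rank :
  \rank (redp p (smith_basis p R a)) = #|[pred i | a i == 0%N]|.
Proof.
rewrite /smith_basis /redp map_mxM mxrankMfree; last first.
  rewrite row_free_unit; move: uR; rewrite !unitmxE det_map_mx.
  exact: rmorph_unit.
set r := #|_|; have rn : (r <= n)%N by rewrite /r -[X in (_ <= X)%N]card_ord max_card.
suff -> : map_mx intr (diag_mx (\row_i (p ^ a i)%N%:Z)) = pid_mx r :> 'M['F_p]_n.
  exact: rank_pid_mx.
apply/matrixP => i j; rewrite !mxE.
have -> : (i < r)%N = (a i == 0%N).
  rewrite -(@ord_down_closed n (fun i => a i == 0%N)) // => k l kl.
  by rewrite -!leqn0; apply: leq_trans; apply: a_mono.
rewrite (_ : (i == j) = (i == j :> nat)) //;
  case: (val i =P val j) => [/val_inj ->|_] /=;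
  last by rewrite mulr0n.
rewrite ?eqxx mulr1n /=; case: (a j) => [|b]; first by rewrite expn0.
rewrite expnS PoszM intrM.
by rewrite (pchar_Fp_0 p_pr : (p%:Z)%:~R = 0 :> 'F_p) mul0r.
Qed.

Lemma smith_corank : zcorank p (smith p R a) #|[pred i | (0 < a i)%N]|.
Proof.
exists (redp p (smith_basis p R a)); first exact: smith_zred.
rewrite smith_rank -[RHS]card_ord -(cardC [pred i | a i == 0%N]).
by congr addn; apply: eq_card => i; rewrite !inE lt0n.
Qed.

End SmithRank.

(** The six pairs [i < j] are numbered lexicographically. This makes [wedge_fst] monotone, so
    increasing exponents [a] yield increasing exponents [a \o wedge_fst]. *)
Definition wedge_fst (k : 'I_6) : 'I_4 :=
  match val k with
  | 0 | 1 | 2 => @Ordinal 4 0 isT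
  | 3 | 4 => @Ordinal 4 1 isT
  | _ => @Ordinal 4 2 isT
  end.

Definition wedge_snd (k : 'I_6) : 'I_4 :=
  match val k with
  | 0 => @Ordinal 4 1 isT
  | 1 | 3 => @Ordinal 4 2 isT
  | _ => @Ordinal 4 3 isT
  end.

Definition wedge (x y : 'rV[int]_4) : 'rV[int]_6 :=
  \row_k (x 0 (wedge_fst k) * y 0 (wedge_snd k)
          - x 0 (wedge_snd k) * y 0 (wedge_fst k)).

(** The second compound matrix, that is, the exterior square of [R]. *)
Definition wedge_mx (R : 'M[int]_4) : 'M[int]_6 :=
  \matrix_k wedge (row (wedge_fst k) R) (row (wedge_snd k) R).

Lemma sum_ord4 (V : nmodType) (f : 'I_4 -> V) :
  \sum_i f i = f (@Ordinal 4 0 isT) + f (@Ordinal 4 1 isT)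
             + f (@Ordinal 4 2 isT) + f (@Ordinal 4 3 isT).
Proof.
rewrite !big_ord_recl big_ord0 addr0 !addrA.
by do !congr (_ + _); congr f; apply/val_inj.
Qed.

Lemma sum_ord6 (V : nmodType) (f : 'I_6 -> V) :
  \sum_i f i = f (@Ordinal 6 0 isT) + f (@Ordinal 6 1 isT)
             + f (@Ordinal 6 2 isT) + f (@Ordinal 6 3 isT)
             + f (@Ordinal 6 4 isT) + f (@Ordinal 6 5 isT).
Proof.
rewrite !big_ord_recl big_ord0 addr0 !addrA.
by do !congr (_ + _); congr f; apply/val_inj.
Qed.

Lemma wedge_mulmx (x y : 'rV[int]_4) R :
  wedge (x *m R) (y *m R) = wedge x y *m wedge_mx R.
Proof.
apply/rowP => l; rewrite !mxE !sum_ord4 sum_ord6 !mxE /=.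
rewrite /wedge_fst /wedge_snd /=.
ring.
Qed.

Lemma wedge_mxM R S : wedge_mx (R *m S) = wedge_mx R *m wedge_mx S.
Proof.
by apply/row_matrixP => k; rewrite row_mul !rowK !row_mul wedge_mulmx.
Qed.

Lemma wedge_mx1 : wedge_mx 1%:M = 1%:M.
Proof.
apply/matrixP => k l; rewrite !mxE.
by case: k => [[|[|[|[|[|[|k]]]]]] kp] //; case: l => [[|[|[|[|[|[|l]]]]]] lp].
Qed.

Lemma wedge_mx_unit R : R \in unitmx ->
  wedge_mx R \in unitmx /\ invmx (wedge_mx R) = wedge_mx (invmx R).
Proof.
move=> uR; have e : wedge_mx R *m wedge_mx (invmx R) = 1%:M.
  by rewrite -wedge_mxM mulmxV // wedge_mx1.
have [uW _] := mulmx1_unit e; split=> //.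
by rewrite -[LHS]mulmx1 -e mulKmx.
Qed.

(** * Pairs of lattices *)

Lemma wedge_fst_mono (k l : 'I_6) : (k <= l)%N -> (wedge_fst k <= wedge_fst l)%N.
Proof.
by case: k => [[|[|[|[|[|[|k]]]]]] kp] //; case: l => [[|[|[|[|[|[|l]]]]]] lp].
Qed.

Lemma wedge_fst_lt (k : 'I_6) : (wedge_fst k < wedge_snd k)%N.
Proof. by case: k => [[|[|[|[|[|[|k]]]]]] kp]. Qed.

(** The excluded pairs have both entries among the last [4 - r] indices. *)
Lemma card_wedge_fst r : (r <= 4)%N ->
  #|[pred k : 'I_6 | (wedge_fst k < r)%N]| = (6 - 'C(4 - r, 2))%N.
Proof.
rewrite -sum1_card big_mkcond /= sum_ord6.
by case: r => [|[|[|[|[|]]]]].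
Qed.

Lemma row_smith_basis p n (R : 'M[int]_n) a i :
  row i (smith_basis p R a) = (p ^ a i)%N%:Z *: row i R.
Proof. by apply/rowP => l; rewrite mxE /smith_basis mul_diag_mx !mxE. Qed.

(** Normality seen on the pair of lattices: conjugation by [(x', y')] adds [wedge x x'] to the
    central part of [(x, y)]. *)
Definition absorbs (L : set 'rV[int]_4) (M : set 'rV[int]_6) : Prop :=
  forall x y, L x -> M (wedge x y).

Section Commutators.
Variables (p : nat) (R : 'M[int]_4) (a : 'I_4 -> nat).
Hypotheses (p_pr : prime p) (uR : R \in unitmx).
Hypothesis a_mono : forall i j : 'I_4, (i <= j)%N -> (a i <= a j)%N.

(** With [r_i] the rows of [R] and [i < j], the element [r_i ^ r_j] is obtained with the factors
    [p ^ a i] and [p ^ a j], and the first divides the second. So the wedge products of [L] generate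
    a lattice in Smith form with exponents [a \o wedge_fst]. *)
Lemma absorbs_smith (M : set 'rV[int]_6) : zsub M ->
  absorbs (smith p R a) M <-> smith p (wedge_mx R) (a \o wedge_fst) `<=` M.
Proof.
have [uW iW] := wedge_mx_unit uR.
move=> sM; split=> [aM x /(smithP _ _ _ uW)[k ->]|KM x y].
  apply: zsub_mulmx => // i.
  have -> : row i (smith_basis p (wedge_mx R) (a \o wedge_fst)) =
    wedge ((p ^ a (wedge_fst i))%N%:Z *: row (wedge_fst i) R)
          (row (wedge_snd i) R).
    rewrite row_smith_basis rowK; apply/rowP => l; rewrite !mxE /=; ring.
  apply: aM; apply/smithP => //; exists (delta_mx 0 (wedge_fst i)).
  by rewrite -rowE row_smith_basis.
move=> /(smithP _ _ _ uR)[k ->]; apply: KM => i; rewrite iW.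
rewrite -[y](mulmxKV uR) mulmxA wedge_mulmx -mulmxA -wedge_mxM mulmxV //.
rewrite wedge_mx1 mulmx1 mxE !mul_mx_diag.
set z := y *m _; rewrite !mxE /=.
have /dvdn_exp2l dab := a_mono (ltnW (wedge_fst_lt i)).
apply: rpredB; first by rewrite mulrAC dvdz_mull.
by rewrite mulrAC dvdz_mull // dvdzE /= dab.
Qed.

End Commutators.

(** * Lattices of [p]-power index and their division by [p] *)

Definition plattice p n (L : set 'rV[int]_n) : Prop :=
  zsub L /\ exists k, forall x, L ((p ^ k)%N%:Z *: x).

Definition zdiv p n (L : set 'rV[int]_n) : set 'rV[int]_n :=
  [set x | L (p%:Z *: x)].

Section PLattices.
Variables (p n : nat).
Hypothesis p_pr : prime p.
Implicit Types (L : set 'rV[int]_n).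

Lemma plattice_smith (R : 'M[int]_n) a : R \in unitmx -> plattice p (smith p R a).
Proof.
move=> uR; split; first exact: smith_sub.
exists (\sum_i a i)%N => x i; rewrite -scalemxAl mxE dvdz_mulr // dvdzE /=.
by rewrite dvdn_exp2l // (bigD1 i) //= leq_addr.
Qed.

Lemma plattice_smithP L : plattice p L -> exists (R : 'M[int]_n) a,
  [/\ R \in unitmx, (forall i j : 'I_n, (i <= j)%N -> (a i <= a j)%N)
    & L = smith p R a].
Proof. by move=> [sL [k Lk]]; apply: smith_exists Lk. Qed.

Lemma zindex_unique L i j :
  zindex L (p ^ i)%N -> zindex L (p ^ j)%N -> i = j.
Proof.
by move=> Li Lj; apply: (expnI (prime_gt1 p_pr)); apply: ncard_unique Li Lj.
Qed.

Lemma plattice_data L : plattice p L ->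
  exists i nu, zindex L (p ^ i)%N /\ zcorank p L nu.
Proof.
move=> /plattice_smithP[R [a [uR a_mono ->]]].
exists (\sum_i a i)%N, #|[pred i | (0 < a i)%N]|.
by split; [apply: smith_index|apply: smith_corank].
Qed.

Lemma zdiv_smith (R : 'M[int]_n) a :
  zdiv p (smith p R a) = smith p R (fun i => (a i).-1).
Proof.
apply/seteqP; split=> x Lx; first exact: (smith_div p_pr R a x).1 Lx.
exact: (smith_div p_pr R a x).2 Lx.
Qed.

(** Division by [p] lowers each positive exponent by one, and the corank is the number of positive
    exponents. *)
Lemma zdiv_plattice L i nu :
  plattice p L -> zindex L (p ^ i)%N -> zcorank p L nu ->
  [/\ plattice p (zdiv p L), (nu <= i)%N & zindex (zdiv p L) (p ^ (i - nu))%N].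
Proof.
move=> /plattice_smithP[R [a [uR a_mono ->]]] Li Lnu.
have {Li} <- := zindex_unique (smith_index p_pr a uR) Li.
have {Lnu} <- := zcorank_unique (smith_corank p_pr uR a_mono) Lnu.
have aE : (\sum_i a i = \sum_i (a i).-1 + #|[pred i | (0 < a i)%N]|)%N.
  rewrite -sum1_card [X in (_ + X)%N]big_mkcond /= -big_split /=;
    apply: eq_bigr => j _.
  by rewrite ?inE; case: (a j) => [|b]; rewrite ?addn1.
rewrite zdiv_smith aE addnK leq_addl; split=> //.
  exact: plattice_smith.
exact: smith_index.
Qed.

Lemma plattice_zdiv L : zsub L -> plattice p (zdiv p L) -> plattice p L.
Proof.
move=> sL [_ [k Lk]]; split=> //; exists k.+1 => x.
by rewrite expnS PoszM -scalerA; apply: Lk.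
Qed.

Lemma zindex_zdiv L i nu : plattice p L ->
  zindex (zdiv p L) (p ^ i)%N -> zcorank p L nu -> zindex L (p ^ (i + nu))%N.
Proof.
move=> pL Li Lnu; have [j [_ [Lj _]]] := plattice_data pL.
have [_ nuj Lj'] := zdiv_plattice pL Lj Lnu.
by rewrite (zindex_unique Li Lj') subnK.
Qed.

Lemma plattice_corank0 L i : plattice p L -> zcorank p L 0 ->
  zindex L (p ^ i)%N -> L = setT /\ i = 0%N.
Proof.
move=> /plattice_smithP[R [a [uR a_mono ->]]] L0 Li.
have /card0_eq a0 := zcorank_unique (smith_corank p_pr uR a_mono) L0.
have {}a0 j : a j = 0%N by apply/eqP; have := a0 j; rewrite !inE lt0n => /negPn.
split; last by rewrite -(zindex_unique (smith_index p_pr a uR) Li) big1.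
by apply/seteqP; split=> // x _ j; rewrite a0 expn0 dvd1z.
Qed.

Lemma plattice_setT : [/\ plattice p [set: 'rV[int]_n],
  zindex [set: 'rV[int]_n] (p ^ 0)%N & zcorank p [set: 'rV[int]_n] 0].
Proof.
have -> : [set: 'rV[int]_n] = smith p 1%:M (fun=> 0%N).
  by apply/seteqP; split=> // x _ j; rewrite expn0 dvd1z.
split; first by apply: plattice_smith; rewrite unitmx1.
  have := smith_index p_pr (fun=> 0%N) (unitmx1 _ n).
  by rewrite big1_eq; apply.
have := @smith_corank p n 1%:M (fun=> 0%N) p_pr (unitmx1 _ n).
by rewrite eq_card0 //; apply.
Qed.

End PLattices.

Definition lattice_pairs (p i j nu m : nat) :
    set (set 'rV[int]_4 * set 'rV[int]_6) :=
  [set LM | [/\ plattice p LM.1 /\ plattice p LM.2, absorbs LM.1 LM.2,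
    zindex LM.1 (p ^ i)%N /\ zindex LM.2 (p ^ j)%N
    & zcorank p LM.1 nu /\ zcorank p LM.2 m]].

(* The number of pairs in state [(nu, m)] over a pair in state [(nu', m')]. *)
Definition step_weight (p nu m nu' m' : nat) : nat :=
  (p ^ (nu' * (4 - nu)) * gauss p (4 - nu') (4 - nu) *
   (p ^ (m' * ('C(nu, 2) - m)) * gauss p ('C(nu, 2) - m') ('C(nu, 2) - m)))%N.

Lemma zred_rank_le p n (L K : set 'rV[int]_n) (M N : 'M['F_p]_n) :
  K `<=` L -> zred K M -> zred L N -> (\rank M <= \rank N)%N.
Proof.
move=> KL KM LN; apply: mxrankS; apply/rV_subP => v /KM[x Kx xv].
by apply/LN; exists x => //; apply: KL.
Qed.

Section Pairs.
Variable p : nat.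
Hypothesis p_pr : prime p.

(** The exponent of a pair vanishes when its first index is among the [4 - nu] indices with exponent
    zero. *)
Lemma commutators_rank (R : 'M[int]_4) a nu : R \in unitmx ->
  (forall i j : 'I_4, (i <= j)%N -> (a i <= a j)%N) ->
  zcorank p (smith p R a) nu ->
  \rank (redp p (smith_basis p (wedge_mx R) (a \o wedge_fst))) = (6 - 'C(nu, 2))%N.
Proof.
move=> uR a_mono /(zcorank_unique (smith_corank p_pr uR a_mono)) <-.
have [uW _] := wedge_mx_unit uR.
rewrite smith_rank //; last by move=> k l kl; apply/a_mono/wedge_fst_mono.
set r := #|[pred i | a i == 0%N]|.
have r4 : (r <= 4)%N by rewrite /r -[X in (_ <= X)%N](card_ord 4) max_card.
have -> : #|[pred i | (0 < a i)%N]| = (4 - r)%N.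
  rewrite -[X in (X - _)%N](card_ord 4) -(cardC [pred i | a i == 0%N]) addKn.
  by apply: eq_card => i; rewrite !inE lt0n.
rewrite -card_wedge_fst //; apply: eq_card => k; rewrite !inE /=.
rewrite -(@ord_down_closed 4 (fun i => a i == 0%N)) // => i j ij.
by rewrite -!leqn0; apply: leq_trans; apply: a_mono.
Qed.

Lemma lattice_pairs_bound i j nu m LM :
  lattice_pairs p i j nu m LM -> (nu <= 4)%N /\ (m <= 'C(nu, 2))%N.
Proof.
case: LM => L M [[/= pL [sM _]] aLM _ [Lnu [N MN rN]]].
have nu4 : (nu <= 4)%N by case: Lnu => ? _ <-; rewrite leq_addl.
split=> //; have [R [a [uR a_mono LE]]] := plattice_smithP p_pr pL.
rewrite LE in Lnu aLM; have [uW _] := wedge_mx_unit uR.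
have := zred_rank_le ((absorbs_smith p uR a_mono sM).1 aLM)
  (smith_zred _ uW) MN.
rewrite (commutators_rank uR a_mono Lnu) => le6.
have : ('C(nu, 2) <= 6)%N by move: nu4 {Lnu le6 rN}; case: nu => [|[|[|[|[|]]]]].
by lia.
Qed.

(** First [L] is chosen over [L'], with the trivial lower bound [[set 0]], then [M] over [M'] above
    the wedge lattice of [L]. The second count involves [L] only through the rank of that lattice
    modulo [p], a function of [nu], so the two counts multiply. *)
Lemma card_pairs_fiber i j nu m nu' m' LM' :
  lattice_pairs p i j nu' m' LM' -> (nu <= 4)%N -> (m <= 'C(nu, 2))%N ->
  ncard [set LM | lattice_pairs p (i + nu) (j + m) nu m LM /\
                  (zdiv p LM.1, zdiv p LM.2) = LM']
    (step_weight p nu m nu' m').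
Proof.
case: LM' => L' M' [[/= pL' pM'] aLM' [L'i M'j] [L'nu M'm]] nu4 mnu.
have [R' [a' [uR' a'_mono L'E]]] := plattice_smithP p_pr pL'.
have [S' [b' [uS' b'_mono M'E]]] := plattice_smithP p_pr pM'.
pose A := [set L : set 'rV[int]_4 | [/\ zsub L, [set 0] `<=` L,
  (forall x, L (p%:Z *: x) <-> L' x) & zcorank p L nu]].
apply: (ncard_fibers_const (f := fst) (B := A)).
- rewrite {}/A L'E in L'nu *.
  have z0 : zred [set 0 : 'rV[int]_4] (0 : 'M['F_p]_4).
    move=> v; rewrite submx0; split=> [/eqP ->|[_ -> <-]].
      by exists 0 => //; apply/(redp_eq0 p_pr); exists 0; rewrite scaler0.
    by apply/eqP/(redp_eq0 p_pr); exists 0; rewrite scaler0.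
  have := @card_lattice_step p 4 R' a' p_pr uR' [set 0] 0 nu' nu (4 - nu) L'nu.
  rewrite mxrank0 subn0 addn0 subnK //; apply=> //.
    by split=> // _ _ -> ->; rewrite /= subr0.
  move=> x /= /eqP; rewrite -[X in _ == X](scaler0 _ p%:Z) => /eqP.
  move/(scalez_inj (lt0r_neq0 (_ : 0 < p%:Z))) ->;
    last by rewrite ltz_nat prime_gt0.
  by case: (smith_sub p R' a').
- move=> [L M] [[/= [[sL _] _] _ _ [Lnu _]] [LL' _]]; split=> //.
    by move=> _ ->; case: sL.
  by move=> x; rewrite -LL'.
move=> L [sL _ Ldiv Lnu].
have LL' : zdiv p L = L' by apply/seteqP; split=> x /Ldiv.
have pL : plattice p L by apply: (plattice_zdiv (p := p) sL); rewrite LL'.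
have [R [a [uR a_mono LE]]] := plattice_smithP p_pr pL.
have [uW _] := wedge_mx_unit uR.
rewrite LE in Lnu; have rK := commutators_rank uR a_mono Lnu.
have C6 : ('C(nu, 2) <= 6)%N by move: nu4; case: (nu) => [|[|[|[|[|]]]]].
have := @card_lattice_step p 6 S' b' p_pr uS' (smith p (wedge_mx R) (a \o wedge_fst))
  (redp p (smith_basis p (wedge_mx R) (a \o wedge_fst))) m' m ('C(nu, 2) - m).
rewrite -M'E rK subKn //; set B := [set _ | _] => cardB.
have {cardB} : ncard B (p ^ (m' * ('C(nu, 2) - m)) *
    gauss p ('C(nu, 2) - m') ('C(nu, 2) - m)).
  apply: cardB => //; first exact: smith_sub.
  (* Dividing the wedge lattice of [L] by [p] lowers its exponents and gives the wedge lattice of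
     [L'], contained in [M']. *)
  - have a_mono' (k l : 'I_4) : (k <= l)%N -> ((a k).-1 <= (a l).-1)%N.
      by move=> /a_mono; lia.
    have := (absorbs_smith p uR a_mono' (pM'.1)).1.
    rewrite -zdiv_smith // -LE LL' => /(_ aLM') KM' x /(smith_div p_pr) Kx.
    exact: KM'.
  - exact: smith_zred.
  - by lia.
apply: (ncard_preimage (f := snd)).
- move=> [L0 M] [[[[/= _ [sM _]] aLM _ [_ Mm]] [_ MM']] L0E] /=.
  rewrite /= in MM' L0E; split=> //.
  + by apply/(absorbs_smith p uR a_mono sM); rewrite -LE -L0E.
  + by move=> x; rewrite -MM'.
- by move=> [L1 M1] [L2 M2] [_ /= ->] [_ /= ->] ->.
move=> M [sM KM Mdiv Mm]; exists (L, M) => //=; split=> //.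
have MM' : zdiv p M = M' by apply/seteqP; split=> x /Mdiv.
have pM : plattice p M by apply: (plattice_zdiv (p := p) sM); rewrite MM'.
split=> //=; last by rewrite LL' MM'.
split=> //=; last by rewrite LE.
  by rewrite LE; apply/(absorbs_smith p uR a_mono sM).
by split; apply: zindex_zdiv => //; rewrite ?LL' ?MM' // LE.
Qed.

End Pairs.

(** * States and the recursion on pairs *)

Lemma ncard_bigsum (S T : eqType) (s : seq S) (A : set T) (As : S -> set T) c :
  uniq s -> (forall x, A x <-> exists2 i, i \in s & As i x) ->
  (forall i j x, i \in s -> j \in s -> As i x -> As j x -> i = j) ->
  (forall i, i \in s -> ncard (As i) (c i)) ->
  ncard A (\sum_(i <- s) c i).
Proof.
elim: s A => [|i s IH] A.
  move=> _ A0 _ _; rewrite big_nil; apply: ncard0 => x.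
  by move=> /A0[k]; rewrite in_nil.
move=> /= /andP[ins us] AE disj Ac; rewrite big_cons.
have [t1 [ut1 st1 t1P]] := Ac i (mem_head _ _).
have [|||t2 [ut2 st2 t2P]] := IH [set x | exists2 j, j \in s & As j x] us.
- by [].
- by move=> j k x js ks; apply: disj; rewrite inE ?js ?ks orbT.
- by move=> j js; apply: Ac; rewrite inE js orbT.
exists (t1 ++ t2); split.
- rewrite cat_uniq ut1 ut2 andbT /=; apply/hasPn => x /t2P[j js Aj].
  apply: contra ins => /t1P Ai; rewrite (disj i j x) ?mem_head //.
  by rewrite inE js orbT.
- by rewrite size_cat st1 st2.
move=> x; rewrite mem_cat; split.
  move=> /AE[j]; rewrite inE => /predU1P[-> Ai|js Aj]; apply/orP.
    by left; apply/t1P.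
  by right; apply/t2P; exists j.
move=> /orP[/t1P Ai|/t2P[j js Aj]]; apply/AE.
  by exists i => //; rewrite mem_head.
by exists j => //; rewrite inE js orbT.
Qed.

(** The list is lexicographic, the order in which the linear system is triangular. Its head [(0, 0)]
    is the state of the pair of full lattices alone, hence [behead states] below. *)
Definition states : seq (nat * nat) :=
  [seq (nu, m) | nu <- iota 0 5, m <- iota 0 ('C(nu, 2)).+1].

Lemma mem_states nu m :
  ((nu, m) \in states) = (nu <= 4)%N && (m <= 'C(nu, 2))%N.
Proof.
apply/allpairsPdep/andP => [[nu' [m' []]]|[nu4 mnu]].
  by rewrite !mem_iota !add0n !ltnS => nu4 mnu [-> ->].
by exists nu, m; rewrite !mem_iota !add0n !ltnS.
Qed.

Definition num_pairs (p i j nu m : nat) : nat :=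
  #|` fset_set (lattice_pairs p i j nu m)|%fset.

Section Recursion.
Variable p : nat.
Hypothesis p_pr : prime p.

Lemma lattice_pairs_zdiv i j nu m LM : lattice_pairs p i j nu m LM ->
  exists2 s, s \in states &
    lattice_pairs p (i - nu) (j - m) s.1 s.2 (zdiv p LM.1, zdiv p LM.2)
    /\ (nu <= i)%N && (m <= j)%N.
Proof.
case: LM => L M [[/= pL pM] aLM [Li Mj] [Lnu Mm]].
have [pL' nui Li'] := zdiv_plattice p_pr pL Li Lnu.
have [pM' mj Mj'] := zdiv_plattice p_pr pM Mj Mm.
have [_ [nu' [_ L'nu]]] := plattice_data p_pr pL'.
have [_ [m' [_ M'm]]] := plattice_data p_pr pM'.
have H : lattice_pairs p (i - nu) (j - m) nu' m' (zdiv p L, zdiv p M).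
  split=> //= x y; rewrite /zdiv /= => Lpx.
  rewrite (_ : _ *: _ = wedge (p%:Z *: x) y); first exact: aLM.
  by apply/rowP => k; rewrite !mxE; ring.
exists (nu', m'); last by rewrite nui mj.
by have [nu4 mnu] := lattice_pairs_bound p_pr H; rewrite mem_states nu4.
Qed.

Lemma lattice_pairs_disj i j s t LM :
  lattice_pairs p i j s.1 s.2 LM -> lattice_pairs p i j t.1 t.2 LM -> s = t.
Proof.
move: s t => [s1 s2] [t1 t2] [_ _ _ [/= Ls1 Ms2]] [_ _ _ [/= Lt1 Mt2]].
by rewrite (zcorank_unique Ls1 Lt1) (zcorank_unique Ms2 Mt2).
Qed.

Lemma lattice_pairs_step i j nu m c : (nu, m) \in states ->
  (forall s, s \in states -> ncard (lattice_pairs p i j s.1 s.2) (c s)) ->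
  ncard (lattice_pairs p (i + nu) (j + m) nu m)
    (\sum_(s <- states) c s * step_weight p nu m s.1 s.2)%N.
Proof.
rewrite mem_states => /andP[nu4 mnu] Hc.
pose A s := [set LM | lattice_pairs p (i + nu) (j + m) nu m LM /\
  lattice_pairs p i j s.1 s.2 (zdiv p LM.1, zdiv p LM.2)].
apply: (@ncard_bigsum _ _ _ _ A).
- by rewrite /states.
- move=> LM; split=> [H|[s _ []] //].
  have [s ss []] := lattice_pairs_zdiv H; rewrite !addnK => Hs _.
  by exists s.
- by move=> s t LM _ _ [_ Hs] [_ Ht]; apply: lattice_pairs_disj Hs Ht.
move=> s ss; apply: (ncard_fibers_const
    (f := fun LM => (zdiv p LM.1, zdiv p LM.2)) (Hc s ss)).
  by move=> LM [].
move=> LM' HLM'; have := card_pairs_fiber p_pr HLM' nu4 mnu.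
apply: (ncard_image (f := id)) => [LM [HLM LME]|//|LM [[HLM _] LME]].
  by split=> //; split=> //; rewrite LME.
by exists LM.
Qed.

Lemma lattice_pairs_small i j nu m : ~~ ((nu <= i)%N && (m <= j)%N) ->
  ncard (lattice_pairs p i j nu m) 0.
Proof.
move=> small; apply: ncard0 => LM /lattice_pairs_zdiv[_ _ [_]].
by apply/negP.
Qed.

Lemma lattice_pairs0 i j :
  ncard (lattice_pairs p i j 0 0) ((i == 0%N) && (j == 0%N)).
Proof.
case: (boolP (_ && _)) => [/andP[/eqP -> /eqP ->]|ij0]; last first.
  apply: ncard0 => -[L M] [[/= pL pM] _ [Li Mj] [L0 M0]].
  have [_ i0] := plattice_corank0 p_pr pL L0 Li.
  have [_ j0] := plattice_corank0 p_pr pM M0 Mj.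
  by rewrite i0 j0 in ij0.
exists [:: (setT, setT)]; split=> // -[L M]; rewrite inE; split.
  move=> [[/= pL pM] _ [Li Mj] [L0 M0]].
  have [-> _] := plattice_corank0 p_pr pL L0 Li.
  by have [-> _] := plattice_corank0 p_pr pM M0 Mj.
move=> /eqP[-> ->].
have [pL Li L0] := plattice_setT 4 p_pr; have [pM Mj M0] := plattice_setT 6 p_pr.
by split.
Qed.

(** Finiteness comes out of the recursion itself, by induction on [i + j], which every state other
    than [(0, 0)] lowers. It is what gives meaning to [num_pairs]. *)
Lemma lattice_pairs_finite i j s : s \in states ->
  exists c, ncard (lattice_pairs p i j s.1 s.2) c.
Proof.
have [k] := ubnP (i + j); elim: k i j s => // k IH i j [nu m] ijk ss.
have [s0|s0] := eqVneq (nu, m) (0, 0)%N.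
  by case: s0 => -> ->; exists ((i == 0) && (j == 0))%N; apply: lattice_pairs0.
have [/andP[nui mj]|small] := boolP ((nu <= i)%N && (m <= j)%N); last first.
  by exists 0; apply: lattice_pairs_small.
have c_ex (s : nat * nat) : exists c, s \in states ->
    ncard (lattice_pairs p (i - nu) (j - m) s.1 s.2) c.
  have [ss'|ss'] := boolP (s \in states); last by exists 0.
  have [|c Hc] := IH (i - nu)%N (j - m)%N s _ ss'; last by exists c.
  move: s0; rewrite xpair_eqE /= in ss nui mj *; lia.
have [c Hc] := choice c_ex.
have := lattice_pairs_step ss Hc; rewrite !subnK // => H.
by eexists; apply: H.
Qed.

Lemma num_pairsP i j s : s \in states ->
  ncard (lattice_pairs p i j s.1 s.2) (num_pairs p i j s.1 s.2).
Proof.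
move=> ss; have [c Hc] := lattice_pairs_finite i j ss.
by rewrite /num_pairs (ncard_fset_set Hc).
Qed.

Lemma num_pairs_step i j nu m : (nu, m) \in states ->
  num_pairs p (i + nu) (j + m) nu m =
  (\sum_(s <- states) num_pairs p i j s.1 s.2 * step_weight p nu m s.1 s.2)%N.
Proof.
move=> ss; apply: ncard_fset_set; apply: lattice_pairs_step => // s.
exact: num_pairsP.
Qed.

Lemma num_pairs_small i j nu m : ~~ ((nu <= i)%N && (m <= j)%N) ->
  num_pairs p i j nu m = 0%N.
Proof. by move=> small; apply/ncard_fset_set/lattice_pairs_small. Qed.

Lemma num_pairs0 i j : num_pairs p i j 0 0 = ((i == 0%N) && (j == 0%N)).
Proof. exact/ncard_fset_set/lattice_pairs0. Qed.

End Recursion.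

(** * Normal subgroups of the class-two group *)

Lemma ncard_surj (T U : eqType) (A : set T) (B : set U) (f : T -> U) k :
  (forall x, A x -> B (f x)) -> (forall y, B y -> exists2 x, A x & f x = y) ->
  ncard A k -> exists l, ncard B l.
Proof.
move=> AB surj [s [us _ As]]; exists (size (undup (map f s))).
exists (undup (map f s)); split=> //; first exact: undup_uniq.
move=> y; rewrite mem_undup; split=> [/surj[x /As xs <-]|/mapP[x /As Ax ->]].
  exact: map_f.
exact: AB.
Qed.

Lemma ncardX (T U : eqType) (A : set T) (B : set U) k l :
  ncard A k -> ncard B l -> ncard [set xy : T * U | A xy.1 /\ B xy.2] (k * l)%N.
Proof.
move=> Ak Bl; apply: (ncard_fibers_const (f := fst) Ak) => [x []//|x Ax].
apply: (ncard_image (f := fun y => (x, y))) Bl => [y By|y z _ _ []//|[x' y]].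
  by split.
by move=> [[/= _ By] ->]; exists y.
Qed.

(** * Powers of elements modulo a normal subgroup of finite index *)

Section Lagrange.
Variables (G : groupType) (H : set G).
Hypothesis nH : is_normal H.

Lemma left_cosetP x y : left_coset H x = left_coset H y <-> H (x^-1 * y)%g.
Proof.
have [[H1 HM HV] _] := nH; split=> [e|Hxy].
  have : left_coset H y y by exists 1%g; rewrite ?mulg1.
  by rewrite -e => -[h Hh <-]; rewrite mulKg.
apply/seteqP; split=> _ [h Hh <-].
  exists ((x^-1 * y)^-1 * h)%g; first by apply: HM => //; apply: HV.
  by rewrite invgM invgK !mulgA mulgV mul1g.
by exists (x^-1 * y * h)%g; [apply: HM|rewrite !mulgA mulgV mul1g].
Qed.

Lemma has_indexP (U : eqType) (f : G -> U) m :
  (forall x y, f x = f y <-> H (x^-1 * y)%g) ->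
  ncard (range f) m <-> has_index H m.
Proof.
move=> fH; rewrite /has_index -card_eq_IIP.
by split; apply: ncard_range => x y; rewrite fH left_cosetP.
Qed.

Lemma normal_expg x k : H x -> H (x ^+ k)%g.
Proof.
have [[H1 HM _] _] := nH.
by move=> Hx; elim: k => // k IH; rewrite expgS; apply: HM.
Qed.

(* If [x] has order [o] modulo [H], then each class modulo [<x> H] consists of [o]
   cosets of [H], so [o] divides [m]. *)
Lemma has_index_expg m x : has_index H m -> H (x ^+ m)%g.
Proof.
have [[H1 HM HV] HJ] := nH.
move=> /card_eq_IIP Hm; have [s [us sm sP]] := Hm.
have order_ex : exists o, (0 < o)%N && `[< H (x ^+ o)%g >].
  pose c i := left_coset H (x ^+ i)%g.
  have : ~~ uniq (map c (iota 0 m.+1)).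
    have sub : {subset map c (iota 0 m.+1) <= s}.
      by move=> _ /mapP[i _ ->]; apply/sP; exists (x ^+ i)%g.
    apply/negP => u; have := uniq_leq_size u sub.
    by rewrite size_map size_iota sm ltnn.
  move=> /(uniqPn set0)[i [j [ij]]]; rewrite size_map size_iota => jm.
  have im := ltn_trans ij jm; rewrite !(nth_map 0%N) ?size_iota // !nth_iota //.
  rewrite !add0n => /left_cosetP Hij; exists (j - i)%N; rewrite subn_gt0 ij /=.
  apply/asboolP; rewrite -(subnKC (ltnW ij)) expgnDr mulKg in Hij.
  exact: Hij.
case: (ex_minnP order_ex) => o /andP[] ogt0 /asboolP Ho omin {order_ex}.
have Hmod k : H (x ^+ k)%g -> (o %| k)%N.
  move=> Hk; rewrite /dvdn; apply/negPn/negP => ko.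
  have : (o <= k %% o)%N.
    apply: omin; rewrite lt0n; apply/andP; split=> //.
    apply/asboolP; move: Hk; rewrite {1}(divn_eq k o) mulnC expgnDr expgnA => Hk.
    by have := HM _ _ (HV _ (normal_expg (k %/ o) Ho)) Hk; rewrite mulKg.
  by rewrite leqNgt ltn_pmod.
pose f (C : set G) : set G :=
  [set z | exists y i, C y /\ H ((y * x ^+ i)^-1 * z)%g].
have fE y : f (left_coset H y) = [set z | exists i, H ((y * x ^+ i)^-1 * z)%g].
  apply/seteqP; split=> z /=; last first.
    by move=> [i Hz]; exists y, i; split=> //; exists 1%g; rewrite ?mulg1.
  move=> [_ [i [[h Hh <-] Hz]]]; exists i.
  have -> : ((y * x ^+ i)^-1 * z = h ^ (x ^+ i) * ((y * h * x ^+ i)^-1 * z))%g.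
    by rewrite /conjg !invgM !mulgA !mulgK.
  by apply: HM => //; apply: HJ.
have f_eq y z : f (left_coset H y) = f (left_coset H z) ->
    exists2 i, (i < o)%N & left_coset H (y * x ^+ i)%g = left_coset H z.
  rewrite !fE => e; have : [set z' | exists i, H ((z * x ^+ i)^-1 * z')%g] z.
    by exists 0; rewrite expg0 mulg1 mulVg.
  rewrite -e => -[i Hi]; exists (i %% o)%N; first by rewrite ltn_pmod.
  have xi : (x ^+ i = x ^+ (i %% o) * x ^+ o ^+ (i %/ o))%g.
    by rewrite {1}(divn_eq i o) addnC mulnC expgnDr expgnA.
  apply/left_cosetP; have -> : ((y * x ^+ (i %% o))^-1 * z =
      x ^+ o ^+ (i %/ o) * ((y * x ^+ i)^-1 * z))%g.
    by rewrite xi !invgM !mulgA mulgV mul1g.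
  by apply: HM => //; apply/normal_expg.
have f_mul y i : f (left_coset H (y * x ^+ i)%g) = f (left_coset H y).
  rewrite !fE; apply/seteqP; split=> z [j Hj].
    by exists (i + j)%N; rewrite expgnDr mulgA.
  (* Modulo [H], the power with exponent [i * o.-1] is the inverse of [x ^+ i]. *)
  exists (j + i * o.-1)%N.
  have -> : ((y * x ^+ i * x ^+ (j + i * o.-1))^-1 * z =
      ((x ^+ o ^+ i)^-1) * ((y * x ^+ j)^-1 * z))%g.
    have e : (i + (j + i * o.-1) = j + o * i)%N.
      by rewrite -[in RHS](prednK ogt0) mulSn (mulnC i); lia.
    by rewrite -(mulgA y) -expgnDr e expgnDr expgnA !invgM !mulgA.
  by apply: HM => //; apply/HV/normal_expg.
have [l Hl] : exists l, ncard [set C | exists y, C = f (left_coset H y)] l.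
  apply: (ncard_surj (f := f) _ _ Hm) => [_ [y _ <-]|_ [y ->]]; first by exists y.
  by exists (left_coset H y) => //; exists y.
have : ncard (range (left_coset H)) (l * o)%N.
  apply: (ncard_fibers_const (f := f) Hl) => [_ [y _ <-]|_ [y ->]];
    first by exists y.
  have := ncard_finType (@predT 'I_o); rewrite card_ord.
  apply: (ncard_image (f := fun i : 'I_o => left_coset H (y * x ^+ i)%g)).
  - by move=> i _; split; [exists (y * x ^+ i)%g|apply: f_mul].
  - suff le (i j : 'I_o) : (i <= j)%N ->
        left_coset H (y * x ^+ i)%g = left_coset H (y * x ^+ j)%g -> i = j.
      by move=> i j _ _ e; have [/le->|/ltnW/le->] := leqP i j.
    move=> ij /left_cosetP; rewrite -(subnKC ij) expgnDr (mulgA y) mulKg => /Hmod.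
    have [ji _|ji] := posnP (j - i)%N.
      by apply/val_inj/eqP; rewrite eqn_leq ij -subn_eq0 ji.
    move=> /(dvdn_leq ji); rewrite leqNgt.
    by rewrite (leq_ltn_trans (leq_subr _ _)).
  move=> C [[z _ <-] /esym/f_eq[i io <-]].
  by exists (Ordinal io).
move=> /(ncard_unique Hm) ->; rewrite mulnC expgnA.
exact: normal_expg.
Qed.

End Lagrange.

(** * The class-two group on [Z^4 x Z^6] and its normal subgroups *)

Definition heis : Type := ('rV[int]_4 * 'rV[int]_6)%type.
HB.instance Definition _ := Choice.on heis.

(** A bilinear cocycle whose antisymmetrization is [wedge]. An antisymmetric cocycle with the same
    commutators would need a factor [1/2]. *)
Definition heis_form (x y : 'rV[int]_4) : 'rV[int]_6 :=
  \row_k (x 0 (wedge_fst k) * y 0 (wedge_snd k)).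

Lemma heis_formDl x y z : heis_form (x + y) z = heis_form x z + heis_form y z.
Proof. by apply/rowP => k; rewrite !mxE mulrDl. Qed.

Lemma heis_formDr x y z : heis_form x (y + z) = heis_form x y + heis_form x z.
Proof. by apply/rowP => k; rewrite !mxE mulrDr. Qed.

Lemma heis_formNl x y : heis_form (- x) y = - heis_form x y.
Proof. by apply/rowP => k; rewrite !mxE mulNr. Qed.

Lemma heis_formNr x y : heis_form x (- y) = - heis_form x y.
Proof. by apply/rowP => k; rewrite !mxE mulrN. Qed.

Lemma heis_form0l y : heis_form 0 y = 0.
Proof. by apply/rowP => k; rewrite !mxE mul0r. Qed.

Lemma heis_form0r x : heis_form x 0 = 0.
Proof. by apply/rowP => k; rewrite !mxE mulr0. Qed.

Definition heis_one : heis := (0, 0).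
Definition heis_mul (g h : heis) : heis :=
  (g.1 + h.1, g.2 + h.2 + heis_form g.1 h.1).
Definition heis_inv (g : heis) : heis := (- g.1, heis_form g.1 g.1 - g.2).

Lemma heis_mulA : associative heis_mul.
Proof.
move=> [x y] [x' y'] [x'' y'']; rewrite /heis_mul /= addrA; congr pair.
by rewrite heis_formDl heis_formDr; apply/rowP => k; rewrite !mxE; ring.
Qed.
Lemma heis_mul1 : left_id heis_one heis_mul.
Proof. by move=> [x y]; rewrite /heis_mul /= heis_form0l !add0r addr0. Qed.
Lemma heis_mul1r : right_id heis_one heis_mul.
Proof. by move=> [x y]; rewrite /heis_mul /= heis_form0r !addr0. Qed.
Lemma heis_mulV : left_inverse heis_one heis_inv heis_mul.
Proof.
move=> [x y]; rewrite /heis_mul /= addNr heis_formNl; congr pair.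
by rewrite subrK subrr.
Qed.
Lemma heis_mulrV : right_inverse heis_one heis_inv heis_mul.
Proof.
move=> [x y]; rewrite /heis_mul /= subrr heis_formNr; congr pair.
by apply/rowP => k; rewrite !mxE; ring.
Qed.

HB.instance Definition _ := isGroup.Build heis
  heis_mulA heis_mul1 heis_mul1r heis_mulV heis_mulrV.

Lemma heis_mulE (g h : heis) :
  (g * h)%g = (g.1 + h.1, g.2 + h.2 + heis_form g.1 h.1) :> heis.
Proof. by []. Qed.

Lemma heis_invE (g : heis) : (g^-1)%g = (- g.1, heis_form g.1 g.1 - g.2) :> heis.
Proof. by []. Qed.

Lemma heis_conjE (g h : heis) : (g ^ h)%g = (g.1, g.2 + wedge g.1 h.1) :> heis.
Proof.
rewrite /conjg !heis_mulE heis_invE /=; congr pair; first by rewrite addrC addrK.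
by apply/rowP => k; rewrite !mxE; ring.
Qed.

Lemma heis_expE (g : heis) k : exists y, (g ^+ k)%g = (g.1 *+ k, y) :> heis.
Proof.
elim: k => [|k [y IH]]; first by exists 0; rewrite expg0.
by rewrite expgS IH heis_mulE /= mulrS; eexists.
Qed.

Lemma heis_exp_central (y : 'rV[int]_6) k :
  (((0, y) : heis) ^+ k)%g = (0, y *+ k) :> heis.
Proof.
elim: k => [|k IH]; first by rewrite expg0 mulr0n.
by rewrite expgS IH heis_mulE /= mulrS heis_form0l !addr0.
Qed.

Lemma zindex_reps (V : zmodType) (L : set V) m : zsub L -> zindex L m ->
  exists2 r : 'I_m -> V, (forall i j, L (r i - r j) -> i = j)
    & forall x, exists i, L (x - r i).
Proof.
move=> sL [s [us sm sP]];
  have r_ex (i : 'I_m) : exists x, nth set0 s i = zcoset L x.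
  have /sP[x _ <-] : nth set0 s i \in s by rewrite mem_nth ?sm.
  by exists x.
have [r rP] := choice r_ex; exists r => [i j|x].
  move=> /(zcosetP sL); rewrite -!rP => /eqP; rewrite nth_uniq ?sm //.
  by move=> /eqP/val_inj.
have xs : zcoset L x \in s by apply/sP; exists x.
have ixs : (index (zcoset L x) s < m)%N by rewrite -sm index_mem.
by exists (Ordinal ixs); apply/(zcosetP sL); rewrite -rP nth_index.
Qed.

Definition heis_proj (N : set heis) : set 'rV[int]_4 := [set x | exists y, N (x, y)].
Definition heis_center (N : set heis) : set 'rV[int]_6 := [set y | N (0, y)].

(* With [2 h = 1] modulo the index, subtracting [h B(x, x)] from the central part
   turns normal subgroups of [heis] into additive subgroups. *)
Definition untwist (h : int) (N : set heis) : set ('rV[int]_4 * 'rV[int]_6) :=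
  [set xw | N (xw.1, xw.2 + h *: heis_form xw.1 xw.1)].

Definition twist (h : int) (I : set ('rV[int]_4 * 'rV[int]_6)) : set heis :=
  [set xy | I (xy.1, xy.2 - h *: heis_form xy.1 xy.1)].

Lemma untwistK h N : twist h (untwist h N) = N.
Proof. by apply/seteqP; split=> -[x y]; rewrite /twist /untwist /= subrK. Qed.

Lemma twistK h I : untwist h (twist h I) = I.
Proof. by apply/seteqP; split=> -[x y]; rewrite /twist /untwist /= addrK. Qed.

Lemma heis_central_split (N : set heis) x y z : is_normal N ->
  N (x, y) -> N (0, z) <-> N (x, y + z).
Proof.
move=> [[_ NM NV] _] Nxy; split=> Nz.
  have := NM _ _ Nxy Nz; rewrite heis_mulE /= addr0 heis_form0r addr0.
  by [].
have := NM _ _ (NV _ Nxy) Nz; rewrite heis_mulE heis_invE /= addNr heis_formNl.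
congr (N (_, _)); first by apply/rowP => k; rewrite !mxE; ring.
Qed.

Lemma heis_center_zsub N : is_normal N -> zsub (heis_center N).
Proof.
move=> [[N1 NM NV] _]; split=> // y z Ny Nz.
have := NM _ _ Ny (NV _ Nz); rewrite heis_mulE heis_invE /=.
by rewrite !heis_form0l subrr sub0r addr0.
Qed.

Lemma heis_proj_zsub N : is_normal N -> zsub (heis_proj N).
Proof.
move=> [[N1 NM NV] _]; split=> [|x x' [y Ny] [y' Ny']]; first by exists 0.
by have := NM _ _ Ny (NV _ Ny'); rewrite heis_mulE heis_invE /=; eexists;
  eassumption.
Qed.

Lemma heis_absorbs N : is_normal N -> absorbs (heis_proj N) (heis_center N).
Proof.
move=> nN x z [y Nxy]; apply/(heis_central_split (wedge x z) nN Nxy).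
by have := nN.2 _ (z, 0) Nxy; rewrite heis_conjE.
Qed.

Section NormalSubgroups.
Variables (q h : int).
Hypothesis hq : h *+ 2 = q + 1.

Let qE : q = h *+ 2 - 1. Proof. by rewrite hq addrK. Qed.

Lemma untwist_zsub N : is_normal N -> (forall y, heis_center N (q *: y)) ->
  zsub (untwist h N).
Proof.
move=> nN Nq; have [[N1 NM NV] NJ] := nN; have sC := heis_center_zsub nN.
split=> [|[x w] [x' w']]; rewrite /untwist /=.
  by rewrite heis_form0l scaler0 addr0.
(* This is the discrepancy between the quotient in the group and the difference of the untwisted
   pairs: [h *: wedge x x'] plus a multiple of [q = 2 h - 1]. *)
move=> Nx Nx'; have Nz : heis_center N
    (h *: wedge x x' + q *: (heis_form x' x' - heis_form x x')).
  apply: zsubD => //; apply: zsubZ => //; apply: heis_absorbs => //.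
  by exists (w + h *: heis_form x x).
have := NM _ _ Nx (NV _ Nx'); rewrite heis_mulE heis_invE /=.
move=> Nd; have := (heis_central_split _ nN Nd).1 Nz.
congr N; congr pair; apply/rowP => k; rewrite !mxE qE; ring.
Qed.

Lemma twist_normal I : zsub I -> (forall y, I (0, q *: y)) ->
  (forall x w z, I (x, w) -> I (0, wedge x z)) -> is_normal (twist h I).
Proof.
move=> sI Iq Iwedge; have ID := zsubD sI; have IN := zsubN sI.
have IDp x y x' y' x'' y'' : I (x, y) -> I (x', y') -> x'' = x + x' ->
    y'' = y + y' -> I (x'', y'').
  by move=> Ixy Ixy' -> ->; have := ID _ _ Ixy Ixy'.
have sI0 : zsub [set y : 'rV[int]_6 | I (0, y)].
  case: sI => I0 IB; split=> // y z Iy Iz.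
  by have := IB _ _ Iy Iz; rewrite /= -[(0, y) - _]/(0 - 0, y - z) subrr.
have IZ (y : 'rV[int]_6) k : I (0, y) -> I (0, k *: y) := @zsubZ _ _ y k sI0.
split; first split.
- by case: sI => I0 _; rewrite /twist /= heis_form0l scaler0 subr0.
- move=> [x y] [x' y']; rewrite /twist heis_mulE /= => Ix Ix'.
  have Iw := Iwedge _ _ x' Ix.
  have Iz := IDp _ _ _ _ _ _ (IZ _ h Iw) (IN _ (Iq (heis_form x x'))) erefl erefl.
  apply: (IDp _ _ _ _ _ _ (ID _ _ Ix Ix') Iz); rewrite /=.
    by apply/rowP => k; rewrite !mxE; ring.
  by apply/rowP => k; rewrite !mxE qE; ring.
- move=> [x y]; rewrite /twist heis_invE /= => Ix.
  apply: (IDp _ _ _ _ _ _ (IN _ Ix) (IN _ (Iq (heis_form x x)))); rewrite /=.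
    by apply/rowP => k; rewrite !mxE; ring.
  by apply/rowP => k; rewrite !mxE qE; ring.
- move=> [x y] [x' y']; rewrite /twist heis_conjE /= => Ix.
  apply: (IDp _ _ _ _ _ _ Ix (Iwedge _ _ x' Ix)); first by rewrite addr0.
  by apply/rowP => k; rewrite !mxE; ring.
Qed.

End NormalSubgroups.

Lemma sum_pair (U V : nmodType) I (s : seq I) (F : I -> U) (G : I -> V) :
  \sum_(i <- s) (F i, G i) = (\sum_(i <- s) F i, \sum_(i <- s) G i).
Proof. by elim: s => [|i s IH]; rewrite ?big_nil // !big_cons IH. Qed.

Lemma zsub_pairZ m n (I : set ('rV[int]_m * 'rV[int]_n)) x y (c : int) :
  zsub I -> I (x, y) -> I (c *: x, c *: y).
Proof.
move=> sI Ixy; have sJ : zsub [set c : int | I (c *: x, c *: y)].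
  split=> [|a b Ia Ib] /=; first by rewrite !scale0r; case: sI.
  by rewrite !scalerBl; apply: (sI.2 _ _ Ia Ib).
by have := zsubMz sJ c (x := 1); rewrite intz; apply; rewrite /= !scale1r.
Qed.

Lemma plattice_exp p n (L : set 'rV[int]_n) j k x : prime p ->
  plattice p L -> zindex L (p ^ j)%N -> (j <= k)%N -> L ((p ^ k)%N%:Z *: x).
Proof.
move=> p_pr pL Lj jk; have [R [a [uR _ LE]]] := plattice_smithP p_pr pL.
move: Lj; rewrite LE => Lj.
have aj := zindex_unique p_pr (smith_index p_pr a uR) Lj.
move=> i; rewrite -scalemxAl mxE dvdz_mulr // dvdzE /=.
by rewrite dvdn_exp2l // (leq_trans _ jk) // -aj (bigD1 i) //= leq_addr.
Qed.

(** Untwisted, [N] is an additive subgroup with projection [L] and central part [M], that is, a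
    homomorphism from [L] to [Z^6 / M]. As [L] is free of rank 4, such a map is given by the classes
    [t] of the images of its basis. The twist is legitimate because [p ^ k] kills [Z^6 / M]. *)
Lemma card_normal_fiber p k h i j nu m LM : prime p -> (j <= k)%N ->
  h *+ 2 = (p ^ k)%N%:Z + 1 -> lattice_pairs p i j nu m LM ->
  ncard [set N | is_normal N /\ (heis_proj N, heis_center N) = LM] ((p ^ j) ^ 4)%N.
Proof.
move=> p_pr jk hq; case: LM => L M [[/= pL pM] aLM [Li Mj] _].
have Mq y : M ((p ^ k)%N%:Z *: y) by apply: plattice_exp Mj jk.
have [R [a [uR _ LE]]] := plattice_smithP p_pr pL.
have [sL _] := pL; have [sM _] := pM.
have [r r_inj r_surj] := zindex_reps sM Mj.
pose B := smith_basis p R a.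
have LP x : L x <-> exists l, x = l *m B by rewrite LE; apply: smithP.
have Binj (l l' : 'rV_4) : l *m B = l' *m B -> l = l'.
  move=> ll'; apply/eqP; rewrite -subr_eq0; apply/eqP.
  by apply: (smith_basis_inj p_pr uR (a := a)); rewrite mulmxBl ll' subrr.
pose Rt (t : {ffun 'I_4 -> 'I_(p ^ j)}) : 'M[int]_(4, 6) := \matrix_i r (t i).
pose I t : set ('rV[int]_4 * 'rV[int]_6) :=
  [set xw | exists l, xw.1 = l *m B /\ M (xw.2 - l *m Rt t)].
have I_sub t : zsub (I t).
  split=> [|[x w] [x' w'] [l [/= -> Mw]] [l' [/= -> Mw']]].
    by exists 0; rewrite !mul0mx subr0; split=> //; case: sM.
  exists (l - l'); rewrite /= !mulmxBl; split=> //.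
  case: sM => _ /(_ _ _ Mw Mw'); congr M.
  move: (l *m _) (l' *m _) => A A'.
  by apply/rowP => c; rewrite !mxE; ring.
have I0 t y : I t (0, y) <-> M y.
  split=> [[l /= [l0 My]]|My]; last by exists 0; rewrite /= !mul0mx subr0.
  by move: My; rewrite -(Binj 0 l) ?mul0mx ?subr0.
have IL t x : L x <-> exists w, I t (x, w).
  split=> [/LP[l ->]|[w [l [/= -> _]]]]; last by apply/LP; exists l.
  by exists (l *m Rt t), l; rewrite /= subrr; split=> //; case: sM.
have card_t : ncard [set t : {ffun 'I_4 -> 'I_(p ^ j)} | predT t] ((p ^ j) ^ 4)%N.
  have := ncard_finType (@predT {ffun 'I_4 -> 'I_(p ^ j)}).
  by rewrite card_ffun !card_ord.
apply: (ncard_image (f := fun t => twist h (I t))) card_t.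
- move=> t _; split.
    apply: (twist_normal hq (I_sub t)) => [y|x w z Ixw]; first by apply/I0.
    by apply/I0/aLM/(IL t); exists w.
  congr pair; apply/seteqP; split.
  + by move=> x [y Iy]; apply/(IL t); eexists; apply: Iy.
  + move=> x /(IL t)[w Iw]; exists (w + h *: heis_form x x).
    by rewrite /twist /= addrK.
  + by move=> y; rewrite /heis_center /twist /= heis_form0l scaler0 subr0 => /I0.
  + by move=> y /(I0 t); rewrite /heis_center /twist /= heis_form0l scaler0 subr0.
- move=> t t' _ _ /(congr1 (untwist h)); rewrite !twistK => tt'.
  apply/ffunP => l; apply: r_inj.
  have : I t (delta_mx 0 l *m B, r (t l)).
    exists (delta_mx 0 l); split=> //=.
    by rewrite -rowE rowK subrr; case: sM.
  rewrite tt' => -[l' [/= /Binj <-]].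
  by rewrite -rowE rowK.
move=> N [nN [NL NM]].
have Nq y : heis_center N ((p ^ k)%N%:Z *: y) by rewrite NM.
have sN := untwist_zsub hq nN Nq.
have uN0 y : untwist h N (0, y) <-> M y.
  by rewrite -NM /untwist /= heis_form0l scaler0 addr0.
have t_ex l : exists i : 'I_(p ^ j), untwist h N (row l B, r i).
  have [y Ny] : heis_proj N (row l B).
    by rewrite NL; apply/LP; exists (delta_mx 0 l); rewrite rowE.
  have [i' Mi] := r_surj (y - h *: heis_form (row l B) (row l B)).
  exists i'; have := sN.2 (row l B, y - h *: heis_form (row l B) (row l B)) (0, _) _ ((uN0 _).2 Mi).
  rewrite -[(_, _) - _]/(_ - _, _ - _) subr0 subKr; apply.
  by rewrite /untwist /= subrK.
have [t tP] := choice t_ex; pose t' := [ffun l => t l]; exists t' => //.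
rewrite -[RHS](untwistK h); congr twist.
have NB l : untwist h N (l *m B, l *m Rt t').
  rewrite !mulmx_sum_row -sum_pair; apply: zsub_sum => // i'.
  by apply: zsub_pairZ => //; rewrite [row i' (Rt t')]rowK ffunE.
apply/seteqP; split=> -[x w].
  move=> [l [/= -> Mw]]; have := zsubD sN (NB l) ((uN0 _).2 Mw).
  by rewrite -[(_, _) + _]/(_ + _, _ + _) addr0 addrC subrK.
move=> Nxw; have /LP[l xl] : L x by rewrite -NL; eexists; apply: Nxw.
exists l; split=> //=; apply/uN0; have := sN.2 _ _ Nxw (NB l).
by rewrite -[(_, _) - _]/(_ - _, _ - _) xl subrr.
Qed.

Lemma heis_centralC (y : 'rV[int]_6) (g : heis) :
  (((0, y) : heis) * g = g * ((0, y) : heis))%g.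
Proof.
by rewrite !heis_mulE /= heis_form0l heis_form0r !addr0 add0r addrC.
Qed.

Lemma heis_centralM (y z : 'rV[int]_6) :
  (((0, y) : heis) * ((0, z) : heis) = ((0, y + z) : heis))%g.
Proof. by rewrite !heis_mulE /= heis_form0l !addr0. Qed.

Lemma heis_centralV (y : 'rV[int]_6) :
  (((0, y) : heis)^-1 = ((0, - y) : heis))%g.
Proof. by rewrite heis_invE /= heis_form0l oppr0 sub0r. Qed.

(** Every [g] is the product of a fixed representative of the class of [g.1] modulo [L], an element
    of [N] and a central element [b g]. So the cosets of [N] correspond to pairs of a class modulo
    [L] and a class of [b g] modulo [M]. *)
Lemma heis_index N A B : is_normal N ->
  zindex (heis_proj N) A -> zindex (heis_center N) B -> has_index N (A * B)%N.
Proof.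
move=> nN NA NB; have [[N1 NM NV] NJ] := nN.
set L := heis_proj N in NA *; set M := heis_center N in NB *.
have sL : zsub L := heis_proj_zsub nN.
have sM : zsub M := heis_center_zsub nN.
have c_ex x : exists y, L x -> N (x, y).
  have [[y Ny]|nLx] := pselect (L x); first by exists y.
  by exists 0.
have [c cP] := choice c_ex.
have r_ex (C : set 'rV[int]_4) : exists x0, forall x, C = zcoset L x -> L (x - x0).
  have [[x ->]|nC] := pselect (exists x, C = zcoset L x).
    by exists x => y /(zcosetP sL) Lxy; rewrite -opprB; apply: zsubN.
  by exists 0 => x Cx; case: nC; exists x.
have [r' rP'] := choice r_ex; pose r x := r' (zcoset L x).
have rP x : L (x - r x) by apply: rP'.
have rE x x' : L (x - x') -> r x = r x' by move=> /(zcosetP sL); rewrite /r => ->.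
pose b (g : heis) : 'rV[int]_6 := g.2 + heis_form (r g.1) (r g.1)
  - heis_form (r g.1) g.1 - c (g.1 - r g.1).
have gE (g : heis) :
    g = (((r g.1, 0) : heis) * ((g.1 - r g.1, c (g.1 - r g.1)) : heis)
         * ((0, b g) : heis))%g.
  case: g => x y; rewrite /b !heis_mulE /=; congr pair.
    by apply/rowP => k; rewrite !mxE; ring.
  by apply/rowP => k; rewrite !mxE; ring.
have gN (g g' : heis) : r g.1 = r g'.1 -> N (g^-1 * g')%g <-> M (b g - b g').
  move=> rr; set x0 := r g.1 in rr.
  pose n : heis := (g.1 - x0, c (g.1 - x0)).
  pose n' : heis := (g'.1 - x0, c (g'.1 - x0)).
  have Ng : N n by apply/cP/rP.
  have Ng' : N n' by apply: cP; rewrite rr; apply: rP.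
  have Nnn : N (n^-1 * n')%g by apply: NM => //; apply: NV.
  have -> : (g^-1 * g' = (n^-1 * n') * ((0, b g' - b g) : heis))%g.
    rewrite {1}(gE g) {1}(gE g') -rr -/x0 -/n -/n'.
    rewrite !invgM -!mulgA mulKg heis_centralV !mulgA.
    by rewrite -(mulgA _ n^-1 n')%g heis_centralC -[LHS]mulgA heis_centralM addrC.
  split=> [Nd|Md].
    have := NM _ _ (NV _ Nnn) Nd; rewrite mulKg => Nb.
    by rewrite -opprB; apply: (zsubN sM).
  by apply: NM => //; have := zsubN sM Md; rewrite opprB.
pose F (g : heis) := (zcoset L g.1, zcoset M (b g)).
apply/(has_indexP nN (f := F)) => [g g'|].
  split=> [[/(zcosetP sL) Lg /(zcosetP sM) Mb]|Ngg'].
    by apply/gN => //; apply: rE.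
  have Lg : L (g.1 - g'.1).
    rewrite -opprB; apply: (zsubN sL); rewrite addrC; exists (g^-1 * g')%g.2.
    by rewrite -[- g.1 + _]/((g^-1 * g')%g.1) -surjective_pairing.
  congr pair; first exact/(zcosetP sL).
  by apply/(zcosetP sM)/gN => //; apply: rE.
have := ncardX NA NB; apply: (ncard_image (f := id)) => [[C D]|//|_ [g _ <-]].
  move=> [/= [x1 _ <-] [y1 _ <-]].
  exists ((x1, y1 - heis_form (r x1) (r x1) + heis_form (r x1) x1 + c (x1 - r x1)) : heis) => //.
  rewrite /F /b /=; congr pair; congr zcoset.
  by apply/rowP => k; rewrite !mxE; ring.
by exists (F g).
Qed.

(** The [p ^ n]-th power of each element lies in [N], so both lattices contain the multiples of
    [p ^ n]. *)
Lemma lattice_pairs_heis p n N : prime p ->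
  is_normal N -> has_index N (p ^ n)%N ->
  exists i nu m, (i <= n)%N /\
    lattice_pairs p i (n - i) nu m (heis_proj N, heis_center N).
Proof.
move=> p_pr nN Nn; have sL := heis_proj_zsub nN; have sM := heis_center_zsub nN.
have pL : plattice p (heis_proj N).
  split=> //; exists n => x; have := has_index_expg nN (x, 0) Nn.
  have [y ->] := heis_expE (x, 0) (p ^ n)%N.
  by rewrite /= -scaler_nat natz; exists y.
have pM : plattice p (heis_center N).
  split=> //; exists n => y; have := has_index_expg nN (0, y) Nn.
  by rewrite heis_exp_central -scaler_nat natz.
have [i [nu [Li Lnu]]] := plattice_data p_pr pL.
have [j [m [Mj Mm]]] := plattice_data p_pr pM.
have := heis_index nN Li Mj; rewrite -expnD => /card_eq_IIP Nij.
have /card_eq_IIP Nn' := Nn.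
have nij := expnI (prime_gt1 p_pr) (ncard_unique Nn' Nij).
exists i, nu, m; rewrite nij leq_addr addKn; split=> //; split=> //.
exact: heis_absorbs.
Qed.

Lemma card_normal_heis p n : prime p -> odd p ->
  ncard (@normal_subgroups_of_index heis (p ^ n)%N)
    (\sum_(i < n.+1) \sum_(s <- states)
       num_pairs p i (n - i) s.1 s.2 * (p ^ (n - i)) ^ 4)%N.
Proof.
move=> p_pr p_odd.
(* As [p] is odd, [(p ^ n + 1) / 2] is an integer, an inverse of 2 modulo [p ^ n]. *)
have [h hq] : exists h : int, h *+ 2 = (p ^ n)%N%:Z + 1.
  have pn_odd : odd (p ^ n)%N by rewrite oddX p_odd orbT.
  exists ((p ^ n)./2.+1)%:Z; rewrite -[in RHS](odd_double_half (p ^ n)%N) pn_odd.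
  by rewrite -mul2n; lia.
pose idx := [seq (i, s) | i <- iota 0 n.+1, s <- states].
pose c (t : nat * (nat * nat)) :=
  (num_pairs p t.1 (n - t.1) t.2.1 t.2.2 * (p ^ (n - t.1)) ^ 4)%N.
have -> : (\sum_(i < n.+1) \sum_(s <- states)
     num_pairs p i (n - i) s.1 s.2 * (p ^ (n - i)) ^ 4)%N = (\sum_(x <- idx) c x)%N.
  rewrite /idx big_allpairs -[iota 0 n.+1]/(index_iota 0 n.+1).
  by rewrite (big_mkord predT (fun i => \sum_(s <- states) c (i, s))%N).
have idxP i s : ((i, s) \in idx) = (i <= n)%N && (s \in states).
  apply/allpairsP/andP => [[[i' s'] [ii' ss' [-> ->]]]|[ni ss]].
    by split=> //; move: ii'; rewrite mem_iota add0n ltnS.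
  by exists (i, s); rewrite mem_iota add0n ltnS.
pose A (t : nat * (nat * nat)) := [set N : set heis | is_normal N /\
  lattice_pairs p t.1 (n - t.1) t.2.1 t.2.2 (heis_proj N, heis_center N)].
apply: (@ncard_bigsum _ _ _ _ A).
- by apply: allpairs_uniq => // [|[i s] [i' s'] _ _ [-> ->]]; rewrite ?iota_uniq.
- move=> N; split=> [[nN Nn]|[[i s] + [nN HN]]].
    have [i [nu [m [ni HN]]]] := lattice_pairs_heis p_pr nN Nn.
    exists (i, (nu, m)) => //; rewrite idxP ni mem_states.
    by have [-> ->] := lattice_pairs_bound p_pr HN.
  rewrite idxP => /andP[ni _]; split=> //.
  case: HN => _ _ [Li Mj] _; have := heis_index nN Li Mj.
  by rewrite -expnD /= subnKC.
- move=> [i s] [i' s'] N _ _ [_ HN] [_ HN'].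
  have ii' : i = i'.
    case: HN HN' => _ _ [/= Li _] _ [_ _ [/= Li' _] _].
    exact: (zindex_unique p_pr Li Li').
  by rewrite -ii' in HN' *; have /= -> := lattice_pairs_disj HN HN'.
- move=> [i s]; rewrite idxP => /andP[ni ss].
  apply: (ncard_fibers_const (f := fun N => (heis_proj N, heis_center N))
    (num_pairsP p_pr i (n - i) ss)) => [N []//|LM HLM].
  have := card_normal_fiber p_pr (leq_subr i n) hq HLM.
  apply: (ncard_image (f := id)) => [N [nN NLM]|//|N [[nN _] NLM]].
    by split=> //; split=> //; rewrite NLM.
  by exists N.
Qed.

(** * The free class-two nilpotent group on four generators *)

Section IntegerPowers.
Variable G : groupType.
Implicit Types (x y : G) (a b : int).

Definition zexp x a : G :=
  match a with Posz n => x ^+ n | Negz n => x ^- n.+1 end%g.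

Lemma zexpS x a : zexp x (a + 1) = (zexp x a * x)%g.
Proof.
case: a => [n|[|n]]; first by rewrite -PoszD addn1 /= expgSr.
  by rewrite /= expg1 mulVg.
have -> : Negz n.+1 + 1 = Negz n by rewrite !NegzE; lia.
rewrite /zexp.
by rewrite [X in (X^-1 * _)%g]expgS invgM mulgVK.
Qed.

Lemma zexpP x a : zexp x (a - 1) = (zexp x a / x)%g.
Proof. by rewrite -{2}[a](subrK 1) zexpS mulgK. Qed.

Lemma zexpD x a b : zexp x (a + b) = (zexp x a * zexp x b)%g.
Proof.
elim/int_rect: b => [|n IH|n IH]; first by rewrite addr0 mulg1.
  by rewrite -addn1 PoszD addrA zexpS IH zexpS mulgA.
by rewrite -addn1 PoszD opprD addrA zexpP IH zexpP mulgA.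
Qed.

Lemma zexp1 x : zexp x 1 = x. Proof. by []. Qed.

Lemma commute_zexp x y a b : commute x y -> commute (zexp x a) (zexp y b).
Proof.
move=> xy; case: a => n; case: b => m /=; do ?[apply: commuteV];
  apply: commute_sym; do ?[apply: commuteV]; by apply/commuteX2/commute_sym.
Qed.

Definition zprod n (v : 'I_n -> G) (x : 'rV[int]_n) : G :=
  (\prod_(i < n) zexp (v i) (x 0 i))%g.

Variables (n : nat) (v : 'I_n -> G).
Hypothesis v_comm : forall i j, commute (v i) (v j).

Lemma zprodD (x y : 'rV[int]_n) : zprod v (x + y) = (zprod v x * zprod v y)%g.
Proof.
rewrite /zprod -prodgM_commute => [|i j _ _]; last first.
  exact/commute_zexp/v_comm.
by apply: eq_bigr => i _; rewrite mxE zexpD.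
Qed.

Lemma zprod0 : zprod v 0 = 1%g.
Proof. by rewrite /zprod big1 // => i _; rewrite mxE. Qed.

Lemma zprodN (x : 'rV[int]_n) : zprod v (- x) = (zprod v x)^-1%g.
Proof.
by apply/(mulgI (zprod v x)); rewrite -zprodD subrr zprod0 mulgV.
Qed.

Lemma zprod_delta i : zprod v (delta_mx 0 i) = v i.
Proof.
rewrite /zprod (big_only1 i) //; first by rewrite mxE !eqxx.
by move=> j ji _; rewrite mxE (negPf ji) andbF.
Qed.

End IntegerPowers.

(** * The universal property of the free group *)

Section FreeLift.
Variables (I : choiceType) (H : groupType) (g : I -> H).

Definition lift_letter (a : letter I) : H := if a.2 then (g a.1)^-1%g else g a.1.

Definition lift_word (w : seq (letter I)) : H :=
  foldr (fun a h => lift_letter a * h)%g 1%g w.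

Lemma lift_letterV a : lift_letter (letter_inv a) = (lift_letter a)^-1%g.
Proof. by case: a => i []; rewrite /lift_letter //= invgK. Qed.

Lemma lift_push a w : lift_word (push a w) = (lift_letter a * lift_word w)%g.
Proof.
case: w => [|b w] //=; case: eqP => [->|//].
by rewrite lift_letterV mulVKg.
Qed.

Definition free_lift (x : free_group I) : H := lift_word x.

Lemma free_liftM x y : free_lift (x * y)%g = (free_lift x * free_lift y)%g.
Proof.
rewrite /free_lift [free_word (x * y)%g]/=.
elim: (free_word x) => [|a u IH] /=; first by rewrite mul1g.
by rewrite lift_push IH mulgA.
Qed.

Lemma free_lift1 : free_lift 1%g = 1%g.
Proof. by []. Qed.

Lemma free_liftV x : free_lift x^-1%g = (free_lift x)^-1%g.
Proof.
by apply/(mulgI (free_lift x)); rewrite -free_liftM !mulgV free_lift1.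
Qed.

Lemma free_liftR x y :
  free_lift [~ x, y]%g = [~ free_lift x, free_lift y]%g.
Proof. by rewrite /commg /conjg !free_liftM !free_liftV. Qed.

End FreeLift.

Section FreeInd.
Variable I : choiceType.

Definition free_letter (a : letter I) : free_group I := @FreeGroup I [:: a] isT.

Definition free_gen (i : I) : free_group I := free_letter (i, false).

Lemma free_letter_inv i : free_letter (i, true) = (free_gen i)^-1%g.
Proof. exact/val_inj. Qed.

Lemma free_lift_gen (H : groupType) (g : I -> H) i :
  free_lift g (free_gen i) = g i.
Proof. by rewrite /free_lift /= mulg1. Qed.

Lemma free_ind (P : free_group I -> Prop) :
  P 1%g -> (forall i x, P x -> P (free_gen i * x)%g) ->
  (forall i x, P x -> P ((free_gen i)^-1 * x)%g) -> forall x, P x.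
Proof.
move=> P1 Pg PV [w rw]; elim: w rw => [|a w IH] raw.
  by rewrite (_ : FreeGroup raw = 1%g) //; apply/val_inj.
have rw : reduced w by apply: path_sorted raw.
have -> : FreeGroup raw = (free_letter a * FreeGroup rw)%g.
  apply/val_inj => /=; case: (w) raw => [|b w'] //= /andP[/negPf -> _] //.
case: a {raw} => i [].
  by rewrite free_letter_inv; apply/PV/IH.
exact/Pg/IH.
Qed.

End FreeInd.

Section QuotientMorphism.
Variables (G : groupType) (N : set G) (nN : is_normal N).

Lemma quoM x y : quo nN (x * y)%g = (quo nN x * quo nN y)%g.
Proof. by rewrite -quo_mulE. Qed.

Lemma quoV x : quo nN x^-1%g = (quo nN x)^-1%g.
Proof. by rewrite -quo_invE. Qed.

Lemma quoR x y : quo nN [~ x, y]%g = [~ quo nN x, quo nN y]%g.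
Proof. by rewrite /commg /conjg !quoM !quoV. Qed.

Lemma quo_eq1 x : quo nN x = 1%g <-> N x.
Proof.
split=> [/esym/quo_eqP|Nx]; first by rewrite invg1 mul1g.
by apply/esym/quo_eqP; rewrite invg1 mul1g.
Qed.

Lemma quo_surj (a : quotient_group nN) : exists x, a = quo nN x.
Proof. by elim/quotW: a => x; exists x. Qed.

End QuotientMorphism.

Lemma commutator_in (G : groupType) (A B : set G) x y :
  A x -> B y -> commutator_subgroup A B [~ x, y]%g.
Proof. by move=> Ax By; apply: sub_gen_smallest; exists x => //; exists y. Qed.

(** * The isomorphism of the free class-two group with [heis] *)

Definition heis_gen (i : 'I_4) : heis := (delta_mx 0 i, 0).

Local Notation heis_lift := (free_lift heis_gen).

Local Notation F := (free_group 'I_4).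
Local Notation Q3 := (quotient_group (@lower_central_normal F 3)).
Local Notation quo3 := (quo (@lower_central_normal F 3)).

Lemma heis_lift_gen i x : (heis_lift (free_gen i * x)%g).1 =
  delta_mx 0 i + (heis_lift x).1.
Proof. by rewrite free_liftM free_lift_gen. Qed.

Lemma heis_lift_genV i x : (heis_lift ((free_gen i)^-1 * x)%g).1 =
  - delta_mx 0 i + (heis_lift x).1.
Proof.
by rewrite free_liftM free_liftV free_lift_gen.
Qed.

(** The quotient by the second term of the lower central series is abelian, so there [x] equals the
    product of the generators raised to their exponent sums, which are the entries of
    [(heis_lift x).1]. *)
Lemma heis_lift_lower2 x : (heis_lift x).1 = 0 -> @lower_central F 2 x.
Proof.
pose Q := quo (@lower_central_normal F 2).
have QC a b : (Q a * Q b = Q b * Q a)%g.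
  rewrite -!quoM; apply/quo_eqP.
  have -> : ((a * b)^-1 * (b * a) = [~ b, a])%g.
    by rewrite /commg /conjg invgM !mulgA.
  exact: commutator_in.
have vC (i j : 'I_4) : commute (Q (free_gen i)) (Q (free_gen j)) by apply: QC.
pose v i := Q (free_gen i).
suff QE : Q x = zprod v (heis_lift x).1.
  by move=> x0; apply/(quo_eq1 (@lower_central_normal F 2));
    rewrite -/(Q x) QE x0 zprod0.
elim/free_ind: x => [|i x IH|i x IH].
- by rewrite zprod0.
- by rewrite heis_lift_gen zprodD // zprod_delta -IH -quoM.
- by rewrite heis_lift_genV zprodD // zprodN // zprod_delta -IH -quoV -quoM.
Qed.

Lemma commg_central3 (a b c : Q3) : commute [~ a, b]%g c.
Proof.
have [x ->] := quo_surj a; have [y ->] := quo_surj b; have [z ->] := quo_surj c.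
apply/commgP/eqP; rewrite -!quoR; apply/quo_eq1.
exact: (@commutator_in F (@lower_central F 2) setT [~ x, y]%g z
  (commutator_in I I) I).
Qed.

(** In class two, commutators are central and therefore multiplicative in each argument. *)
Lemma commgM3l (a b c : Q3) : ([~ a * b, c] = [~ a, c] * [~ b, c])%g.
Proof.
have -> : ([~ a * b, c] = [~ a, c] ^ b * [~ b, c])%g.
  by rewrite /commg /conjg !invgM !mulgA !mulgK.
congr (_ * _)%g; rewrite /conjg.
by rewrite (commg_central3 a c b) mulKg.
Qed.

Definition basic_commutator (k : 'I_6) : Q3 :=
  [~ quo3 (free_gen (wedge_fst k)), quo3 (free_gen (wedge_snd k))]%g.

Lemma basic_commutatorC k l : commute (basic_commutator k) (basic_commutator l).
Proof. exact: commg_central3. Qed.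

Lemma commg_gen (i j : 'I_4) :
  exists y, [~ quo3 (free_gen i), quo3 (free_gen j)]%g = zprod basic_commutator y.
Proof.
suff lt (i' j' : 'I_4) : (i' < j')%N -> exists y,
    [~ quo3 (free_gen i'), quo3 (free_gen j')]%g = zprod basic_commutator y.
  case: (ltngtP i j) => [/lt//|/lt[y e]|/val_inj ->]; last first.
    by exists 0; rewrite commgg zprod0.
  by exists (- y); rewrite (zprodN basic_commutatorC) -e invgR.
move=> ij; suff [k [-> ->]] : exists k, i' = wedge_fst k /\ j' = wedge_snd k.
  by exists (delta_mx 0 k); rewrite zprod_delta.
case: i' ij => [[|[|[|[|i']]]] ip] //; case: j' => [[|[|[|[|j']]]] jp] //= _.
- by exists (@Ordinal 6 0 isT); split; apply/val_inj.
- by exists (@Ordinal 6 1 isT); split; apply/val_inj.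
- by exists (@Ordinal 6 2 isT); split; apply/val_inj.
- by exists (@Ordinal 6 3 isT); split; apply/val_inj.
- by exists (@Ordinal 6 4 isT); split; apply/val_inj.
- by exists (@Ordinal 6 5 isT); split; apply/val_inj.
Qed.

(** Multiplicativity in both arguments reduces the claim to commutators of generators. *)
Lemma commg_basic (a b : Q3) : exists y, [~ a, b]%g = zprod basic_commutator y.
Proof.
pose T (c : Q3) := exists y, c = zprod basic_commutator y.
have T1 : T 1%g by exists 0; rewrite zprod0.
have TM c d : T c -> T d -> T (c * d)%g.
  by move=> [y ->] [z ->]; exists (y + z); rewrite (zprodD basic_commutatorC).
have TV c : T c -> T c^-1%g.
  by move=> [y ->]; exists (- y); rewrite (zprodN basic_commutatorC).
have comm1 (d : Q3) : [~ 1, d]%g = 1%g.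
  by rewrite /commg /conjg invg1 !mul1g mulVg.
have Tcomm (d : Q3) : (forall i, T [~ quo3 (free_gen i), d]%g) ->
    forall c : Q3, T [~ c, d]%g.
  move=> Tgen c; have [x ->] := quo_surj c; elim/free_ind: x => [|i x IH|i x IH].
  - by rewrite ((quo_eq1 _ _).2 _) ?comm1 //;
    have [[]] := @lower_central_normal F 3.
  - by rewrite quoM commgM3l; apply: TM.
  - have gV : [~ (quo3 (free_gen i))^-1, d]%g = [~ quo3 (free_gen i), d]^-1%g.
      by apply: (mulgI [~ quo3 (free_gen i), d]%g);
        rewrite -commgM3l !mulgV comm1.
    by rewrite quoM commgM3l quoV gV; apply: TM => //; apply: TV.
apply: (Tcomm) => i; rewrite -invgR; apply: TV; apply: Tcomm => j.
exact: commg_gen.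
Qed.

Lemma quo3_lower2 x : @lower_central F 2 x ->
  exists y, quo3 x = zprod basic_commutator y.
Proof.
pose T : set F := [set x | exists y, quo3 x = zprod basic_commutator y].
suff : @lower_central F 2 `<=` T by apply.
apply: smallest_sub => [|_ [a _] [b _] <-].
  split.
  - exists 0; rewrite zprod0; apply/quo_eq1.
    by have [[]] := @lower_central_normal F 3.
  - move=> a b [y ay] [z bz]; exists (y + z).
    by rewrite quoM ay bz (zprodD basic_commutatorC).
  - by move=> a [y ay]; exists (- y); rewrite quoV ay (zprodN basic_commutatorC).
rewrite /T /= quoR; exact: commg_basic.
Qed.

Lemma heis_commE (g h : heis) : [~ g, h]%g = (0, wedge g.1 h.1) :> heis.
Proof.
rewrite /commg heis_conjE heis_mulE heis_invE /=; congr pair.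
  by rewrite addNr.
by apply/rowP => k; rewrite !mxE; ring.
Qed.

Lemma heis_lift_lower2_sub : @lower_central F 2 `<=` [set x | (heis_lift x).1 = 0].
Proof.
apply: smallest_sub => [|_ [a _] [b _] <-]; last first.
  rewrite /= free_liftR heis_commE.
  by [].
split=> [//|a b /= a0 b0|a /= a0].
  by rewrite free_liftM heis_mulE /= a0 b0 addr0.
by rewrite free_liftV heis_invE /= a0 oppr0.
Qed.

Lemma heis_lift_lower3_sub x : @lower_central F 3 x -> heis_lift x = 1%g.
Proof.
suff : @lower_central F 3 `<=` [set x | heis_lift x = 1%g] by apply.
apply: smallest_sub => [|_ [a a2] [b _] <-]; last first.
  rewrite /= free_liftR.
  rewrite heis_commE (heis_lift_lower2_sub a2) /=; congr pair.
  by apply/rowP => k; rewrite !mxE; ring.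
split=> [//|a b /= a0 b0|a /= a0].
  by rewrite free_liftM a0 b0 mulg1.
by rewrite free_liftV a0 invg1.
Qed.

Definition heis_map (a : Q3) : heis := heis_lift (repr a).

Lemma heis_map_quo x : heis_map (quo3 x) = heis_lift x.
Proof.
have /heis_lift_lower3_sub := quo_repr (@lower_central_normal F 3) x.
rewrite free_liftM free_liftV => /eqP.
by rewrite -(inj_eq (mulgI (free_lift heis_gen (repr (quo3 x))))) mulVKg mulg1
  => /eqP.
Qed.

Lemma heis_mapM a b : heis_map (a * b)%g = (heis_map a * heis_map b)%g.
Proof.
have [x ->] := quo_surj a; have [y ->] := quo_surj b.
by rewrite -quoM !heis_map_quo free_liftM.
Qed.

Lemma zexp_central (y : 'rV[int]_6) c : zexp ((0, y) : heis) c = (0, c *: y).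
Proof.
case: c => m; rewrite /zexp heis_exp_central ?heis_centralV.
  by rewrite -scaler_nat natz.
by rewrite NegzE scaleNr -scaler_nat natz.
Qed.

Lemma morph_zexp (G H : groupType) (f : G -> H) x c :
  (forall x y, f (x * y)%g = (f x * f y)%g) -> f (zexp x c) = zexp (f x) c.
Proof.
move=> fM; have f1 : f 1%g = 1%g.
  by apply: (mulgI (f 1%g)); rewrite -fM !mulg1.
have fX k : f (x ^+ k)%g = (f x ^+ k)%g.
  by elim: k => // k IH; rewrite !expgS fM IH.
case: c => k; rewrite /zexp; first exact: fX.
by apply: (mulgI (f (x ^+ k.+1)%g)); rewrite -fM mulgV f1 fX mulgV.
Qed.

Lemma heis_map_zprod y : heis_map (zprod basic_commutator y) = (0, y).
Proof.
have big_pair (s : seq 'I_6) :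
    heis_map (\prod_(k <- s) zexp (basic_commutator k) (y 0 k))%g =
    (0, \sum_(k <- s) y 0 k *: delta_mx 0 k).
  elim: s => [|k s IH]; first by rewrite !big_nil heis_map_quo.
  rewrite !big_cons heis_mapM IH (morph_zexp _ _ heis_mapM).
  have -> : heis_map (basic_commutator k) = (0, delta_mx 0 k).
    rewrite /basic_commutator -quoR heis_map_quo free_liftR.
    rewrite !free_lift_gen heis_commE /=; congr pair.
    have := congr1 (row k) wedge_mx1; rewrite rowK !row1 => <-.
    by [].
  by rewrite zexp_central heis_centralM.
by rewrite /zprod big_pair -row_sum_delta.
Qed.

(** A trivial first component places [x] in the second term of the series, so its class is a product
    of basic commutators; the exponents of that product are the second component. *)
Lemma heis_map_inj a : heis_map a = 1%g -> a = 1%g.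
Proof.
have [x ->] := quo_surj a; rewrite heis_map_quo => x1.
have [|y xy] := @quo3_lower2 x.
  by apply: heis_lift_lower2; rewrite x1.
have := heis_map_zprod y; rewrite -xy heis_map_quo x1 => -[/esym y0].
by rewrite xy y0 zprod0.
Qed.

Lemma heis_map_surj g : exists a, heis_map a = g.
Proof.
case: g => x y.
pose a := (\prod_(i < 4) zexp (quo3 (free_gen i)) (x 0 i))%g.
have a1 : (heis_map a).1 = x.
  have zexp1 (h : heis) c : (zexp h c).1 = c *: h.1.
    case: c => m; rewrite /zexp.
      by have [z ->] := heis_expE h m; rewrite /= -scaler_nat natz.
    have [z hz] := heis_expE h m.+1.
    by rewrite heis_invE hz /= NegzE scaleNr -scaler_nat natz.
  have big_pair (s : seq 'I_4) :
      (heis_map (\prod_(k <- s) zexp (quo3 (free_gen k)) (x 0 k))%g).1 =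
      \sum_(k <- s) x 0 k *: delta_mx 0 k.
    elim: s => [|k s IH]; first by rewrite !big_nil heis_map_quo.
    rewrite !big_cons heis_mapM heis_mulE /= IH (morph_zexp _ _ heis_mapM) zexp1.
    by rewrite heis_map_quo free_lift_gen.
  by rewrite /a big_pair -row_sum_delta.
exists (a * zprod basic_commutator (y - (heis_map a).2))%g.
rewrite heis_mapM heis_map_zprod heis_mulE /= heis_form0r !addr0 a1.
by rewrite addrC subrK.
Qed.

Lemma normal_preimage (G H : groupType) (f : G -> H) (N : set H) m :
  (forall x y, f (x * y)%g = (f x * f y)%g) -> (forall h, exists x, f x = h) ->
  normal_subgroups_of_index m N -> normal_subgroups_of_index m (f @^-1` N).
Proof.
move=> fM fsurj [nN Nm]; have [[N1 NM NV] NJ] := nN.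
have f1 : f 1%g = 1%g by apply: (mulgI (f 1%g)); rewrite -fM !mulg1.
have fV x : f x^-1%g = (f x)^-1%g.
  by apply: (mulgI (f x)); rewrite -fM !mulgV.
have nN' : is_normal (f @^-1` N).
  split; first split; rewrite /preimage /=.
  - by rewrite f1.
  - by move=> x y Nx Ny; rewrite fM; apply: NM.
  - by move=> x Nx; rewrite fV; apply: NV.
  - by move=> x y Nx; rewrite /conjg !fM fV; apply: NJ.
split=> //; apply/(has_indexP nN' (f := fun x => left_coset N (f x))).
  by move=> x y; rewrite /preimage /= fM fV; apply: left_cosetP.
move/card_eq_IIP: Nm;
  apply: (ncard_image (f := id)) => [_ [h _ <-]|//|_ [x _ <-]].
  by have [x <-] := fsurj h; exists x.
by exists (left_coset N (f x)) => //; exists (f x).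
Qed.

Lemma ncard_normal_iso (G H : groupType) (f : G -> H) (g : H -> G) m k :
  (forall x y, f (x * y)%g = (f x * f y)%g) -> cancel f g -> cancel g f ->
  ncard (@normal_subgroups_of_index H m) k ->
  ncard (@normal_subgroups_of_index G m) k.
Proof.
move=> fM fK gK; have gM x y : g (x * y)%g = (g x * g y)%g.
  by apply: (can_inj fK); rewrite gK fM !gK.
apply: (ncard_image (f := fun N => f @^-1` N)).
- by move=> N; apply: normal_preimage => // h; exists (g h); rewrite gK.
- have fg (M : set H) : g @^-1` (f @^-1` M) = M.
    by apply/seteqP; split=> h; rewrite /preimage /= gK.
  by move=> N N' _ _ /= NN'; rewrite -(fg N) -(fg N') NN'.
- move=> N HN; exists (g @^-1` N).
    by apply: normal_preimage HN => // x; exists (f x); rewrite fK.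
  by apply/seteqP; split=> x; rewrite /preimage /= fK.
Qed.

Lemma num_normal_free_nilpotent p n : prime p -> odd p ->
  num_normal_subgroups (free_nilpotent 2 4) (p ^ n)%N =
  (\sum_(i < n.+1) \sum_(s <- states)
     num_pairs p i (n - i) s.1 s.2 * (p ^ (n - i)) ^ 4)%N.
Proof.
move=> p_pr p_odd; apply: ncard_fset_set.
have [g gP] := choice heis_map_surj.
apply: (@ncard_normal_iso _ _ heis_map g _ _ heis_mapM _ gP
  (card_normal_heis n p_pr p_odd)) => x.
apply: (mulgI x^-1%g); rewrite mulVg; apply: heis_map_inj.
apply: (mulgI (heis_map x)); rewrite -heis_mapM mulVKg gP mulg1.
by [].
Qed.

(** * Numerator and denominator of the zeta function *)

Lemma gauss_small q n k : (n < k)%N -> gauss q n k = 0%N.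
Proof.
elim: n k => [|n IH] [|k] //=; rewrite ltnS => nk.
by rewrite !IH ?muln0 // ltnW.
Qed.

Lemma gaussnn q n : gauss q n n = 1%N.
Proof. by elim: n => //= n ->; rewrite gauss_small ?muln0. Qed.

(** * Polynomials as coefficient lists *)

Section ListPoly.
Variables (C : Type) (c0 : C) (cadd cmul : C -> C -> C) (cnull : C -> bool).

Fixpoint ladd (s t : seq C) : seq C :=
  match s, t with
  | [::], _ => t
  | _, [::] => s
  | a :: s', b :: t' => cadd a b :: ladd s' t'
  end.

(** The test [cnull] skips zero coefficients, many of which are introduced by [lshift]. *)
Fixpoint lmul (s t : seq C) : seq C :=
  if s is a :: s' then
    let u := c0 :: lmul s' t in if cnull a then u else ladd (map (cmul a) t) u
  else [::].

Definition lshift (k : nat) (s : seq C) : seq C := nseq k c0 ++ s.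

Definition lnorm (s : seq C) : seq C :=
  foldr (fun c acc => if acc is [::] then
    if cnull c then [::] else [:: c] else c :: acc) [::] s.

Definition lpad (k : nat) (s : seq C) : seq C := s ++ nseq (k - size s) c0.

Variables (A : comRingType) (ev : C -> A) (x : A).
Hypotheses (ev0 : ev c0 = 0) (evD : {morph ev : a b / cadd a b >-> a + b})
  (evM : {morph ev : a b / cmul a b >-> a * b})
  (ev_null : forall c, cnull c -> ev c = 0).

Definition leval (s : seq C) : A := foldr (fun c acc => ev c + x * acc) 0 s.

Lemma levalD : {morph leval : s t / ladd s t >-> s + t}.
Proof.
elim=> [|a s IH] [|b t] /=; rewrite ?add0r ?addr0 // evD IH; ring.
Qed.

Lemma leval_map a s : leval (map (cmul a) s) = ev a * leval s.
Proof. by elim: s => [|b s IH] /=; rewrite ?mulr0 // evM IH; ring. Qed.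

Lemma levalM : {morph leval : s t / lmul s t >-> s * t}.
Proof.
move=> s t; elim: s => [|a s IH]; first by rewrite /= mul0r.
rewrite [lmul _ _]/= [leval (a :: s)]/=.
have u_eval : leval (c0 :: lmul s t) = x * (leval s * leval t).
  by rewrite /= IH ev0 add0r.
case: ifP => [/ev_null ->|_]; first by rewrite u_eval; ring.
by rewrite levalD leval_map u_eval; ring.
Qed.

Lemma leval_shift k s : leval (lshift k s) = x ^+ k * leval s.
Proof.
elim: k => [|k IH]; first by rewrite expr0 mul1r.
by rewrite exprS -mulrA -IH /= ev0 add0r.
Qed.

Lemma leval_norm s : leval (lnorm s) = leval s.
Proof.
elim: s => //= c s <-; case: (lnorm s) => [|d t] //=.
by case: ifP => //= /ev_null ->; rewrite mulr0 addr0.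
Qed.

Lemma leval_pad k s : leval (lpad k s) = leval s.
Proof.
rewrite /lpad; elim: s k => [|c s IH] k /=.
  2: by rewrite -(IH k.-1) (_ : k - (size s).+1 = k.-1 - size s)%N //; lia.
by rewrite subn0; elim: k => //= k ->; rewrite ev0 mulr0 addr0.
Qed.

End ListPoly.

Lemma leval_cat (C : Type) (A : comRingType) (ev : C -> A) x s t :
  leval ev x (s ++ t) = leval ev x s + x ^+ size s * leval ev x t.
Proof.
elim: s => [|c s IH] /=; first by rewrite expr0 add0r mul1r.
by rewrite IH exprS; ring.
Qed.

Lemma leval_rev (C : Type) (K : fieldType) (ev : C -> K) x s k : x != 0 ->
  size s = k.+1 -> leval ev x (rev s) = x ^+ k * leval ev x^-1 s.
Proof.
move=> x0; elim: s k => // c s IH [|k] [ss].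
  by rewrite (size0nil ss) /= !mulr0 !addr0 mul1r.
rewrite rev_cons -cats1 leval_cat size_rev ss (IH k) //= mulr0 addr0.
by rewrite mulrDr mulrA exprSr mulfK // addrC.
Qed.

Lemma eq_leval (C : Type) (A : comRingType) (ev ev' : C -> A) x s :
  (forall c, ev c = ev' c) -> leval ev x s = leval ev' x s.
Proof. by move=> e; elim: s => //= c s ->; rewrite e. Qed.

Lemma leval_comp (C D : Type) (A : comRingType) (ev : C -> A) (g : D -> C) x s :
  leval ev x (map g s) = leval (ev \o g) x s.
Proof. by elim: s => //= c s ->. Qed.

Lemma leval_rmorph (C : Type) (A B : comRingType) (f : {rmorphism A -> B})
    (ev : C -> A) x s :
  f (leval ev x s) = leval (f \o ev) (f x) s.
Proof. by elim: s => [|c s IH] /=; rewrite ?rmorph0 // rmorphD rmorphM IH. Qed.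

(* Integer polynomials in two variables, as lists by powers of [y] of lists by
   powers of [x]: unlike [{poly {poly int}}] these compute. *)
Definition zpoly := seq Z.
Definition zpoly2 := seq zpoly.

Definition zpadd : zpoly -> zpoly -> zpoly := ladd Z.add.
Definition is_nil (T : Type) (s : seq T) := if s is [::] then true else false.

Definition zpmul : zpoly -> zpoly -> zpoly := lmul Z0 Z.add Z.mul (Z.eqb Z0).
Definition zp2add : zpoly2 -> zpoly2 -> zpoly2 := ladd zpadd.
Definition zp2mul : zpoly2 -> zpoly2 -> zpoly2 :=
  lmul [::] zpadd zpmul (@is_nil Z).

Section Eval.
Variable A : comRingType.

Definition zeval (c : Z) : A := (int_of_Z c)%:~R.
Definition zpeval (x : A) : zpoly -> A := leval zeval x.
Definition zp2eval (x y : A) : zpoly2 -> A := leval (zpeval x) y.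

Lemma zevalD : {morph zeval : a b / Z.add a b >-> a + b}.
Proof. by move=> a b; rewrite /zeval -intrD; congr _%:~R; lia. Qed.

Lemma zevalM : {morph zeval : a b / Z.mul a b >-> a * b}.
Proof. by move=> a b; rewrite /zeval -intrM; congr _%:~R; lia. Qed.

Lemma zeval_null c : Z.eqb Z0 c -> zeval c = 0.
Proof. by move=> /Z.eqb_eq <-. Qed.

Lemma zpevalD x : {morph zpeval x : a b / zpadd a b >-> a + b}.
Proof. exact/levalD/zevalD. Qed.

Lemma zpevalM x : {morph zpeval x : a b / zpmul a b >-> a * b}.
Proof. exact: (levalM _ _ zevalD zevalM zeval_null). Qed.

Lemma zp2evalD x y : {morph zp2eval x y : a b / zp2add a b >-> a + b}.
Proof. exact/levalD/zpevalD. Qed.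

Lemma zp2evalM x y : {morph zp2eval x y : a b / zp2mul a b >-> a * b}.
Proof. by apply: (levalM _ _ (zpevalD x) (zpevalM x)) => // -[]. Qed.

End Eval.

Lemma zp2eval_rmorph (A B : comRingType) (f : {rmorphism A -> B}) x y P :
  f (zp2eval x y P) = zp2eval (f x) (f y) P.
Proof.
rewrite /zp2eval leval_rmorph; apply: eq_leval => r /=.
rewrite /zpeval leval_rmorph; apply: eq_leval => c /=.
exact: rmorph_int.
Qed.

Fixpoint zgauss (n k : nat) : zpoly :=
  match k, n with
  | 0, _ => [:: Zpos 1]
  | _.+1, 0 => [::]
  | k'.+1, n'.+1 => zpadd (zgauss n' k') (lshift Z0 k (zgauss n' k))
  end.

Lemma zgaussE (A : comRingType) p n k :
  zpeval p%:R (zgauss n k) = (gauss p n k)%:R :> A.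
Proof.
have z0 : zeval A Z0 = 0 by [].
elim: n k => [|n IH] [|k] //=; rewrite ?mulr0 ?addr0 //.
by rewrite zpevalD IH /zpeval leval_shift // -/(zpeval _ _) IH natrD natrM natrX.
Qed.

(** The part [4 * m] of the shift accounts for the [|Z^6 / M| ^ 4] normal subgroups over a pair: a
    step multiplies the index of [M] by [p ^ m]. *)
Definition zweight (s t : nat * nat) : zpoly :=
  let: (nu, m) := s in let: (nu', m') := t in
  lshift Z0 (4 * m + nu' * (4 - nu) + m' * ('C(nu, 2) - m))
    (zpmul (zgauss (4 - nu') (4 - nu)) (zgauss ('C(nu, 2) - m') ('C(nu, 2) - m))).

Lemma zweightE (A : comRingType) p s t :
  zpeval p%:R (zweight s t) =
  (p ^ (4 * s.2) * step_weight p s.1 s.2 t.1 t.2)%:R :> A.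
Proof.
case: s t => [nu m] [nu' m']; rewrite /zweight /zpeval leval_shift //.
rewrite -!/(zpeval _ _) zpevalM !zgaussE /step_weight.
by rewrite !natrM !natrX !exprD; ring.
Qed.

(** The diagonal coefficient of the system: [p ^ deg_x s] is the weighted number of ways to stay in
    the state [s], and such a step multiplies the index of the normal subgroup by [p ^ deg_y s]. *)
Definition deg_x (s : nat * nat) : nat :=
  4 * s.2 + s.1 * (4 - s.1) + s.2 * ('C(s.1, 2) - s.2).
Definition deg_y (s : nat * nat) : nat := s.1 + s.2.

Definition zterm (s t : nat * nat) : zpoly2 :=
  lshift [::] (deg_y s) [:: zweight s t].

Definition zfactor (s : nat * nat) : zpoly2 :=
  zp2add [:: [:: Zpos 1]] (lshift [::] (deg_y s) [:: lshift Z0 (deg_x s) [:: Zneg 1]]).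

Lemma ztermE (A : comRingType) p (y : A) s t :
  zp2eval p%:R y (zterm s t) =
  y ^+ deg_y s * (p ^ (4 * s.2) * step_weight p s.1 s.2 t.1 t.2)%:R.
Proof. by rewrite /zp2eval leval_shift //= zweightE mulr0 addr0. Qed.

Lemma zfactorE (A : comRingType) (x y : A) s :
  zp2eval x y (zfactor s) = 1 - x ^+ deg_x s * y ^+ deg_y s.
Proof.
rewrite /zfactor zp2evalD /zp2eval leval_shift //= !mulr0 !addr0.
rewrite /zpeval leval_shift //= mulr0 addr0.
have -> : zeval A (Zneg 1) = -1 by [].
have -> : zeval A (Zpos 1) = 1 by [].
ring.
Qed.

(** One row of forward substitution. The list holds the numerators of the states solved so far over
    a common denominator; the new state brings one more factor to it, by which all older numerators
    are multiplied. Nothing is ever cancelled, so everything stays polynomial. *)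
Definition znumer_step (nums : seq ((nat * nat) * zpoly2)) (s : nat * nat) :=
  (s, foldr (fun tn acc => zp2add (zp2mul (zterm s tn.1) tn.2) acc) [::] nums)
    :: [seq (tn.1, zp2mul (zfactor s) tn.2) | tn <- nums].

Definition znumers :=
  foldl znumer_step [:: ((0, 0)%N, [:: [:: Zpos 1]])] (behead states).

Definition znumer : zpoly2 := foldr (fun tn acc => zp2add tn.2 acc) [::] znumers.

(* Normalizing comes first because arithmetic leaves zero rows and zero leading
   coefficients behind. *)
Definition zp2pad (a b : nat) (P : zpoly2) : zpoly2 :=
  map (lpad Z0 a) (lpad [::] b (lnorm (@is_nil Z) (map (lnorm (Z.eqb Z0)) P))).

Lemma zp2padE (A : comRingType) (x y : A) a b P :
  zp2eval x y (zp2pad a b P) = zp2eval x y P.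
Proof.
have z0 : zeval A Z0 = 0 by [].
rewrite /zp2eval leval_comp (@eq_leval _ _ _ (zpeval x)) => [|r]; last first.
  by rewrite /= /zpeval leval_pad.
rewrite leval_pad // leval_norm => [|[]//].
rewrite leval_comp; apply: eq_leval => r.
by rewrite /= /zpeval leval_norm //; apply: zeval_null.
Qed.

(** Reversing rows and columns turns [P(x, y)] into [x ^ a * y ^ b * P(1/x, 1/y)], provided that the
    sizes are exactly [a + 1] and [b + 1]. *)
Definition palindromic (a b : nat) (P : zpoly2) : bool :=
  let Q := zp2pad a.+1 b.+1 P in
  [&& size Q == b.+1, all (fun r => size r == a.+1) Q & rev (map rev Q) == Q].

Lemma zp2eval_palindromic (K : fieldType) (x y : K) a b P :
  palindromic a b P -> x != 0 -> y != 0 ->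
  zp2eval x y P = x ^+ a * y ^+ b * zp2eval x^-1 y^-1 P.
Proof.
move=> /and3P[]; set Q := zp2pad _ _ _ => /eqP sQ sr /eqP pal x0 y0.
rewrite -(zp2padE x y a.+1 b.+1) -(zp2padE x^-1 y^-1 a.+1 b.+1) -/Q -{1}pal.
rewrite /zp2eval (leval_rev _ y0 (k := b)); last by rewrite size_map.
rewrite [RHS]mulrAC mulrC; congr (_ * _).
elim: (Q) sr => [|r R IH] /=; first by rewrite mulr0.
move=> /andP[/eqP sr sR]; rewrite mulrDr mulrCA -IH //; congr (_ + _).
by rewrite /zpeval (leval_rev _ x0 (k := a)).
Qed.

(** The exponents are those of the denominator, [(174, 73)], minus [(45, 14)]. *)
Lemma palindromic_znumer : palindromic 129 59 znumer.
Proof. by vm_compute. Qed.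

Lemma znumer_inv (K : fieldType) (x y : K) : x != 0 -> y != 0 ->
  zp2eval x y znumer = x ^+ 129 * y ^+ 59 * zp2eval x^-1 y^-1 znumer.
Proof. exact: zp2eval_palindromic palindromic_znumer. Qed.

Definition denom (A : comRingType) (x y : A) : A :=
  \prod_(s <- behead states) (1 - x ^+ deg_x s * y ^+ deg_y s).

Lemma denom_rmorph (A B : comRingType) (f : {rmorphism A -> B}) x y :
  f (denom x y) = denom (f x) (f y).
Proof.
rewrite rmorph_prod; apply: eq_bigr => s _.
by rewrite rmorphB rmorphM !rmorphXn rmorph1.
Qed.

Lemma prod_neg_monomials (A : comRingType) (x y : A) l :
  \prod_(s <- l) - (x ^+ deg_x s * y ^+ deg_y s) =
  (-1) ^+ size l * x ^+ (\sum_(s <- l) deg_x s)%N * y ^+ (\sum_(s <- l) deg_y s)%N.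
Proof.
elim: l => [|s l IH]; first by rewrite !big_nil !mulr1.
by rewrite !big_cons IH /= exprS !exprD; ring.
Qed.

(** Each factor [1 - m] is [- m] times [1 - m^-1]. The exponents are the sums of [deg_x] and
    [deg_y], and the number of signs, 14, is even. *)
Lemma denom_inv (K : fieldType) (x y : K) : x != 0 -> y != 0 ->
  denom x y = x ^+ 174 * y ^+ 73 * denom x^-1 y^-1.
Proof.
move=> x0 y0.
have -> : x ^+ 174 * y ^+ 73 =
    \prod_(s <- behead states) - (x ^+ deg_x s * y ^+ deg_y s).
  have sumE (f : nat * nat -> nat) :
      (\sum_(s <- behead states) f s = sumn (map f (behead states)))%N.
    by rewrite sumnE big_map.
  by rewrite prod_neg_monomials !sumE /= -signr_odd /= mul1r.
rewrite -big_split /=; apply: eq_bigr => s _.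
rewrite !exprVn -invfM mulrBr mulr1 mulNr mulfV ?opprK ?mulf_neq0 ?expf_neq0 //.
by rewrite addrC.
Qed.

(** * Convergence *)

Lemma cvg_sum_seq (K : numFieldType) (I : Type) (l : seq I) (f : I -> nat -> K) a :
  (forall i, f i n @[n --> \oo] --> a i) ->
  \sum_(i <- l) f i n @[n --> \oo] --> \sum_(i <- l) a i.
Proof.
move=> fa; elim: l => [|i l IH].
  rewrite big_nil; under eq_fun do rewrite big_nil.
  exact: cvg_cst.
rewrite big_cons; under eq_fun do rewrite big_cons.
exact: (cvgD (fa i) IH).
Qed.

Definition later (s t : nat * nat) : bool :=
  (s.1 < t.1)%N || (s.1 == t.1) && (s.2 < t.2)%N.

(** Division by [p] enlarges both lattices and so never increases a corank; here this appears as a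
    vanishing Gaussian coefficient. *)
Lemma step_weight_later p s t : s \in states -> t \in states -> later s t ->
  step_weight p s.1 s.2 t.1 t.2 = 0%N.
Proof.
case: s t => [nu m] [nu' m']; rewrite !mem_states /later /step_weight /=.
move=> /andP[nu4 mnu] /andP[nu4' mnu'] /orP[lt|/andP[/eqP nn lt]].
  by rewrite gauss_small ?muln0 ?mul0n //; lia.
by rewrite -nn in mnu' *; rewrite [X in (_ * (_ * X))%N]gauss_small ?muln0 //;
  lia.
Qed.

Lemma states_pairwise : pairwise later states.
Proof. by []. Qed.

Lemma states_later l1 s l2 t : states = l1 ++ s :: l2 -> t \in l2 -> later s t.
Proof.
move=> e tl; have := states_pairwise; rewrite e pairwise_cat pairwise_cons.
by move=> /and3P[_ _ /andP[/allP/(_ t tl)]].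
Qed.

Lemma step_weight_diag p s : s \in states ->
  (p ^ (4 * s.2) * step_weight p s.1 s.2 s.1 s.2)%N = (p ^ deg_x s)%N.
Proof.
by case: s => nu m _; rewrite /step_weight /deg_x !gaussnn !muln1 /= !expnD mulnA.
Qed.

Lemma mem_behead_cat (T : eqType) (l1 l2 : seq T) x :
  (0 < size l1)%N -> x \in behead (l1 ++ x :: l2).
Proof. by case: l1 => // a l1 _; rewrite /= mem_cat mem_head orbT. Qed.

(** * Solving the triangular system in the limit *)

Section Limits.
Variables (K : numFieldType) (p : nat) (y : K).
Variables (S e : nat * nat -> nat -> K).
Local Notation u s t := (zp2eval p%:R y (zterm s t)).
Hypothesis S_start : S (0, 0)%N n @[n --> \oo] --> (1 : K).
Hypothesis e_small : forall s, s \in behead states ->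
  e s n @[n --> \oo] --> (0 : K).
Hypothesis S_rec : forall s n, s \in behead states ->
  S s n + e s n = \sum_(t <- states) u s t * S t n.
Hypothesis diag_ne1 : forall s, s \in behead states ->
  1 - p%:R ^+ deg_x s * y ^+ deg_y s != 0.

Let udiag s : s \in states -> u s s = p%:R ^+ deg_x s * y ^+ deg_y s.
Proof.
by move=> ss; rewrite ztermE step_weight_diag // natrX mulrC.
Qed.

(** States after [s] have weight zero in the equation for [s], which can therefore be solved for
    [S s n] in terms of convergent sequences, the error [e s n] and the nonzero factor [1 - m]. *)
Lemma cvg_znumer_step nums s l D : D != 0 -> nums != [::] ->
  states = rev (map fst nums) ++ s :: l ->
  (forall tn, tn \in nums ->
     S tn.1 n @[n --> \oo] --> zp2eval p%:R y tn.2 / D) ->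
  forall tn, tn \in znumer_step nums s ->
     S tn.1 n @[n --> \oo] -->
       zp2eval p%:R y tn.2 / (D * (1 - p%:R ^+ deg_x s * y ^+ deg_y s)).
Proof.
move=> D0 nums0 statesE Snums tn.
have ss : s \in behead states.
  by rewrite statesE; apply: mem_behead_cat; rewrite size_rev size_map;
    case: (nums) nums0.
have ss' : s \in states by rewrite statesE mem_cat mem_head orbT.
have m1 := diag_ne1 ss; set m := p%:R ^+ _ * _ in m1 *.
rewrite inE => /predU1P[->|/mapP[tn' tn's ->]] /=; last first.
  rewrite zp2evalM zfactorE -/m [(1 - m) * _]mulrC -mulf_div divff // mulr1.
  exact: Snums.
have -> : S s = fun n =>
  (\sum_(tn <- nums) u s tn.1 * S tn.1 n - e s n) / (1 - m).
  apply/funext => n; apply: (canRL (mulfK m1)); apply/eqP.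
  rewrite eq_sym subr_eq mulrBr mulr1 addrAC S_rec // statesE big_cat big_cons /=.
  rewrite udiag // -/m [X in _ + (_ + X)]big1_seq ?addr0; last first.
    move=> t /andP[_ tl];
      rewrite ztermE step_weight_later ?muln0 ?mulr0 ?mul0r //.
      by rewrite statesE mem_cat inE tl !orbT.
    exact: states_later statesE tl.
  rewrite [m * _]mulrC addrK -(big_map fst predT (fun t => u s t * S t n)).
  by apply/eqP; symmetry; apply/perm_big/permEl/perm_rev.
rewrite invfM mulrA; apply: cvgMr_tmp.
have -> : zp2eval p%:R y (foldr (fun tn0 acc =>
      zp2add (zp2mul (zterm s tn0.1) tn0.2) acc) [::] nums) / D =
    \sum_(tn <- nums) u s tn.1 * (zp2eval p%:R y tn.2 / D) - 0.
  rewrite subr0; elim: (nums) => [|t l' IH]; first by rewrite big_nil /= mul0r.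
  by rewrite big_cons -IH /= zp2evalD zp2evalM mulrDl mulrA.
apply: cvgB; last exact: e_small.
elim: (nums) Snums => [|t l' IH] Sl.
  rewrite big_nil; under eq_fun do rewrite big_nil.
  exact: cvg_cst.
rewrite big_cons; under eq_fun do rewrite big_cons.
apply: cvgD; first by apply: cvgMl_tmp; apply: Sl; rewrite mem_head.
by apply: IH => t' tl; apply: Sl; rewrite inE tl orbT.
Qed.

Lemma cvg_znumers : forall tn, tn \in znumers ->
  S tn.1 n @[n --> \oo] --> zp2eval p%:R y tn.2 / denom p%:R y.
Proof.
suff H l nums D : D != 0 -> nums != [::] -> states = rev (map fst nums) ++ l ->
    (forall tn, tn \in nums ->
       S tn.1 n @[n --> \oo] --> zp2eval p%:R y tn.2 / D) ->
    forall tn, tn \in foldl znumer_step nums l ->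
       S tn.1 n @[n --> \oo] --> zp2eval p%:R y tn.2 /
         (D * \prod_(s <- l) (1 - p%:R ^+ deg_x s * y ^+ deg_y s)).
  have := H (behead states) [:: ((0, 0)%N, [:: [:: Zpos 1]])] 1 (oner_neq0 _).
  rewrite mul1r; apply=> // tn; rewrite inE => /eqP ->; rewrite divr1.
  rewrite (_ : zp2eval _ _ _ = 1); first exact: S_start.
  by rewrite /zp2eval /zpeval /= !mulr0 !addr0.
elim: l nums D => [|s l IH] nums D D0 nums0 sE Sn tn /=.
  by rewrite big_nil mulr1; apply: Sn.
rewrite big_cons mulrA; apply: IH => //.
- rewrite mulf_neq0 ?diag_ne1 // sE.
  by apply: mem_behead_cat; rewrite size_rev size_map; case: (nums) nums0.
- rewrite sE /= rev_cons -map_comp cat_rcons; congr (rev _ ++ _).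
- exact: cvg_znumer_step D0 nums0 sE Sn.
Qed.

End Limits.

(** For odd [p], the number of normal subgroups of index [p ^ n] in state [s]. The interval of
    naturals allows the sum to be split and shifted. *)
Definition weighted_pairs (p : nat) (s : nat * nat) (n : nat) : nat :=
  \sum_(0 <= i < n.+1) num_pairs p i (n - i) s.1 s.2 * (p ^ (n - i)) ^ 4.

Section WeightedPairs.
Variable p : nat.
Hypothesis p_pr : prime p.
Local Notation w s t := (p ^ (4 * s.2) * step_weight p s.1 s.2 t.1 t.2)%N.

Lemma weighted_pairs_small s n : (n < deg_y s)%N -> weighted_pairs p s n = 0%N.
Proof.
move=> ns; rewrite /weighted_pairs big_nat big1 // => i /andP[_ ni].
by rewrite num_pairs_small //; move: ns; rewrite /deg_y; lia.
Qed.

Lemma weighted_pairs0 n : weighted_pairs p (0, 0)%N n = (n == 0%N).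
Proof.
rewrite /weighted_pairs big_nat_recl // num_pairs0 //= subn0 big1 ?addn0 =>
  [|i _].
  by case: n => [|n]; rewrite ?mul0n // expn0 exp1n.
by rewrite num_pairs0.
Qed.

Lemma weighted_pairs_step s n : s \in states ->
  weighted_pairs p s (n + deg_y s) =
  (\sum_(t <- states) weighted_pairs p t n * w s t)%N.
Proof.
move=> ss; rewrite /weighted_pairs /deg_y.
have [nu_le n_le] : (s.1 <= n.+1 + s.1)%N /\
    (n.+1 + s.1 <= (n + (s.1 + s.2)).+1)%N by split; lia.
(* The terms with [i < nu] and those with [i > n + nu] vanish, as one of the two indices is then too
   small for its corank. *)
rewrite (big_cat_nat (n := s.1)) //=; last by lia.
rewrite big_nat big1 ?add0n => [|i /andP[_ i_lt]]; last first.
  by rewrite num_pairs_small //; lia.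
rewrite (big_cat_nat (n := n.+1 + s.1)) //=.
rewrite [X in (_ + X)%N]big_nat [X in (_ + X)%N]big1 ?addn0 =>
  [|i /andP[i_ge i_lt]]; last first.
  by rewrite num_pairs_small //; lia.
rewrite -{1}[s.1]add0n big_addn addnK.
under [RHS]eq_bigr do rewrite big_distrl.
rewrite exchange_big /= big_nat [RHS]big_nat; apply: eq_bigr => i /andP[_ ni].
have -> : (n + (s.1 + s.2) - (i + s.1) = n - i + s.2)%N by lia.
rewrite num_pairs_step -?surjective_pairing // big_distrl /=.
apply: eq_bigr => t _; rewrite expnD expnMn -[((p ^ s.2) ^ 4)%N]expnM.
by rewrite [(s.2 * 4)%N]mulnC; ring.
Qed.

(** A crude exponential rate: a step multiplies the counts by at most the sum of all weights. The
    successor makes it positive and larger than every weight. *)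
Definition growth : nat := (\sum_(s <- states) \sum_(t <- states) w s t).+1.

Lemma weight_growth s t : s \in states -> t \in states -> (w s t < growth)%N.
Proof.
move=> ss ts; rewrite ltnS (big_rem s) //=; apply: leq_trans (leq_addr _ _).
by rewrite (big_rem t) //= leq_addr.
Qed.

Lemma weighted_pairs_growth s n : s \in states ->
  (weighted_pairs p s n <= growth ^ n)%N.
Proof.
have [k] := ubnP n; elim: k n s => // k IH n s nk ss.
have [ns|sn] := ltnP n (deg_y s); first by rewrite weighted_pairs_small.
have [d0|d0] := posnP (deg_y s).
  have -> : s = (0, 0)%N.
    by case: s d0 {ss sn} => a b /eqP;
      rewrite /deg_y addn_eq0 => /andP[/= /eqP -> /eqP ->].
  by rewrite weighted_pairs0; case: (n) => // m; rewrite expn_gt0.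
rewrite -(subnK sn) weighted_pairs_step //.
have nk' : (n - deg_y s < k)%N by lia.
apply: leq_trans (_ : growth ^ (n - deg_y s) * growth <= _)%N; last first.
  by rewrite -expnSr leq_pexp2l // -addn1 leq_add2l.
apply: leq_trans (_ : \sum_(t <- states) growth ^ (n - deg_y s) * w s t <= _)%N.
  rewrite big_seq [X in (_ <= X)%N]big_seq; apply: leq_sum => t ts.
  by rewrite leq_mul2r IH ?orbT.
rewrite -big_distrr leq_mul2l /=; apply/orP; right; apply: leqW.
by rewrite [X in (_ <= X)%N](big_rem s) //= leq_addr.
Qed.

End WeightedPairs.

Section GeneratingFunction.
Variables (K : numFieldType) (p : nat) (y : K).
Hypothesis p_pr : prime p.
Hypothesis small : (growth p)%:R ^+ n * y ^+ n @[n --> \oo] --> (0 : K).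
Hypothesis diag_ne1 : forall s, s \in behead states ->
  1 - p%:R ^+ deg_x s * y ^+ deg_y s != 0.

Let S (s : nat * nat) (n : nat) : K :=
  \sum_(0 <= k < n) (weighted_pairs p s k)%:R * y ^+ k.

Let behead_states s : s \in behead states -> s \in states /\ (0 < deg_y s)%N.
Proof.
move=> sb; have ss : s \in states by apply: mem_behead.
split=> //; have : all (fun s => 0 < deg_y s)%N (behead states) by [].
by move=> /allP; apply.
Qed.

Lemma cvg_weighted_pairs s : s \in states ->
  (weighted_pairs p s n)%:R * y ^+ n @[n --> \oo] --> (0 : K).
Proof.
move=> ss; apply/cvgr0Pnorm_lt => eps eps0.
have /cvgr0Pnorm_lt/(_ _ eps0) := small; apply: filterS => n.
apply: le_lt_trans; rewrite -natrX !normrM ler_wpM2r // !normr_nat ler_nat.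
exact: weighted_pairs_growth.
Qed.

(** The recursion expresses the partial sum of a state up to [n + deg_y s] through the partial sums
    up to [n]. The error [e] collects the [deg_y s] surplus terms, each of which tends to zero. *)
Lemma cvg_generating_function :
  \sum_(0 <= k < n) (\sum_(s <- states) weighted_pairs p s k)%:R * y ^+ k
    @[n --> \oo] --> zp2eval p%:R y znumer / denom p%:R y.
Proof.
pose e (s : nat * nat) (n : nat) : K :=
  \sum_(0 <= k < deg_y s) (weighted_pairs p s (k + n))%:R * y ^+ (k + n).
have S_cvg : forall tn, tn \in znumers ->
    S tn.1 n @[n --> \oo] --> zp2eval p%:R y tn.2 / denom p%:R y.
  apply: (@cvg_znumers K p y S e) => //.
  (* The partial sum is empty at [n = 0] and equals [1] from then on. *)
  - rewrite -(cvg_shiftn 1) /=.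
    under eq_fun => n.
      rewrite /S addn1 big_nat_recl // weighted_pairs0 // mul1r expr0 big1_seq ?addr0.
        over.
      by move=> i _; rewrite weighted_pairs0 // mul0r.
    exact: cvg_cst.
  - move=> s /behead_states[ss _]; rewrite /e.
    have := @cvg_sum_seq K _ (index_iota 0 (deg_y s)) (fun k n =>
      (weighted_pairs p s (k + n))%:R * y ^+ (k + n)) (fun=> 0).
    rewrite big1_eq; apply=> k; have := cvg_weighted_pairs ss.
    rewrite -(cvg_shiftn k) /=.
    have -> // : (fun n => (weighted_pairs p s (n + k))%:R * y ^+ (n + k)) =
        (fun n => (weighted_pairs p s (k + n))%:R * y ^+ (k + n)).
    by apply/funext => n; rewrite addnC.
  - move=> s n /behead_states[ss d0].
    have -> : S s n + e s n = S s (n + deg_y s).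
      rewrite /S [RHS](big_cat_nat (n := n)) ?leq_addr //=; congr (_ + _).
      by rewrite -{2}[n]add0n big_addn addKn.
    rewrite /S addnC (big_cat_nat (n := deg_y s)) ?leq_addr //= big_nat.
    rewrite big1 ?add0r => [|k /andP[_ kd]]; last first.
      by rewrite weighted_pairs_small // mul0r.
    rewrite -{1}[deg_y s]add0n big_addn addKn.
    under [RHS]eq_bigr do rewrite ztermE big_distrr.
    rewrite exchange_big /=; apply: eq_bigr => k _.
    rewrite weighted_pairs_step // natr_sum mulr_suml; apply: eq_bigr => t _.
    by rewrite exprD natrM; ring.
(* The keys of [znumers] are the states in reverse order, so a sum over [znumers] runs over all
   states. *)
have keys nums l : map fst (foldl znumer_step nums l) = rev l ++ map fst nums.
  elim: l nums => //= s l IH nums.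
  by rewrite IH /= -map_comp rev_cons cat_rcons.
have -> : (fun n => \sum_(0 <= k < n)
      (\sum_(s <- states) weighted_pairs p s k)%:R * y ^+ k) =
    (fun n => \sum_(tn <- znumers) S tn.1 n).
  apply/funext => n; under eq_bigr do rewrite natr_sum mulr_suml.
  rewrite exchange_big -(big_map fst predT (fun t => S t n)) {}/znumers keys.
  by symmetry; apply: perm_big.
have -> : zp2eval p%:R y znumer / denom p%:R y =
    \sum_(tn <- znumers) zp2eval p%:R y tn.2 / denom p%:R y.
  rewrite /znumer; elim: (znumers) => [|t l IH];
    first by rewrite big_nil /= mul0r.
  by rewrite big_cons -IH /= zp2evalD mulrDl.
elim: (znumers) S_cvg => [|t l IH] Sl.
  rewrite big_nil; under eq_fun do rewrite big_nil.
  exact: cvg_cst.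
rewrite big_cons; under eq_fun do rewrite big_cons.
apply: cvgD; first by apply: Sl; rewrite mem_head.
by apply: IH => t' tl; apply: Sl; rewrite inE tl orbT.
Qed.

End GeneratingFunction.

(** * Complex powers of positive reals *)

Section ComplexPow.
Variable R : realType.
Implicit Types (x : R) (s t : R[i]).

Lemma complex_powD x s t : 0 < x ->
  complex_pow x (s + t) = complex_pow x s * complex_pow x t.
Proof.
case: s t => [a b] [c d] x0; rewrite /complex_pow /=.
rewrite powRD ?(gt_eqF x0) ?implybT // mulrDl cosD sinD.
by apply/eqP; rewrite eq_complex /= !mul0r !subr0 !addr0; apply/andP; split;
  apply/eqP; ring.
Qed.

Lemma complex_pow0 x : complex_pow x 0 = 1.
Proof. by rewrite /complex_pow /= powRr0 mul0r cos0 sin0 mul1r. Qed.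

Lemma complex_powXn x s n : 0 < x ->
  complex_pow x (- (n%:R * s)) = complex_pow x (- s) ^+ n.
Proof.
move=> x0; elim: n => [|n IH]; first by rewrite mul0r oppr0 complex_pow0 expr0.
by rewrite exprS -IH -complex_powD // -natr1 mulrDl mul1r opprD addrC.
Qed.

Lemma norm_complex_pow x s : 0 < x ->
  `|complex_pow x s| = (x `^ complex.Re s)%:C%C.
Proof.
case: s => a b x0; rewrite /complex_pow normrM /=.
have -> : `|(cos (b * ln x) +i* sin (b * ln x))%C| = 1 :> R[i].
  by rewrite normc_def /= cos2Dsin2 sqrtr1.
by rewrite mulr1 normc_def /= expr0n addr0 sqrtr_sqr ger0_norm ?powR_ge0.
Qed.

End ComplexPow.

(** * The zeta function as a rational function *)

Section Substitution.
Variable K : fieldType.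

Definition ratpoly (q : {poly {poly int}}) : {poly {poly rat}} :=
  map_poly (map_poly intr) q.

Lemma eval2_ratpoly (x y : K) q :
  eval2 (ratpoly q) x y = (map_poly (map_poly intr) q).[x, y].
Proof.
rewrite /eval2 /ratpoly -map_poly_comp_id0 ?map_poly0 //.
congr _.[_, _]; apply: eq_map_poly => r /=.
rewrite -map_poly_comp_id0 ?ratr_int //.
  by apply: eq_map_poly => c /=; rewrite ratr_int.
exact: (ratr_int _ 0).
Qed.

(** Written as a composite of ring morphisms, so that [zp2eval_rmorph] and [denom_rmorph] carry the
    explicit polynomials to any point. *)
Definition eval_int (x y : K) : {poly {poly int}} -> K :=
  horner_eval y \o horner_eval x%:P \o map_poly (map_poly intr).

HB.instance Definition _ x y := GRing.RMorphism.on (eval_int x y).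

Lemma eval_intX x y : eval_int x y 'X = x.
Proof. by rewrite /eval_int /= map_polyX /horner_eval hornerX hornerC. Qed.

Lemma eval_intY x y : eval_int x y 'Y = y.
Proof. by rewrite /eval_int /= map_polyC /= map_polyX /horner_eval hornerC hornerX. Qed.

Lemma eval2_zp2eval (x y : K) P :
  eval2 (ratpoly (zp2eval 'X 'Y P)) x y = zp2eval x y P.
Proof.
rewrite eval2_ratpoly -[LHS]/(eval_int x y _).
by rewrite zp2eval_rmorph /= eval_intX eval_intY.
Qed.

Lemma eval2_denom (x y : K) : eval2 (ratpoly (denom 'X 'Y)) x y = denom x y.
Proof.
rewrite eval2_ratpoly -[LHS]/(eval_int x y _).
by rewrite denom_rmorph /= eval_intX eval_intY.
Qed.

End Substitution.

Local Notation "x %:F" := (@FracField.tofrac _ x).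

Definition ratfun_int (q : {poly {poly int}}) : ratfun2 := (ratpoly q)%:F.

HB.instance Definition _ := GRing.RMorphism.copy ratfun_int
  (@FracField.tofrac _ \o map_poly (map_poly intr)).

Lemma ratfun_intX : ratfun_int 'X = rX.
Proof. by rewrite /ratfun_int /ratpoly map_polyX. Qed.

Lemma ratfun_intY : ratfun_int 'Y = rY.
Proof. by rewrite /ratfun_int /ratpoly map_polyC /= map_polyX. Qed.

Definition zeta_ratfun : ratfun2 :=
  ratfun_int (zp2eval 'X 'Y znumer) / ratfun_int (denom 'X 'Y).

Lemma ratfun_int_zp2eval P : ratfun_int (zp2eval 'X 'Y P) = zp2eval rX rY P.
Proof. by rewrite zp2eval_rmorph /= ratfun_intX ratfun_intY. Qed.

Lemma ratfun_int_denom : ratfun_int (denom 'X 'Y) = denom rX rY.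
Proof. by rewrite denom_rmorph /= ratfun_intX ratfun_intY. Qed.

(** At [X = 1], [Y = 0] every factor takes the value [1], since the [deg_y] are positive. *)
Lemma denom_ratfun_neq0 : denom rX rY != 0.
Proof.
rewrite -ratfun_int_denom /ratfun_int tofrac_eq0; apply/eqP => d0.
have := eval2_denom (1 : rat) 0; rewrite d0 /eval2 !map_poly0 !horner0.
rewrite /denom big1_seq => [/esym/eqP|s /andP[_ sb]]; first by rewrite oner_eq0.
have : all (fun s => 0 < deg_y s)%N (behead states) by [].
by move=> /allP/(_ s sb) s0; rewrite expr0n gtn_eqF // mulr0 subr0.
Qed.

(** The monomials are abstract so that [field] does not meet the large powers. *)
Lemma cancel_monomials (K : fieldType) (a b c d N D : K) :
  a != 0 -> b != 0 -> c != 0 -> d != 0 -> D != 0 ->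
  a * c * (b * d * N / (a * b * (c * d) * D)) = N / D.
Proof. by move=> a0 b0 c0 d0 D0; field; rewrite a0 b0 c0 d0 D0. Qed.

Lemma zeta_ratfun_inv :
  ratfun_value zeta_ratfun rX^-1 rY^-1 (rX ^+ 45 * rY ^+ 14 * zeta_ratfun).
Proof.
have X0 : rX != 0 by rewrite tofrac_eq0 polyX_eq0.
have Y0 : rY != 0 by rewrite tofrac_eq0 polyC_eq0 polyX_eq0.
have D0 := denom_ratfun_neq0; have Dinv := denom_inv X0 Y0.
exists (ratpoly (zp2eval 'X 'Y znumer)), (ratpoly (denom 'X 'Y)).
have D0' : denom rX^-1 rY^-1 != 0.
  by apply: contraNneq D0 => d0; rewrite Dinv d0 mulr0.
rewrite eval2_denom eval2_zp2eval; split=> //.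
rewrite /zeta_ratfun ratfun_int_zp2eval ratfun_int_denom (znumer_inv X0 Y0) Dinv.
move: (zp2eval rX^-1 rY^-1 znumer) (denom rX^-1 rY^-1) D0' => N D D0'.
have -> : rX ^+ 174 = rX ^+ 45 * rX ^+ 129 by rewrite -exprD.
have -> : rY ^+ 73 = rY ^+ 14 * rY ^+ 59 by rewrite -exprD.
have := expf_neq0 45 X0; have := expf_neq0 129 X0.
have := expf_neq0 14 Y0; have := expf_neq0 59 Y0.
move: (rX ^+ 45) (rX ^+ 129) (rY ^+ 14) (rY ^+ 59) => a b c d d0 c0 b0 a0.
exact (cancel_monomials N a0 b0 c0 d0 D0').
Qed.

Lemma num_normal_weighted p n : prime p -> odd p ->
  num_normal_subgroups (free_nilpotent 2 4) (p ^ n)%N =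
  (\sum_(s <- states) weighted_pairs p s n)%N.
Proof.
move=> p_pr p_odd; rewrite num_normal_free_nilpotent // exchange_big /=.
by apply: eq_bigr => s _; rewrite /weighted_pairs big_mkord.
Qed.

(** * The zeta function in a right half-plane *)

Section Convergence.
Variables (R : realType) (p : nat) (s : R[i]).
Hypotheses (p_pr : prime p) (p_odd : odd p).
Hypothesis s_gt : (growth p)%:R < complex.Re s.
Local Notation y := (complex_pow p%:R (- s)).
Local Notation r := (p%:R `^ (- complex.Re s) : R).

Let p0 : 0 < p%:R :> R. Proof. by rewrite ltr0n prime_gt0. Qed.

Let norm_y : `|y| = r%:C%C.
Proof. by rewrite norm_complex_pow //; case: (s). Qed.

(** Because [g < p ^ g], the number [growth p] itself serves as a bound on the real part of [s]. *)
Let r_small : (growth p)%:R * r < 1.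
Proof.
have : r <= p%:R `^ (- (growth p)%:R).
  by apply: ler_powR; [rewrite ler1n prime_gt0|rewrite lerN2 ltW].
rewrite [leRHS]powRN powR_mulrn ?ler0n // => /(ler_wpM2l (ler0n R (growth p))) le.
apply: le_lt_trans le _;
  rewrite -natrX ltr_pdivrMr ?ltr0n ?expn_gt0 ?prime_gt0 //.
by rewrite mul1r ltr_nat ltn_expl // prime_gt1.
Qed.

Lemma growth_cvg0 :
  ((growth p)%:R ^+ n * y ^+ n : R[i]^o) @[n --> \oo] --> (0 : R[i]^o).
Proof.
apply/cvgr0Pnorm_lt => eps eps0.
have : ((growth p)%:R * r) ^+ n @[n --> \oo] --> (0 : R).
  by apply: cvg_expr; rewrite ger0_norm // mulr_ge0 ?ler0n.
(* A positive element of [R[i]] is real, which leaves a real geometric sequence. *)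
have [e0 epsE] : 0 < complex.Re eps /\ eps = (complex.Re eps)%:C%C.
  by case: eps eps0 => a b; rewrite ltcE /= => /andP[/eqP -> a0].
have normE n : `|(growth p)%:R ^+ n * y ^+ n| =
    (((growth p)%:R * r) ^+ n)%:C%C :> R[i].
  rewrite -exprMn normrX normrM normr_nat norm_y rmorphXn rmorphM /=.
  by rewrite -[(growth p)%:R in LHS](rmorph_nat (real_complex R)).
move=> /cvgr0Pnorm_lt/(_ _ e0); apply: filterS => n.
rewrite ger0_norm ?exprn_ge0 ?mulr_ge0 ?ler0n // -ltcR -epsE -normE.
exact: id.
Qed.

(** The norm is below [1]: [p ^ deg_x t] is a weight, hence less than [growth p], and a positive
    power of [r < 1] is at most [r]. *)
Let monomial_ne1 t : t \in behead states ->
  1 - p%:R ^+ deg_x t * y ^+ deg_y t != 0.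
Proof.
move=> tb; have ts : t \in states by apply: mem_behead.
have d0 : (0 < deg_y t)%N.
  have : all (fun t => 0 < deg_y t)%N (behead states) by [].
  by move=> /allP/(_ t tb).
have r_lt1 : r < 1.
  by apply: le_lt_trans r_small; rewrite ler_peMl // ler1n.
rewrite subr_eq0; apply/eqP => /(congr1 Num.norm) /eqP.
rewrite normr1 normrM !normrX norm_y normr_nat eq_sym lt_eqF //.
rewrite -natrX -[(p ^ _)%:R](rmorph_nat (real_complex R)) -rmorphXn -rmorphM /=.
rewrite -[ltRHS]/((1 : R)%:C%C) ltcR; apply: le_lt_trans r_small.
rewrite ler_pM ?ler0n ?exprn_ge0 //.
  by rewrite ler_nat -step_weight_diag // ltnW // weight_growth.
by rewrite -[leRHS]expr1 ler_wiXn2l // ltW.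
Qed.

Lemma zeta_cvg :
  series (normal_zeta_term (free_nilpotent 2 4) p s) n @[n --> \oo] -->
  (zp2eval p%:R y znumer / denom p%:R y : R[i]^o).
Proof.
have -> : series (normal_zeta_term (free_nilpotent 2 4) p s) =
    (fun n => \sum_(0 <= k < n)
      (\sum_(t <- states) weighted_pairs p t k)%:R * y ^+ k).
  apply/funext => n; apply: eq_bigr => k _.
  by rewrite /normal_zeta_term num_normal_weighted // complex_powXn.
exact: (cvg_generating_function p_pr growth_cvg0 monomial_ne1).
Qed.

Lemma zeta_value :
  cvgn (series (normal_zeta_term (free_nilpotent 2 4) p s)) /\
  ratfun_value zeta_ratfun p%:R y (normal_zeta (free_nilpotent 2 4) p s).
Proof.
split; first by apply/cvg_ex; eexists; exact: zeta_cvg.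
exists (ratpoly (zp2eval 'X 'Y znumer)), (ratpoly (denom 'X 'Y)).
rewrite eval2_denom eval2_zp2eval; split=> //.
  rewrite prodf_seq_neq0; apply/allP => t tb; exact: monomial_ne1.
by apply: cvg_lim zeta_cvg; exact: norm_hausdorff.
Qed.

End Convergence.

Theorem corollary1p7 (R : realType) :
  exists W : ratfun2,
    almost_all_primes (fun p : nat =>
      exists sigma : R, forall s : R[i], sigma < complex.Re s ->
        cvgn (series (normal_zeta_term (free_nilpotent 2 4) p s)) /\
        ratfun_value W p%:R (complex_pow p%:R (- s))
          (normal_zeta (free_nilpotent 2 4) p s)) /\
    ratfun_value W rX^-1 rY^-1 (rX ^+ 45 * rY ^+ 14 * W).
Proof.
exists zeta_ratfun; split; last exact: zeta_ratfun_inv.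
(* The only exceptional prime allowed is 2. *)
apply: (@sub_finite_set _ _ [set 2%N]); last exact: finite_set1.
move=> p [p_pr nP]; apply: contrapT => p2; apply: nP.
exists (growth p)%:R => s; apply: zeta_value => //.
by case: (even_prime p_pr).
Qed.
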